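(* Let $\alpha_A,\alpha_B>0$ be coercivity constants of the bilinear forms $A,B$ on $\bm{V}$, and let $C_J=C_\tau^2(1+\mu_{\mathrm{fr}})c_p$, where $C_\tau$ is the constant of the trace inequality. If $$\alpha_A+\frac{\alpha_B}{\Delta t}>C_J$$ (which can always be fulfilled by choosing a sufficiently small time step $\Delta t$), then Problem (Q-D) has a unique solution. That is, for every $n\in\{1,2,\dots,N\}$ there exists a unique pair $(\bm{u}_n^h,p_n^h)\in \bm{V}^h\times Q^h$ such that $$A[\bm{u}_n^h,\bm{v}^h-\delta_t\bm{u}_n^h]+B[\delta_t\bm{u}_n^h,\bm{v}^h-\delta_t\bm{u}_n^h]-\alpha\left(p_n^h,\nabla\cdot(\bm{v}^h-\delta_t\bm{u}_n^h)\right)+J[\bm{u}_n^h,\bm{v}^h]-J[\bm{u}_n^h,\delta_t\bm{u}_n^h]\ge\langle\bm{f}_n^*,\bm{v}^h-\delta_t\bm{u}_n^h\rangle\quad\forall\,\bm{v}^h\in\bm{V}^h,$$ $$\left(c_0\delta_tp_n^h+\alpha\nabla\cdot\delta_t\bm{u}_n^h,q^h\right)+\frac1\mu\left(\bm{K}\nabla p_n^h,\nabla q^h\right)=(\psi_n,q^h)\quad\forall\,q^h\in Q^h.$$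
   Context: Domain and parameters: $\Omega\subset\mathbb{R}^d$, $d\in\{2,3\}$, is an open, bounded, connected domain with Lipschitz boundary $\Gamma$ and outward unit normal $\bm{\nu}$. The boundary is decomposed into disjoint subsets in two ways: $\Gamma=\Gamma_p\cup\Gamma_f$ and $\Gamma=\Gamma_d\cup\Gamma_n\cup\Gamma_c$, with $\Gamma_d$ and $\Gamma_p$ of positive measure. Constants: Lamé constants $G>0,\lambda>0$; viscoelastic parameter $\gamma>0$; Biot coefficient $\alpha>0$; storage coefficient $c_0>0$; viscosity $\mu>0$; normal stiffness $c_p>0$; friction coefficient $\mu_{\mathrm{fr}}\ge0$. $\bm{K}$ is a symmetric, bounded matrix field on $\Omega$, uniformly positive definite in space and constant in time. Notation: $(\cdot,\cdot)$ is the $L^2(\Omega)$ inner product for scalar-, vector- or tensor-valued functions; $(\cdot,\cdot)_{\Gamma_n}$ is the $L^2(\Gamma_n)$ inner product. Traces are written like the functions themselves. On $\Gamma_c$, $v_\nu=\bm{v}\cdot\bm{\nu}$ and $\bm{v}_\tau=\bm{v}-v_\nu\bm{\nu}$; $(\cdot)_+$ is the positive part. $\bm{\varepsilon}(\bm{u})=\frac12(\nabla\bm{u}+(\nabla\bm{u})^T)$. Spaces: $Q=\{q\in H^1(\Omega): q=0\text{ on }\Gamma_p\}$, $\bm{V}=\{\bm{v}\in \bm{H}^1(\Omega)=H^1(\Omega)^d:\bm{v}=\bm{0}\text{ on }\Gamma_d\}$. $C_\tau>0$ is a constant with $\|v\|_{L^2(\Gamma)}\le C_\tau\|v\|_{H^1(\Omega)}$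 for all $v\in H^1(\Omega)$ (also for vector-valued functions). Forms: $A[\bm{u},\bm{v}]=2G(\bm{\varepsilon}(\bm{u}),\bm{\varepsilon}(\bm{v}))+\lambda(\nabla\cdot\bm{u},\nabla\cdot\bm{v})$, $B[\bm{u},\bm{v}]=\gamma(\bm{\varepsilon}(\bm{u}),\bm{\varepsilon}(\bm{v}))+\gamma(\nabla\cdot\bm{u},\nabla\cdot\bm{v})$; these are continuous on $\bm{V}$ and coercive: $A[\bm{v},\bm{v}]\ge\alpha_A\|\bm{v}\|_{H^1(\Omega)}^2$, $B[\bm{v},\bm{v}]\ge\alpha_B\|\bm{v}\|_{H^1(\Omega)}^2$ for all $\bm{v}\in\bm{V}$. With a gap function $g\in L^2(\Gamma_c)$, $$J[\bm{u},\bm{v}]=\int_{\Gamma_c}c_p(u_\nu-g)_+v_\nu\,ds+\int_{\Gamma_c}\mu_{\mathrm{fr}}c_p(u_\nu-g)_+|\bm{v}_\tau|\,ds.$$ Discretization: $T>0$, $N\ge1$, $\Delta t=T/N$, $t_n=n\Delta t$; for time-continuous $v$, $v_n=v(\cdot,t_n)$; $\delta_tv_n=(v_n-v_{n-1})/\Delta t$. $\mathcal{T}^h$ is a member of a regular family of conforming triangulations of $\overline\Omega$ with maximal element diameter $h$; $k_1,k_2\ge1$; $\bm{V}^h=\{\bm{v}^h\in\bm{V}:\bm{v}^h|_T\in\mathbb{P}_{k_1}(T)^d\ \forall T\in\mathcal{T}^h\}$, $Q^h=\{q^h\in Q:q^h|_T\in\mathbb{P}_{k_2}(T)\ \forall T\in\mathcal{T}^h\}$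 (continuous Lagrange finite elements). $\bm{u}^I$ and $p^I$ denote the standard Lagrange interpolants of $\bm{u}\in\bm{V}$ in $\bm{V}^h$ and of $p\in Q$ in $Q^h$. Problem (Q-D): the data satisfy $\bm{f}\in H^1(0,T;\bm{L}^2(\Omega))$, $\bm{b}\in H^1(0,T;\bm{L}^2(\Gamma_n))$, $\psi\in H^1(0,T;L^2(\Omega))$, $g\in L^2(\Gamma_c)$, and $\langle\bm{f}^*,\bm{v}\rangle=(\bm{f},\bm{v})+(\bm{b},\bm{v})_{\Gamma_n}$ for $\bm{v}\in\bm{V}$. Given $p_0\in Q$, $\bm{u}_0\in\bm{V}$, set $p_0^h=p_0^I$, $\bm{u}_0^h=\bm{u}_0^I$. For $n=1,\dots,N$, given $\bm{u}_{n-1}^h,p_{n-1}^h$, find $\bm{u}_n^h\in\bm{V}^h$ and $p_n^h\in Q^h$ satisfying the variational inequality and the variational equation displayed in the claim, where $\delta_t\bm{u}_n^h=(\bm{u}_n^h-\bm{u}_{n-1}^h)/\Delta t$ and $\delta_tp_n^h=(p_n^h-p_{n-1}^h)/\Delta t$. *)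

(* Defs.v *)
From HB Require Import structures.
From mathcomp Require Import all_boot all_order all_algebra.
From mathcomp Require Import all_classical all_reals all_analysis.

Set Implicit Arguments.
Unset Strict Implicit.
Unset Printing Implicit Defensive.

Import Order.TTheory GRing.Theory Num.Theory.
Import numFieldNormedType.Exports.

Local Open Scope classical_set_scope.
Local Open Scope ring_scope.

(* R^d is 'rV[R]_d.  Its sigma-algebra is generated by the coordinates, i.e.
   it is the Borel sigma-algebra. *)
Definition measure_rV_display : measure_display -> measure_display.
Proof. exact. Qed.

Section measurable_rV.
Context {disp : measure_display} {T : sigmaRingType disp} (n : nat).

Let coors : 'I_n -> 'rV[T]_n -> T := fun i x => x ord0 i.

Let rV_set0 : g_sigma_preimage coors set0.
Proof. exact: sigma_algebra0. Qed.

Let rV_setC A : g_sigma_preimage coors A -> g_sigma_preimage coors (~` A).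
Proof. exact: sigma_algebraC. Qed.

Let rV_bigcup (F : (set 'rV[T]_n)^nat) :
  (forall i, g_sigma_preimage coors (F i)) ->
  g_sigma_preimage coors (\bigcup_i (F i)).
Proof. exact: sigma_algebra_bigcup. Qed.

HB.instance Definition _ := @isMeasurable.Build (measure_rV_display disp)
  'rV[T]_n (g_sigma_preimage coors) rV_set0 rV_setC rV_bigcup.

Lemma measurable_coor (i : 'I_n) :
  measurable_fun [set: 'rV[T]_n] (fun x : 'rV[T]_n => x ord0 i).
Proof.
move=> _ Y mY; rewrite setTI; apply: sub_sigma_algebra => /=.
rewrite -bigcup_seq/=; exists i => /=; first by rewrite mem_index_enum.
by exists Y => //; rewrite setTI.
Qed.

End measurable_rV.

Lemma measurable_fun_rV (d1 d2 : measure_display) (T1 : measurableType d1)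
    (T2 : measurableType d2) (n : nat) (f : T1 -> 'rV[T2]_n) :
  (forall i, measurable_fun [set: T1] (fun x => f x ord0 i)) ->
  measurable_fun [set: T1] f.
Proof.
move=> mf _ A mA; rewrite setTI.
suff : g_sigma_preimage (fun (i : 'I_n) (x : 'rV[T2]_n) => x ord0 i) `<=`
    [set B | measurable (f @^-1` B)] by apply.
apply: smallest_sub.
  split => /=.
  - by rewrite preimage_set0; exact: measurable0.
  - by move=> B mB; rewrite setTD preimage_setC; exact: measurableC.
  - by move=> F mF; rewrite preimage_bigcup; exact: bigcupT_measurable.
rewrite -bigcup_seq => B [i _ [C mC <-]] /=.
rewrite setTI -comp_preimage.
by have := mf i measurableT C mC; rewrite setTI.
Qed.

Section lebesgue_rV.
Context {R : realType}.

Definition row_cons n (z : R * 'rV[R]_n) : 'rV[R]_n.+1 :=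
  \row_i (if unlift ord0 i is Some j then z.2 ord0 j else z.1).

Lemma measurable_row_cons n : measurable_fun setT (@row_cons n).
Proof.
apply: measurable_fun_rV => i.
case: (unliftP ord0 i) => [j|] ->.
  rewrite (_ : (fun _ => _) = (fun x : 'rV[R]_n => x ord0 j) \o snd); last first.
    by apply/funext => z /=; rewrite mxE liftK.
  exact: measurableT_comp (measurable_coor j) measurable_snd.
rewrite (_ : (fun _ => _) = fst); first exact: measurable_fst.
by apply/funext => z /=; rewrite mxE unlift_none.
Qed.

Definition row_uncons n (x : 'rV[R]_n.+1) : R * 'rV[R]_n :=
  (x ord0 ord0, \row_j x ord0 (lift ord0 j)).

Lemma measurable_row_uncons n : measurable_fun setT (@row_uncons n).
Proof.
apply/measurable_fun_pairP; split; first exact: measurable_coor.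
apply: measurable_fun_rV => i /=.
by under eq_fun do rewrite mxE; exact: measurable_coor.
Qed.

Lemma row_consK n : cancel (@row_cons n) (@row_uncons n).
Proof.
case=> a v; rewrite /row_uncons /row_cons /= mxE unlift_none; congr pair.
by apply/rowP => j; rewrite !mxE liftK.
Qed.

Section step.
Context (n : nat) (m : {sigma_finite_measure set 'rV[R]_n -> \bar R}).

Let prod : {measure set (measurableTypeR R * 'rV[R]_n)%type -> \bar R} :=
  (@lebesgue_measure R \x m)%E.

Definition lebesgue_step : set 'rV[R]_n.+1 -> \bar R :=
  fun A => prod (@row_cons n @^-1` A).

Let mpre (A : set 'rV[R]_n.+1) :
  measurable A -> measurable (@row_cons n @^-1` A : set (measurableTypeR R * _)).
Proof. by move=> mA; rewrite -[X in measurable X]setTI; exact: measurable_row_cons. Qed.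

Let step0 : lebesgue_step set0 = 0%E.
Proof. by rewrite /lebesgue_step preimage_set0 measure0. Qed.

Let step_ge0 A : (0 <= lebesgue_step A)%E.
Proof. exact: measure_ge0. Qed.

Let step_additive : semi_sigma_additive lebesgue_step.
Proof.
move=> F mF tF mUF; rewrite /lebesgue_step preimage_bigcup.
apply: measure_semi_sigma_additive.
- by move=> k; exact: mpre.
- apply/trivIsetP => /= i j _ _ ij; rewrite -preimage_setI.
  by move/trivIsetP : tF => /(_ _ _ _ _ ij) ->//; rewrite preimage_set0.
- by rewrite -preimage_bigcup; exact: mpre.
Qed.

HB.instance Definition _ := isMeasure.Build _ _ _ lebesgue_step
  step0 step_ge0 step_additive.

Let step_sigma_finite : sigma_finite setT lebesgue_step.
Proof.
have /sigma_finiteP[F [TF ndF Foo]] := sigma_finiteT (@lebesgue_measure R).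
have /sigma_finiteP[G [TG ndG Goo]] := sigma_finiteT m.
exists (fun k => @row_uncons n @^-1` (F k `*` G k)).
  rewrite -preimage_bigcup (_ : \bigcup_k _ = setT) ?preimage_setT//.
  rewrite -setXTT TF TG predeqE => -[x y]; split.
    by move=> [k _ []/= ? ?]; split; exists k.
  move=> [/= [k _ Fkx] [l _ Gly]]; exists (maxn k l) => //; split.
  - by move: x Fkx; exact/subsetPset/ndF/leq_maxl.
  - by move: y Gly; exact/subsetPset/ndG/leq_maxr.
move=> k; have [mF Fk] := Foo k; have [mG Gk] := Goo k; split.
  rewrite -[X in measurable X]setTI; apply: measurable_row_uncons => //.
  exact: measurableX.
rewrite /lebesgue_step -comp_preimage (_ : _ \o _ = id); last first.
  by apply/funext => z; exact: row_consK.
rewrite /prod /= product_measure1E// lte_mul_pinfty// ge0_fin_numE//.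
Qed.

HB.instance Definition _ := @Measure_isSigmaFinite.Build _ _ _
  lebesgue_step step_sigma_finite.

End step.

(* d-dimensional Lebesgue measure, as the d-fold product of lebesgue_measure *)
Fixpoint lebesgue_rV (d : nat) : {sigma_finite_measure set 'rV[R]_d -> \bar R} :=
  match d with
  | 0 => @dirac _ 'rV[R]_0 0 R
  | n.+1 => lebesgue_step (lebesgue_rV n)
  end.

End lebesgue_rV.

Section euclidean.
Context {R : realType} {d : nat}.
Implicit Types x y z e : 'rV[R]_d.

(* The library norm of 'rV[R]_d is the sup norm; this is the Euclidean one. *)
Definition dotp x y : R := \sum_i x ord0 i * y ord0 i.
Definition enorm x : R := Num.sqrt (dotp x x).
Definition eball x (r : R) : set 'rV[R]_d := [set y | enorm (y - x) < r].

Definition ediam (A : set 'rV[R]_d) : \bar R :=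
  ereal_sup (0%E |` [set (enorm (x.1 - x.2))%:E | x in A `*` A]).

Definition frob (A B : 'M[R]_d) : R := \sum_i \sum_j A i j * B i j.

Definition boundary (Om : set 'rV[R]_d) : set 'rV[R]_d := closure Om `\` Om°.

(* component of z orthogonal to the unit vector e *)
Definition perp e z : 'rV[R]_d := z - dotp z e *: e.

(* Near each boundary point x, in orthonormal coordinates centred at x with
   last axis e, Om is the subgraph of a Lipschitz function phi of the
   coordinates orthogonal to e. *)
Definition lipschitz_domain (Om : set 'rV[R]_d) : Prop :=
  forall x, boundary Om x ->
  exists e (r s L : R) (phi : 'rV[R]_d -> R),
    [/\ enorm e = 1, 0 < r, 0 < s,
        forall y z, `|phi y - phi z| <= L * enorm (y - z) &
        forall y, enorm (perp e (y - x)) < r -> `|dotp (y - x) e| < s ->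
          (Om y <-> dotp (y - x) e < phi (perp e (y - x))) /\
          (boundary Om y <-> dotp (y - x) e = phi (perp e (y - x)))].

(* n is the outward unit normal of Om at x: the boundary has tangent
   hyperplane n^perp at x, with Om on the side of -n.  At a boundary point
   where a local graph function phi is differentiable, this is the usual
   normalised (- grad phi, 1). *)
Definition outward_unit_normal (Om : set 'rV[R]_d) x (n : 'rV[R]_d) : Prop :=
  enorm n = 1 /\
  forall eta : R, 0 < eta -> exists2 r : R, 0 < r & forall y,
    enorm (y - x) < r ->
    (dotp (y - x) n < - (eta * enorm (y - x)) -> Om y) /\
    (eta * enorm (y - x) < dotp (y - x) n -> ~ Om y).

End euclidean.

Section hausdorff.
Context {R : realType} {d : nat}.
Implicit Types A : set 'rV[R]_d.
Local Open Scope ereal_scope.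

(* Normalised so that it agrees with s-dimensional area on s-dimensional
   surfaces (s > 0): volume of the unit ball of R^s over 2^s. *)
Definition hausdorff_cst (s : nat) : \bar R :=
  lebesgue_rV s (eball (0 : 'rV[R]_s)%R 1%R) * ((2 ^- s)%R)%:E.

Definition hausdorff_pre (s : nat) (delta : R) A : \bar R :=
  ereal_inf [set \sum_(0 <= k <oo) (hausdorff_cst s * ediam (E k) ^+ s) |
    E in [set E : nat -> set 'rV[R]_d |
      A `<=` \bigcup_k E k /\ forall k, ediam (E k) <= delta%:E]].

Definition hausdorff (s : nat) A : \bar R :=
  ereal_sup [set hausdorff_pre s delta A | delta in [set x : R | (0 < x)%R]].

(* sg is the surface measure of the boundary of Om, as a Borel measure on R^d *)
Definition surface_measure (Om : set 'rV[R]_d)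
    (sg : {measure set 'rV[R]_d -> \bar R}) : Prop :=
  forall A, measurable A -> sg A = hausdorff d.-1 (A `&` boundary Om).

End hausdorff.

Section L2.
Context {disp : measure_display} {X : measurableType disp} {R : realType}.
Variable mu : {measure set X -> \bar R}.

Definition L2 (D : set X) (f : X -> R) : Prop :=
  measurable_fun D f /\ (\int[mu]_(x in D) ((f x ^+ 2)%:E) < +oo)%E.

Definition L2V d (D : set X) (f : X -> 'rV[R]_d) : Prop :=
  forall i, L2 D (fun x => f x ord0 i).

Definition ip (D : set X) (f g : X -> R) : R := \int[mu]_(x in D) (f x * g x).
Definition ipV d (D : set X) (f g : X -> 'rV[R]_d) : R :=
  \int[mu]_(x in D) dotp (f x) (g x).
Definition ipT d (D : set X) (f g : X -> 'M[R]_d) : R :=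
  \int[mu]_(x in D) frob (f x) (g x).

End L2.

Section time.
Context {disp : measure_display} {X : measurableType disp} {R : realType}.
Variable mu : {measure set X -> \bar R}.

Definition time_itv (T : R) : set R := `]0, T[%classic.

(* C^1 functions with compact support in ]0, T[ *)
Definition time_test (T : R) (phi : R -> R) : Prop :=
  [/\ forall t, derivable phi t 1, continuous (fun t => 'D_1 phi t),
      compact (closure [set t | phi t != 0]) &
      closure [set t | phi t != 0] `<=` time_itv T].

Definition L2time (T : R) (D : set X) (f : R -> X -> R) : Prop :=
  measurable_fun (time_itv T `*` D) (fun z : R * X => f z.1 z.2) /\
  (\int[lebesgue_measure]_(t in time_itv T)
     \int[mu]_(x in D) ((f t x ^+ 2)%:E) < +oo)%E.

(* f is (the representative that is continuous in time of) an element of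
   H^1(0,T; L^2(D)) *)
Definition H1time (T : R) (D : set X) (f : R -> X -> R) : Prop :=
  [/\ L2time T D f,
      exists2 f' : R -> X -> R, L2time T D f' &
        forall phi, time_test T phi -> {ae mu, forall x, D x ->
          \int[lebesgue_measure]_(t in time_itv T) (f t x * 'D_1 phi t) =
          - \int[lebesgue_measure]_(t in time_itv T) (f' t x * phi t)},
      forall t, 0 <= t <= T -> L2 mu D (f t) &
      forall t, 0 <= t <= T ->
        (\int[mu]_(x in D) (((f s x - f t x) ^+ 2)%:E))%E
          @[s --> within `[0, T] (nbhs t)] --> 0%E].

Definition H1timeV d (T : R) (D : set X) (f : R -> X -> 'rV[R]_d) : Prop :=
  forall i, H1time T D (fun t x => f t x ord0 i).

End time.

Section sobolev.
Context {R : realType} {d : nat}.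
Variables (Om : set 'rV[R]_d) (sg : {measure set 'rV[R]_d -> \bar R}).
Implicit Types (v w phi : 'rV[R]_d -> R) (u : 'rV[R]_d -> 'rV[R]_d).

Local Notation leb := (lebesgue_rV d).
Local Notation Gam := (boundary Om).

Definition cpnt u (i : 'I_d) : 'rV[R]_d -> R := fun x => u x ord0 i.

Definition pderiv phi (i : 'I_d) : 'rV[R]_d -> R :=
  fun x => 'D_(delta_mx ord0 i) phi x.

Definition is_C1 phi : Prop := forall i,
  (forall x, derivable phi x (delta_mx ord0 i)) /\ continuous (pderiv phi i).

Definition test_function phi : Prop :=
  [/\ is_C1 phi, compact (closure [set x | phi x != 0]) &
      closure [set x | phi x != 0] `<=` Om].

Definition is_wgrad v (g : 'rV[R]_d -> 'rV[R]_d) : Prop :=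
  L2V leb Om g /\
  forall i phi, test_function phi ->
    ip leb Om v (pderiv phi i) = - ip leb Om (cpnt g i) phi.

Definition H1 v : Prop := L2 leb Om v /\ exists g, is_wgrad v g.

(* a weak gradient of v, unique up to a null set; junk if v is not in H^1 *)
Definition wgrad v : 'rV[R]_d -> 'rV[R]_d := xget (fun=> 0) [set g | is_wgrad v g].

Definition H1norm v : R :=
  Num.sqrt (ip leb Om v v + ipV leb Om (wgrad v) (wgrad v)).

(* w is the trace of v on the boundary: the L^2 limit of the restrictions of
   C^1 functions converging to v in H^1 *)
Definition is_trace v w : Prop :=
  [/\ H1 v, L2 sg Gam w &
      exists phi : nat -> 'rV[R]_d -> R,
      [/\ forall k, is_C1 (phi k),
          (\int[leb]_(x in Om) (((v x - phi k x) ^+ 2)%:E))%E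
             @[k --> \oo] --> 0%E,
          forall i, (\int[leb]_(x in Om)
             (((cpnt (wgrad v) i x - pderiv (phi k) i x) ^+ 2)%:E))%E
             @[k --> \oo] --> 0%E &
          (\int[sg]_(x in Gam) (((w x - phi k x) ^+ 2)%:E))%E
             @[k --> \oo] --> 0%E]].

Definition bdtrace v : 'rV[R]_d -> R := xget (fun=> 0) [set w | is_trace v w].

Definition trace_inequality (C : R) : Prop :=
  forall v w, is_trace v w -> Num.sqrt (ip sg Gam w w) <= C * H1norm v.

(* {v in H^1(Om) : v = 0 on D}, D being a part of the boundary *)
Definition H1_zero (D : set 'rV[R]_d) v : Prop :=
  exists2 w, is_trace v w & {ae sg, forall x, D x -> w x = 0}.

Definition H1_zeroV (D : set 'rV[R]_d) u : Prop := forall i, H1_zero D (cpnt u i).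

Definition H1normV u : R := Num.sqrt (\sum_i H1norm (cpnt u i) ^+ 2).

Definition jacobian u (x : 'rV[R]_d) : 'M[R]_d := \matrix_(i, j) wgrad (cpnt u i) x ord0 j.
Definition sym_grad u (x : 'rV[R]_d) : 'M[R]_d := 2^-1 *: (jacobian u x + (jacobian u x)^T).
Definition divg u (x : 'rV[R]_d) : R := \tr (jacobian u x).
Definition bdtraceV u (x : 'rV[R]_d) : 'rV[R]_d := \row_i bdtrace (cpnt u i) x.

End sobolev.

Section forms.
Context {R : realType} {d : nat}.
Variables (Om : set 'rV[R]_d) (sg : {measure set 'rV[R]_d -> \bar R}).
Implicit Types (u v : 'rV[R]_d -> 'rV[R]_d) (p q : 'rV[R]_d -> R).

Local Notation leb := (lebesgue_rV d).

Definition elastic_form (G lam : R) u v : R :=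
  2 * G * ipT leb Om (sym_grad Om u) (sym_grad Om v)
  + lam * ip leb Om (divg Om u) (divg Om v).

Definition viscous_form (gam : R) u v : R :=
  gam * ipT leb Om (sym_grad Om u) (sym_grad Om v)
  + gam * ip leb Om (divg Om u) (divg Om v).

Definition coercive (V : set ('rV[R]_d -> 'rV[R]_d))
    (a : ('rV[R]_d -> 'rV[R]_d) -> ('rV[R]_d -> 'rV[R]_d) -> R) (c : R) : Prop :=
  forall v, V v -> c * H1normV Om v ^+ 2 <= a v v.

Variables (nu : 'rV[R]_d -> 'rV[R]_d).

Definition normal_part u (x : 'rV[R]_d) : R := dotp (bdtraceV Om sg u x) (nu x).
Definition tangential_part u (x : 'rV[R]_d) : 'rV[R]_d :=
  bdtraceV Om sg u x - normal_part u x *: nu x.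

Definition contact_form (Gc : set 'rV[R]_d) (cp mufr : R) (g : 'rV[R]_d -> R) u v : R :=
  \int[sg]_(x in Gc) (cp * Num.max 0 (normal_part u x - g x) * normal_part v x)
  + \int[sg]_(x in Gc)
      (mufr * cp * Num.max 0 (normal_part u x - g x) * enorm (tangential_part v x)).

(* <f*, v> = (f, v) + (b, v)_{Gn} *)
Definition load_form (Gn : set 'rV[R]_d) (f b : 'rV[R]_d -> 'rV[R]_d) v : R :=
  ipV leb Om f v + ipV sg Gn b (bdtraceV Om sg v).

(* (K grad p, grad q) *)
Definition darcy_form (K : 'rV[R]_d -> 'M[R]_d) p q : R :=
  ipV leb Om (fun x => wgrad Om p x *m (K x)^T) (wgrad Om q).

(* symmetric, bounded, uniformly positive definite *)
Definition permeability (K : 'rV[R]_d -> 'M[R]_d) : Prop :=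
  [/\ forall i j, measurable_fun Om (fun x => K x i j),
      {ae leb, forall x, Om x -> (K x)^T = K x},
      exists M : R, {ae leb, forall x, Om x -> forall i j, `|K x i j| <= M} &
      exists2 k0 : R, 0 < k0 & {ae leb, forall x, Om x ->
        forall z : 'rV[R]_d, k0 * enorm z ^+ 2 <= dotp (z *m (K x)^T) z}].

End forms.

Section finite_elements.
Context {R : realType} {d : nat}.
Implicit Types (a : 'I_d.+1 -> 'rV[R]_d) (S : {set 'I_d.+1}).

(* A simplex is given by its d+1 vertices a. *)
Definition affinely_independent a : Prop :=
  forall c : 'I_d.+1 -> R, \sum_i c i = 0 -> \sum_i c i *: a i = 0 ->
  forall i, c i = 0.

(* convex hull of the vertices a i, i in S; empty when S is *)
Definition face a S : set 'rV[R]_d :=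
  [set x | exists c : 'I_d.+1 -> R,
    [/\ forall i, 0 <= c i, forall i, i \notin S -> c i = 0,
        \sum_i c i = 1 & x = \sum_i c i *: a i]].

Definition simplex a : set 'rV[R]_d := face a [set: 'I_d.+1]%SET.

Record triangulation := Triangulation {
  ncells : nat;
  vertices : 'I_ncells -> 'I_d.+1 -> 'rV[R]_d }.

Definition cell (M : triangulation) (k : 'I_(ncells M)) : set 'rV[R]_d :=
  simplex (@vertices M k).

(* Two distinct cells meet in a common proper face, possibly empty. *)
Definition conforming (Om : set 'rV[R]_d) (M : triangulation) : Prop :=
  [/\ forall k, affinely_independent (@vertices M k),
      closure Om = \bigcup_k @cell M k &
      forall k l, k != l -> exists S1 S2 : {set 'I_d.+1},
        [/\ exists i, i \notin S1,
            [set @vertices M k i | i in [set` S1]] =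
            [set @vertices M l i | i in [set` S2]] &
            @cell M k `&` @cell M l = face (@vertices M k) S1]].

(* shape regularity: the diameter of each cell is at most kappa times the
   radius of some ball contained in it *)
Definition regular_family (Om : set 'rV[R]_d) (F : set triangulation) : Prop :=
  (forall M, F M -> conforming Om M) /\
  exists2 kappa : R, 0 < kappa & forall M, F M -> forall k,
    exists x r, [/\ 0 < r, eball x r `<=` @cell M k &
                    (ediam (@cell M k) <= (kappa * r)%:E)%E].

(* v agrees on T with a polynomial of total degree at most k *)
Definition poly_on (k : nat) (T : set 'rV[R]_d) (v : 'rV[R]_d -> R) : Prop :=
  exists c : {ffun 'I_d -> 'I_k.+1} -> R, forall x, T x ->
    v x = \sum_(m : {ffun 'I_d -> 'I_k.+1} | (\sum_i m i <= k)%N)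
             c m * \prod_i x ord0 i ^+ m i.

Definition fe_space (M : triangulation) (k : nat) (Q : set ('rV[R]_d -> R)) :
    set ('rV[R]_d -> R) :=
  [set q | Q q /\ forall c, poly_on k (@cell M c) q].

Definition fe_spaceV (M : triangulation) (k : nat)
    (V : set ('rV[R]_d -> 'rV[R]_d)) : set ('rV[R]_d -> 'rV[R]_d) :=
  [set v | V v /\ forall c i, poly_on k (@cell M c) (cpnt v i)].

(* Lagrange nodes of order k of the simplex with vertices a *)
Definition lagrange_nodes (k : nat) a : set 'rV[R]_d :=
  [set x | exists m : 'I_d.+1 -> nat,
    (\sum_i m i = k)%N /\ x = \sum_i ((m i)%:R / k%:R) *: a i].

(* w has the nodal values of the continuous representative of v *)
Definition nodal_interpolant (Om : set 'rV[R]_d) (M : triangulation) (k : nat)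
    (v w : 'rV[R]_d -> R) : Prop :=
  exists vc : 'rV[R]_d -> R,
    [/\ {within closure Om, continuous vc},
        {ae lebesgue_rV d, forall x, Om x -> vc x = v x} &
        forall c x, lagrange_nodes k (@vertices M c) x -> w x = vc x].

Definition lagrange_interpolant Om M k (Qh : set ('rV[R]_d -> R))
    (p pI : 'rV[R]_d -> R) : Prop :=
  Qh pI /\ nodal_interpolant Om M k p pI.

Definition lagrange_interpolantV Om M k (Vh : set ('rV[R]_d -> 'rV[R]_d))
    (u uI : 'rV[R]_d -> 'rV[R]_d) : Prop :=
  Vh uI /\ forall i, nodal_interpolant Om M k (cpnt u i) (cpnt uI i).

End finite_elements.
Arguments triangulation : clear implicits.

(* One time step of the discrete problem: from the previous iterate
   (u0, p0), the unknowns are u and p, with du = (u - u0) / dt and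
   dp = (p - p0) / dt. *)
Definition QD_step (R : realType) (d : nat) (Om : set 'rV[R]_d)
    (Vh : set ('rV[R]_d -> 'rV[R]_d)) (Qh : set ('rV[R]_d -> R))
    (A B J : ('rV[R]_d -> 'rV[R]_d) -> ('rV[R]_d -> 'rV[R]_d) -> R)
    (D : ('rV[R]_d -> R) -> ('rV[R]_d -> R) -> R)
    (alpha c0 mu dt : R)
    (F : ('rV[R]_d -> 'rV[R]_d) -> R) (psi : 'rV[R]_d -> R)
    (u0 : 'rV[R]_d -> 'rV[R]_d) (p0 : 'rV[R]_d -> R)
    (u : 'rV[R]_d -> 'rV[R]_d) (p : 'rV[R]_d -> R) : Prop :=
  let leb := lebesgue_rV d in
  let du x := dt^-1 *: (u x - u0 x) in
  let dp x := (p x - p0 x) / dt in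
  [/\ Vh u, Qh p,
      forall v, Vh v ->
        A u (v \- du) + B du (v \- du) - alpha * ip leb Om p (divg Om (v \- du))
        + J u v - J u du >= F (v \- du) &
      forall q, Qh q ->
        ip leb Om (fun x => c0 * dp x + alpha * divg Om du x) q + mu^-1 * D p q
        = ip leb Om psi q].

(* Main.v *)
Require Import Defs.
From HB Require Import structures.
From mathcomp Require Import all_boot all_order all_algebra.
From mathcomp Require Import all_classical all_reals all_analysis.
From mathcomp Require Import measurable_realfun ring lra.

(** Every time step is a strongly monotone quasi-variational inequality in
    finite dimension. Take the discrete velocity [w] and the pressure [p] as
    unknowns; the displacement is [u0 + dt w], where [u0] is the previous one.
    Adding the inequality to the equation gives a single inequality for the pair,
    whose bilinear form is [dt A + B] in the velocities, [c0/dt] times the L^2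
    product plus the Darcy form over [mu] in the pressures, and two coupling terms
    that cancel on the diagonal. By coercivity of [A] and [B] this form is bounded
    below by [m = dt alphaA + alphaB] times the square of a norm made of the H^1
    norm of the velocity and a weighted L^2 norm of the pressure. The contact term
    [J (u0 + dt w) v] is convex and Lipschitz in [v], and its dependence on [w] is
    controlled by [contact_form_four_terms] with the constant [L = dt CJ]: the
    positive part is 1-Lipschitz, normal and tangential components are bounded by
    the trace, and the trace inequality is used twice. The smallness condition of
    the theorem says exactly that [L < m].

    Under this condition a solution is unique: test each of two inequalities with
    the other solution, as in [coupled_step_unique]. It exists because it is a fixed
    point of the map that takes an explicit step along the bilinear form and then
    the proximal map of the contact term frozen at the current point; for a small
    step size this map is a contraction ([quasi_variational_inequality]). Both the
    proximal point and the fixed point are obtained by minimising a coercive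
    continuous function on a Euclidean space.

    Most of the work makes the forms bilinear. Weak gradients and traces are
    chosen representatives, so they depend linearly on a function only up to
    null sets, and even this requires their uniqueness. For weak gradients it is
    the fundamental lemma of the calculus of variations ([fundamental_lemma]),
    proved with bump functions on boxes and the pi-lambda theorem; for traces it
    follows from the trace inequality applied to the zero function
    ([is_trace_unique]).

    The finite element spaces consist of functions on the whole space, which are
    determined by finitely many coefficients on the closed domain only. So their
    dimension is replaced by a bound on the size of orthonormal families
    ([orthonormal_bound]), and definiteness of the norms by
    [piecewise_polynomial_null]: a piecewise polynomial that vanishes almost
    everywhere in the domain vanishes on the closed domain, because the interior of
    a simplex is dense in it and nonempty open sets have positive measure. *)

Set Implicit Arguments.
Unset Strict Implicit.
Unset Printing Implicit Defensive.

Import Order.TTheory GRing.Theory Num.Theory.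
Import numFieldNormedType.Exports.

Local Open Scope classical_set_scope.
Local Open Scope ring_scope.

(** * Semi-inner products on subspaces of functions *)

Section semi_inner_products.
Context {R : realType} {V : lmodType R}.

(** All notions below are relative to a set [W] of vectors, because the forms of
    the problem are only linear on functions that are regular enough. *)
Definition subspace (W : set V) :=
  W 0 /\ forall (k : R) x y, W x -> W y -> W (k *: x + y).

Definition linear_on (W : set V) (l : V -> R) :=
  forall (k : R) x y, W x -> W y -> l (k *: x + y) = k * l x + l y.

Definition bilinear_on (W : set V) (a : V -> V -> R) :=
  forall z, W z -> linear_on W (a z) /\ linear_on W (a ^~ z).

Definition semi_inner (W : set V) (s : V -> V -> R) :=
  [/\ bilinear_on W s, forall x y, W x -> W y -> s x y = s y x &
      forall x, W x -> 0 <= s x x].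

Variable W : set V.
Hypothesis sW : subspace W.

Lemma subspaceD x y : W x -> W y -> W (x + y).
Proof. by move=> Wx Wy; rewrite -[x]scale1r; apply: sW.2. Qed.

Lemma subspaceZ k x : W x -> W (k *: x).
Proof. by move=> Wx; rewrite -[_ *: _]addr0; apply: sW.2 => //; exact: sW.1. Qed.

Lemma subspaceB x y : W x -> W y -> W (x - y).
Proof. by move=> Wx Wy; rewrite addrC -scaleN1r; exact: sW.2. Qed.

Lemma subspace_sum n (F : 'I_n -> V) : (forall i, W (F i)) -> W (\sum_i F i).
Proof. by move=> WF; elim/big_ind : _ => //; [exact: sW.1|exact: subspaceD]. Qed.

Section linear_on.
Variable l : V -> R.
Hypothesis ll : linear_on W l.

Lemma linear_on0 : l 0 = 0.
Proof. by have := ll 1 sW.1 sW.1; rewrite scale1r addr0 mul1r; lra. Qed.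

Lemma linear_onD x y : W x -> W y -> l (x + y) = l x + l y.
Proof. by move=> Wx Wy; rewrite -[x in LHS]scale1r ll// mul1r. Qed.

Lemma linear_onZ k x : W x -> l (k *: x) = k * l x.
Proof.
move=> Wx; rewrite -[_ *: _]addr0 ll// ?linear_on0 ?addr0//; exact: sW.1.
Qed.

Lemma linear_onB x y : W x -> W y -> l (x - y) = l x - l y.
Proof. by move=> Wx Wy; rewrite addrC -scaleN1r ll// mulN1r addrC. Qed.

Lemma linear_on_sum n (F : 'I_n -> V) : (forall i, W (F i)) ->
  l (\sum_i F i) = \sum_i l (F i).
Proof.
move=> WF; suff [] : W (\sum_i F i) /\ l (\sum_i F i) = \sum_i l (F i) by [].
elim/big_rec2 : _; first by split; [exact: sW.1|exact: linear_on0].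
move=> i x y _ [Wy e]; split; first exact: subspaceD.
by rewrite linear_onD// e.
Qed.

End linear_on.

Variable s : V -> V -> R.
Hypothesis si : semi_inner W s.

Let slin x : W x -> linear_on W (s x).
Proof. by case: si => bl _ _ /bl[]. Qed.

Let srin x : W x -> linear_on W (s ^~ x).
Proof. by case: si => bl _ _ /bl[]. Qed.

Lemma semi_inner_ge0 x : W x -> 0 <= s x x.
Proof. by case: si => _ _; apply. Qed.

Lemma semi_innerC x y : W x -> W y -> s x y = s y x.
Proof. by case: si => _ h _; apply: h. Qed.

Lemma semi_inner_expand k x y : W x -> W y ->
  s (k *: x + y) (k *: x + y) = k ^+ 2 * s x x + 2 * k * s x y + s y y.
Proof.
move=> Wx Wy; have Wk := sW.2 k _ _ Wx Wy.
rewrite (slin Wk)// (srin Wx)// (srin Wy)// (semi_innerC Wy Wx); ring.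
Qed.

(** The form may be degenerate, so the case [s x x = 0] needs its own choice of
    the point at which the nonnegative quadratic [s (k x + y) (k x + y)] is
    evaluated. *)
Lemma cauchy_schwarz_sqr x y : W x -> W y -> s x y ^+ 2 <= s x x * s y y.
Proof.
move=> Wx Wy.
have P k : 0 <= k ^+ 2 * s x x + 2 * k * s x y + s y y.
  by rewrite -semi_inner_expand//; exact/semi_inner_ge0/sW.2.
have := semi_inner_ge0 Wx; rewrite le_eqVlt => /predU1P[/esym x0|x0].
  rewrite x0 mul0r; have [->|xy0] := eqVneq (s x y) 0; first by rewrite expr0n.
  (* this point makes the affine function of [k] equal to [-1] *)
  have := P (- (s y y + 1) / (2 * s x y)).
  rewrite x0 mulr0 add0r (_ : 2 * _ * _ = - (s y y + 1)); last by field.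
  lra.
have := P (- s x y / s x x).
rewrite (_ : _ + _ = (s x x * s y y - s x y ^+ 2) / s x x); last first.
  by field; rewrite gt_eqF.
by rewrite pmulr_lge0 ?invr_gt0// subr_ge0.
Qed.

Definition seminorm x := Num.sqrt (s x x).

Lemma cauchy_schwarz x y : W x -> W y -> `|s x y| <= seminorm x * seminorm y.
Proof.
move=> Wx Wy; rewrite -sqrtrM ?semi_inner_ge0// -sqrtr_sqr.
by rewrite ler_wsqrtr// cauchy_schwarz_sqr.
Qed.

Lemma seminorm_sqr x : W x -> seminorm x ^+ 2 = s x x.
Proof. by move=> Wx; rewrite sqr_sqrtr// semi_inner_ge0. Qed.

Lemma seminorm_triangle x y : W x -> W y ->
  seminorm (x + y) <= seminorm x + seminorm y.
Proof.
move=> Wx Wy; have Wxy := subspaceD Wx Wy.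
rewrite -(@ler_pXn2r _ 2)// ?nnegrE ?addr_ge0 ?sqrtr_ge0// seminorm_sqr//.
rewrite -[x]scale1r semi_inner_expand// scale1r expr1n mul1r mulr1 sqrrD.
rewrite !seminorm_sqr//.
have := le_trans (ler_norm _) (cauchy_schwarz Wx Wy); lra.
Qed.

Lemma seminorm0_orth x y : W x -> W y -> s x x = 0 -> s x y = 0.
Proof.
move=> Wx Wy x0; have := cauchy_schwarz_sqr Wx Wy; rewrite x0 mul0r => h.
by apply/eqP; rewrite -sqrf_eq0 eq_le h sqr_ge0.
Qed.

Definition orthonormal n (e : 'I_n -> V) :=
  (forall i, W (e i)) /\ forall i j, s (e i) (e j) = (i == j)%:R.

Definition comb n (e : 'I_n -> V) (c : 'rV[R]_n) : V := \sum_i c ord0 i *: e i.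

Lemma comb_linear n (e : 'I_n -> V) k c c' :
  comb e (k *: c + c') = k *: comb e c + comb e c'.
Proof.
rewrite /comb scaler_sumr -big_split/=; apply: eq_bigr => i _.
by rewrite !mxE scalerDl scalerA.
Qed.

Lemma comb_sub n (e : 'I_n -> V) c c' : comb e (c - c') = comb e c - comb e c'.
Proof.
by rewrite (addrC c) -(scaleN1r c') comb_linear scaleN1r addrC.
Qed.

Lemma comb_subspace n (e : 'I_n -> V) c : (forall i, W (e i)) -> W (comb e c).
Proof. by move=> We; apply: subspace_sum => i; exact: subspaceZ. Qed.

Lemma comb_inner n (e : 'I_n -> V) c x : (forall i, W (e i)) -> W x ->
  s (comb e c) x = \sum_i c ord0 i * s (e i) x.
Proof.
move=> We Wx; rewrite (linear_on_sum (srin Wx)); last by move=> i; exact: subspaceZ.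
by apply: eq_bigr => i _; rewrite (linear_onZ (srin Wx)).
Qed.

Lemma comb_dotp n (e : 'I_n -> V) c c' : orthonormal e ->
  s (comb e c) (comb e c') = dotp c c'.
Proof.
move=> [We oe]; rewrite comb_inner//; last exact: comb_subspace.
apply: eq_bigr => i _; rewrite semi_innerC//; last exact: comb_subspace.
rewrite comb_inner// (bigD1 i)//= oe eqxx mulr1 big1 ?addr0// => j ji.
by rewrite oe (negPf ji) mulr0.
Qed.

(** A bound on the size of orthonormal families is used instead of a basis, so
    that [W] may be a subspace of functions that are only determined up to a
    null vector; a family of maximal size spans, since the normalised residual
    of a vector outside its span could be added to it. *)
Lemma orthonormal_basis m :
  (forall n (e : 'I_n -> V), orthonormal e -> (n <= m)%N) ->
  exists n (e : 'I_n -> V), orthonormal e /\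
    forall x, W x -> exists c, s (x - comb e c) (x - comb e c) = 0.
Proof.
move=> bnd; pose P k := `[< exists e : 'I_k -> V, orthonormal e >].
have exP : exists k, P k.
  by exists 0%N; apply/asboolP; exists (fun=> 0); split=> -[].
have ubP k : P k -> (k <= m)%N by move=> /asboolP[e]; exact: bnd.
case: (ex_maxnP exP ubP) => n /asboolP[e oe] nmax; exists n, e; split=> // x Wx.
have [We oeE] := oe.
pose c : 'rV[R]_n := \row_i s x (e i); exists c.
set r := x - comb e c.
have Wr : W r by apply: subspaceB => //; exact: comb_subspace.
have re i : s r (e i) = 0.
  rewrite (linear_onB (srin (We i)))//; last exact: comb_subspace.
  rewrite comb_inner// (bigD1 i)//= oeE eqxx mulr1 big1 ?addr0 ?mxE ?subrr// => j ji.
  by rewrite oeE (negPf ji) mulr0.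
apply/eqP/negPn/negP => r0.
have rgt0 : 0 < s r r by rewrite lt_def r0 semi_inner_ge0.
pose r' := (Num.sqrt (s r r))^-1 *: r.
have Wr' : W r' by exact: subspaceZ.
have r'e i : s r' (e i) = 0 by rewrite (linear_onZ (srin (We i)))// re mulr0.
have r'r' : s r' r' = 1.
  rewrite (linear_onZ (slin Wr'))// (linear_onZ (srin Wr))// mulrA -invfM.
  by rewrite -expr2 sqr_sqrtr ?ltW// mulVf// gt_eqF.
suff : P n.+1 by move/nmax; rewrite ltnn.
apply/asboolP.
exists (fun i => if unlift ord0 i is Some j then e j else r'); split=> [i|i j].
  by case: unliftP.
case: (unliftP ord0 i) => [i'|] ->; case: (unliftP ord0 j) => [j'|] ->.
- by rewrite oeE (inj_eq lift_inj).
- by rewrite semi_innerC// r'e eq_sym (negPf (neq_lift _ _)).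
- by rewrite r'e (negPf (neq_lift _ _)).
- by rewrite r'r' eqxx.
Qed.

End semi_inner_products.

(** * Euclidean geometry of row vectors *)

Section euclidean_geometry.
Context {R : realType} {n : nat}.
Implicit Types x y z : 'rV[R]_n.

Lemma dotpC x y : dotp x y = dotp y x.
Proof. by apply: eq_bigr => i _; rewrite mulrC. Qed.

Lemma dotp_ge0 x : 0 <= dotp x x.
Proof. by apply: sumr_ge0 => i _; rewrite -expr2 sqr_ge0. Qed.

Lemma dotp_linear z k x y : dotp z (k *: x + y) = k * dotp z x + dotp z y.
Proof.
rewrite /dotp mulr_sumr -big_split/=; apply: eq_bigr => i _; rewrite !mxE; ring.
Qed.

Lemma subspaceT (V : lmodType R) : subspace [set: V].
Proof. by []. Qed.

Lemma semi_inner_dotp : semi_inner [set: 'rV[R]_n] dotp.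
Proof.
split=> [z _|x y _ _|x _]; [|exact: dotpC|exact: dotp_ge0].
split=> k x y _ _; first exact: dotp_linear.
by rewrite ![dotp _ z]dotpC dotp_linear.
Qed.

Lemma dotpDl x y z : dotp (x + y) z = dotp x z + dotp y z.
Proof. by rewrite /dotp -big_split/=; apply: eq_bigr => i _; rewrite mxE mulrDl. Qed.

Lemma dotpNl x z : dotp (- x) z = - dotp x z.
Proof. by rewrite /dotp -sumrN; apply: eq_bigr => i _; rewrite mxE mulNr. Qed.

Lemma dotpZl k x z : dotp (k *: x) z = k * dotp x z.
Proof. by rewrite /dotp mulr_sumr; apply: eq_bigr => i _; rewrite mxE mulrA. Qed.

Lemma dotpDr x y z : dotp z (x + y) = dotp z x + dotp z y.
Proof. by rewrite dotpC dotpDl !(dotpC z). Qed.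

Lemma dotpNr x z : dotp z (- x) = - dotp z x.
Proof. by rewrite dotpC dotpNl dotpC. Qed.

Lemma dotpZr k x z : dotp z (k *: x) = k * dotp z x.
Proof. by rewrite dotpC dotpZl dotpC. Qed.

Definition dotpE := (dotpDl, dotpDr, dotpNl, dotpNr, dotpZl, dotpZr).

Lemma dotp_le x y : `|dotp x y| <= enorm x * enorm y.
Proof. exact: (cauchy_schwarz (@subspaceT _) semi_inner_dotp). Qed.

Lemma enorm_sqr x : enorm x ^+ 2 = dotp x x.
Proof. by rewrite sqr_sqrtr// dotp_ge0. Qed.

Lemma enorm_ge0 x : 0 <= enorm x.
Proof. exact: sqrtr_ge0. Qed.

Lemma enormD x y : enorm (x + y) <= enorm x + enorm y.
Proof. exact: (seminorm_triangle (@subspaceT _) semi_inner_dotp). Qed.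

Lemma enormN x : enorm (- x) = enorm x.
Proof. by rewrite /enorm !dotpE opprK. Qed.

Lemma enormB x y : enorm (x - y) = enorm (y - x).
Proof. by rewrite -opprB enormN. Qed.

Lemma enormZ k x : enorm (k *: x) = `|k| * enorm x.
Proof. by rewrite /enorm !dotpE mulrA sqrtrM ?sqr_ge0// -expr2 sqrtr_sqr. Qed.

Lemma enorm0 : enorm (0 : 'rV[R]_n) = 0.
Proof. by rewrite /enorm /dotp big1 ?sqrtr0// => i _; rewrite mxE mul0r. Qed.

Lemma dotpp_eq0 x : dotp x x = 0 -> x = 0.
Proof.
move=> /eqP; rewrite psumr_eq0 => [/allP h|i _]; last by rewrite -expr2 sqr_ge0.
apply/rowP => i; rewrite mxE; have := h i; rewrite mem_index_enum => /(_ isT).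
by rewrite /= mulf_eq0 orbb => /eqP.
Qed.

Lemma enorm_eq0 x : enorm x = 0 -> x = 0.
Proof. by move=> h; apply: dotpp_eq0; rewrite -enorm_sqr h expr0n. Qed.

Lemma coord_le_enorm x i : `|x ord0 i| <= enorm x.
Proof.
rewrite -sqrtr_sqr ler_wsqrtr// /dotp (bigD1 i)//= -expr2 lerDl.
by apply: sumr_ge0 => j _; rewrite -expr2 sqr_ge0.
Qed.

Lemma norm_le_enorm x : `|x| <= enorm x.
Proof.
rewrite [leLHS]/Num.norm/= mx_normrE; apply: bigmax_le; first exact: enorm_ge0.
by move=> [i j] _ /=; rewrite ord1 coord_le_enorm.
Qed.

Lemma coord_le_norm x i : `|x ord0 i| <= `|x|.
Proof.
rewrite [leRHS]/Num.norm/= mx_normrE.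
exact: (le_bigmax _ (fun ij => `|x ij.1 ij.2|) (ord0, i)).
Qed.

Lemma enorm_le_norm x : enorm x <= n%:R * `|x|.
Proof.
rewrite -ler_sqr ?nnegrE ?enorm_ge0 ?mulr_ge0// enorm_sqr /dotp.
have [n0|n0] := eqVneq n 0%N.
  rewrite big1 ?sqr_ge0// => i _; have := ltn_ord i; by rewrite {2}n0.
apply: (@le_trans _ _ (\sum_(i < n) `|x| ^+ 2)).
  apply: ler_sum => i _; rewrite -expr2 -real_normK ?num_real//.
  by rewrite ler_sqr ?nnegrE ?coord_le_norm.
rewrite sumr_const card_ord -[_ *+ _]mulr_natl exprMn ler_wpM2r ?sqr_ge0//.
by rewrite -natrX ler_nat -mulnn leq_pmull// lt0n.
Qed.

End euclidean_geometry.

(** * Quasi-variational inequalities in finite dimension *)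

Definition convex_fct (R : realType) (V : lmodType R) (W : set V) (phi : V -> R) :=
  forall (t : R) x y, W x -> W y -> 0 <= t <= 1 ->
  phi (t *: x + (1 - t) *: y) <= t * phi x + (1 - t) * phi y.

Section real_continuity.
Context {R : realType} {T : topologicalType}.
Implicit Types f g : T -> R.

Lemma continuous_add f g :
  continuous f -> continuous g -> continuous (fun x => f x + g x).
Proof. by move=> cf cg x; apply: (@continuousD _ _ _ f g); [exact: cf|exact: cg]. Qed.

Lemma continuous_mul f g :
  continuous f -> continuous g -> continuous (fun x => f x * g x).
Proof. by move=> cf cg x; apply: (@continuousM _ _ f g); [exact: cf|exact: cg]. Qed.

Lemma continuous_const (c : R) : continuous (fun _ : T => c).
Proof. by move=> x; exact: cst_continuous. Qed.

Lemma continuous_bigsum (I : Type) (s : seq I) (F : I -> T -> R) :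
  (forall i, continuous (F i)) -> continuous (fun x => \sum_(i <- s) F i x).
Proof.
move=> cF; elim: s => [|i s IH].
  have -> : (fun x => \sum_(i <- [::]) F i x) = fun=> 0.
    by apply/funext => x; rewrite big_nil.
  exact: continuous_const.
have -> : (fun x => \sum_(i <- i :: s) F i x) = fun x => F i x + \sum_(i <- s) F i x.
  by apply/funext => x; rewrite big_cons.
exact: continuous_add.
Qed.

Lemma continuous_bigprod (I : Type) (s : seq I) (F : I -> T -> R) :
  (forall i, continuous (F i)) -> continuous (fun x => \prod_(i <- s) F i x).
Proof.
move=> cF; elim: s => [|i s IH].
  have -> : (fun x => \prod_(i <- [::]) F i x) = fun=> 1.
    by apply/funext => x; rewrite big_nil.
  exact: continuous_const.
have -> : (fun x => \prod_(i <- i :: s) F i x) = fun x => F i x * \prod_(i <- s) F i x.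
  by apply/funext => x; rewrite big_cons.
exact: continuous_mul.
Qed.

End real_continuity.

Section finite_dimensional_inequalities.
Context {R : realType} {n : nat}.
Implicit Types (x y z : 'rV[R]_n) (phi : 'rV[R]_n -> R).

Definition enorm_lipschitz phi (L : R) :=
  0 <= L /\ forall x y, phi x - phi y <= L * enorm (x - y).

Lemma enorm_lipschitz_continuous phi L :
  enorm_lipschitz phi L -> continuous phi.
Proof.
move=> [L0 lip] x; apply/(@cvgrPdist_lt _ _ _ (nbhs x) (nbhs_filter x)) => e e0.
have C0 : 0 < L * n%:R + 1 by rewrite ltr_wpDl// mulr_ge0.
apply/nbhs_ballP.
exists (e / (L * n%:R + 1)) => [|y]; first exact: divr_gt0.
rewrite -ball_normE /= => xy.
have h : forall u v, phi u - phi v <= (L * n%:R) * `|u - v|.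
  move=> u v; apply: (le_trans (lip u v)).
  by rewrite -mulrA ler_wpM2l// enorm_le_norm.
apply: (@le_lt_trans _ _ ((L * n%:R) * `|x - y|)).
  by rewrite ler_norml h lerNl opprB distrC h.
apply: (@le_lt_trans _ _ ((L * n%:R + 1) * `|x - y|)).
  by rewrite ler_wpM2r// lerDl.
by rewrite mulrC -ltr_pdivlMr.
Qed.

Lemma continuous_enorm : continuous (@enorm R n).
Proof.
apply: (@enorm_lipschitz_continuous _ 1); split=> // x y.
by rewrite mul1r lerBlDr -{1}(subrK y x) enormD.
Qed.

Lemma coercive_continuous_min phi (c C : R) : continuous phi -> 0 < c ->
  (forall x, c * enorm x - C <= phi x) -> exists x, forall y, phi x <= phi y.
Proof.
move=> cphi c0 growth.
(* outside the ball of radius [r], [phi] exceeds [phi 0] *)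
pose r := (phi 0 + C) / c.
have r0 : 0 <= r.
  by have := growth 0; rewrite enorm0 mulr0 => h; apply: divr_ge0; [lra|exact: ltW].
pose A := [set x : 'rV[R]_n | enorm x <= r].
have cA : compact A.
  apply: bounded_closed_compact.
    exists r; split=> [|M rM x /= Ax]; first exact: num_real.
    exact: le_trans (norm_le_enorm x) (le_trans Ax (ltW rM)).
  rewrite (_ : A = @enorm R n @^-1` [set y | y <= r])//.
  apply: preimage_closed; [|exact: closed_le].
  by move=> x _; exact: continuous_enorm.
have A0 : A 0 by rewrite /A/= enorm0.
have [x Ax xmin] := @compact_EVT_min _ _ phi A (ex_intro _ _ A0) cA
  (continuous_subspaceT cphi).
exists x => y; have [yr|yr] := leP (enorm y) r; first by apply: xmin; rewrite inE.
apply: (@le_trans _ _ (phi 0)); first by apply: xmin; rewrite inE.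
apply: le_trans (growth y); move: yr; rewrite ltr_pdivrMr// => yr; lra.
Qed.

(** The fixed point is obtained from compactness rather than from iterates: a
    point [z] moved least by [T] must be fixed, because [T z] is moved by at
    most [kap < 1] times that distance. *)
Lemma euclidean_contraction_fixed_point (T : 'rV[R]_n -> 'rV[R]_n) (kap : R) :
  0 <= kap < 1 -> (forall x y, enorm (T x - T y) <= kap * enorm (x - y)) ->
  exists z, T z = z.
Proof.
move=> /andP[k0 k1] Tk; pose phi x := enorm (x - T x).
have lip : enorm_lipschitz phi (1 + kap).
  split=> [|x y]; first lra.
  rewrite /phi (_ : x - T x = (x - y) + (y - T y) + (T y - T x)); last first.
    by apply/rowP => i; rewrite !mxE; ring.
  have := enormD (x - y + (y - T y)) (T y - T x); have := enormD (x - y) (y - T y).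
  have := Tk y x; rewrite (enormB y x); lra.
have [||z zmin] := @coercive_continuous_min phi (1 - kap) (enorm (T 0))
  (enorm_lipschitz_continuous lip); first lra.
  move=> x; have := Tk x 0; have := enormD (x - T x) (T x - T 0 + T 0).
  have := enormD (T x - T 0) (T 0); rewrite !subrK subr0 /phi; lra.
exists z; have := zmin (T z); have := Tk z (T z); rewrite -/(phi z) -/(phi (T z)).
have := enorm_ge0 (z - T z); rewrite -/(phi z) => p0 p1 p2.
have /enorm_eq0/eqP : phi z = 0.
  apply/eqP; rewrite eq_le p0 andbT leNgt; apply/negP => p3.
  have : kap * phi z < phi z by rewrite -[ltRHS]mul1r ltr_pM2r. lra.
by rewrite subr_eq0 => /eqP.
Qed.

(** First-order condition for the minimiser of
    [1/2 |y - x|^2 + phi y]: compare with a convex combination of [y] and [v]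
    and let its weight tend to [0]. *)
Lemma proximal_point phi L x : enorm_lipschitz phi L -> convex_fct setT phi ->
  exists y, forall v, dotp (x - y) (v - y) <= phi v - phi y.
Proof.
move=> lip cvx; have [L0 lipE] := lip.
pose f y := 2^-1 * dotp (y - x) (y - x) + phi y.
have cd : continuous (fun y => enorm (y - x)).
  apply: (@enorm_lipschitz_continuous _ 1); split=> // u v.
  rewrite mul1r lerBlDr (_ : u - x = (u - v) + (v - x)) ?enormD//.
  by rewrite addrA subrK.
have cf : continuous f.
  rewrite (_ : f = (fun y => 2^-1 * (enorm (y - x) * enorm (y - x)) + phi y)).
    apply: continuous_add; last exact: enorm_lipschitz_continuous lip.
    apply: continuous_mul; first exact: continuous_const.
    exact: continuous_mul.
  by apply/funext => y; rewrite /f -enorm_sqr expr2.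
have [||y ymin] := @coercive_continuous_min f 1
  (enorm x + (L + 1) ^+ 2 / 2 - phi x) cf; first by [].
  move=> y; rewrite /f -enorm_sqr.
  have := lipE x y; rewrite (enormB x y).
  have := enormD (y - x) x; rewrite subrK.
  have := sqr_ge0 (enorm (y - x) - (L + 1)); nra.
exists y => v.
set D := dotp _ _; set E := phi v - phi y.
have key (t : R) : 0 < t <= 1 -> D <= E + t * (2^-1 * dotp (v - y) (v - y)).
  move=> /andP[t0 t1].
  have := ymin (t *: v + (1 - t) *: y).
  have := cvx t v y I I; rewrite ltW//= => /(_ t1).
  rewrite /f (_ : t *: v + (1 - t) *: y - x = t *: (v - y) - (x - y)); last first.
    by apply/rowP => i; rewrite !mxE; ring.
  have -> : dotp (t *: (v - y) - (x - y)) (t *: (v - y) - (x - y)) =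
    t ^+ 2 * dotp (v - y) (v - y) - 2 * t * D + dotp (y - x) (y - x).
    rewrite -(opprB y x) /D -(opprB y x); move: (v - y) (y - x) => p q.
    rewrite !dotpE !opprK (dotpC q p); ring.
  rewrite /E => h1 h2; rewrite -(ler_pM2l t0) mulrDr; nra.
rewrite leNgt; apply/negP => ED.
set B := 2^-1 * dotp (v - y) (v - y) in key.
have B0 : 0 <= B by rewrite mulr_ge0// dotp_ge0.
pose t := Num.min 1 ((D - E) / (2 * (B + 1))).
have t0 : 0 < t by rewrite lt_min ltr01/= divr_gt0 ?subr_gt0//; lra.
have := key t; rewrite t0 ge_min lexx/= => /(_ isT).
have tB : t * B <= (D - E) / 2.
  apply: (@le_trans _ _ ((D - E) / (2 * (B + 1)) * (B + 1))).
    by apply: ler_pM; rewrite ?(ltW t0)// ?ge_min ?lexx ?orbT//; lra.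
  rewrite le_eqVlt; apply/orP; left; apply/eqP; field; lra.
lra.
Qed.

Lemma enorm_mulmx_le (M : 'M[R]_n) : exists2 C, 0 <= C &
  forall z, enorm (z *m M) <= C * enorm z.
Proof.
exists (n%:R * \sum_i \sum_j `|M i j|).
  by rewrite mulr_ge0// sumr_ge0// => i _; rewrite sumr_ge0.
move=> z; apply: (le_trans (enorm_le_norm _)); rewrite -mulrA ler_wpM2l//.
rewrite [leLHS]/Num.norm/= mx_normrE; apply: bigmax_le.
  by rewrite mulr_ge0 ?enorm_ge0// sumr_ge0// => i _; rewrite sumr_ge0.
move=> [i j] _ /=; rewrite ord1 mxE (le_trans (ler_norm_sum _ _ _))// mulr_suml.
apply: ler_sum => k _; rewrite normrM mulrC ler_pM ?coord_le_enorm//.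
by rewrite (bigD1 j)//= lerDl sumr_ge0.
Qed.

(** A solution is a fixed point of [z |-> prox_(rho j(z, .)) (z - rho (M z - l))].
    For a small step [rho] the affine part contracts by about [1 - rho m], while
    the dependence of [j] on its first argument costs at most [rho L]; hence the
    smallness condition [L < m]. *)
Lemma quasi_variational_inequality_rV (M : 'M[R]_n) (l : 'rV[R]_n)
    (j : 'rV[R]_n -> 'rV[R]_n -> R) (m L : R) : 0 <= L < m ->
  (forall z, m * dotp z z <= dotp (z *m M) z) ->
  (forall z, exists K, enorm_lipschitz (j z) K) ->
  (forall z, convex_fct setT (j z)) ->
  (forall z z' v v', j z v - j z v' + j z' v' - j z' v <=
     L * enorm (z - z') * enorm (v - v')) ->
  exists z, forall y, dotp l (y - z) <= dotp (z *m M) (y - z) + j z y - j z z.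
Proof.
move=> /andP[L0 Lm] Mm jlip jcvx j4.
have [C C0 MC] := enorm_mulmx_le M.
(* any step with [rho C^2 <= m - L] and [rho L < 1] would do *)
pose rho := (m - L) / (C ^+ 2 + m ^+ 2).
have m0 : 0 < m by lra.
have den0 : 0 < C ^+ 2 + m ^+ 2 by have := sqr_ge0 C; nra.
have rho0 : 0 < rho by rewrite divr_gt0// subr_gt0.
have rhoE : rho * (C ^+ 2 + m ^+ 2) = m - L by rewrite /rho; field; lra.
have rhoL : rho * L < 1.
  rewrite -(ltr_pM2r den0) mulrAC rhoE mul1r; have := sqr_ge0 C; nra.
pose q := 1 - 2 * rho * m + rho ^+ 2 * C ^+ 2.
pose kap := Num.sqrt q + rho * L.
have q1 : q < (1 - rho * L) ^+ 2.
  rewrite /q -subr_gt0.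
  have -> : (1 - rho * L) ^+ 2 - (1 - 2 * rho * m + rho ^+ 2 * C ^+ 2) =
    rho * (2 * (m - L) - rho * C ^+ 2 + rho * L ^+ 2) by ring.
  apply: mulr_gt0 => //.
  have := mulr_ge0 (ltW rho0) (sqr_ge0 m); have := mulr_ge0 (ltW rho0) (sqr_ge0 L).
  move: rhoE; rewrite mulrDr; lra.
have kap0 : 0 <= kap by rewrite addr_ge0 ?sqrtr_ge0// mulr_ge0// ltW.
have kap1 : kap < 1.
  rewrite /kap -ltrBrDr -[ltRHS]ger0_norm; last lra.
  by rewrite -sqrtr_sqr ltr_sqrt// exprn_gt0//; lra.
pose X z := z - rho *: (z *m M - l).
have /choice[T TP] : forall z, exists y, forall v,
    dotp (X z - y) (v - y) <= rho * j z v - rho * j z y.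
  move=> z; have [K [K0 lipK]] := jlip z.
  apply: (@proximal_point (fun v => rho * j z v) (rho * K)).
    split=> [|x y]; first by rewrite mulr_ge0// ltW.
    by rewrite -mulrBr -mulrA ler_pM2l.
  move=> t x y _ _ t01; have := jcvx z t x y I I t01.
  by rewrite -(ler_pM2l rho0) mulrDr !(mulrCA rho).
have Xlip z z' : enorm (X z - X z') <= Num.sqrt q * enorm (z - z').
  have -> : X z - X z' = (z - z') - rho *: ((z - z') *m M).
    rewrite /X mulmxBl; apply/rowP => i; rewrite !mxE; ring.
  move: (z - z') => w.
  have q0 : 0 <= q * enorm w ^+ 2 - enorm (w - rho *: (w *m M)) ^+ 2.
    rewrite !enorm_sqr !dotpE (dotpC w (w *m M)).
    have : dotp (w *m M) (w *m M) <= C ^+ 2 * dotp w w.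
      rewrite -!enorm_sqr -exprMn; apply: lerXn2r (MC w).
        by rewrite nnegrE enorm_ge0.
      by rewrite nnegrE mulr_ge0 ?enorm_ge0.
    move=> /(ler_wpM2l (sqr_ge0 rho)) h1.
    have := Mm w => /(ler_wpM2l (ltW rho0)) h2.
    rewrite /q; nra.
  have [w0|w0] := eqVneq (enorm w) 0.
    rewrite (enorm_eq0 w0) mul0mx scaler0 subr0 enorm0 mulr0//.
  have w20 : 0 < enorm w ^+ 2 by rewrite exprn_gt0// lt_def w0 enorm_ge0.
  have qq : 0 <= q.
    have := sqr_ge0 (enorm (w - rho *: (w *m M))) => h.
    by rewrite -(pmulr_lge0 _ w20); lra.
  rewrite -[leLHS]ger0_norm ?enorm_ge0// -sqrtr_sqr.
  rewrite -[X in _ * X]ger0_norm ?enorm_ge0// -(sqrtr_sqr (enorm w)) -sqrtrM//.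
  by rewrite ler_wsqrtr//; lra.
have [||z Tz] := @euclidean_contraction_fixed_point T kap.
- by rewrite kap0.
- move=> x y; have := TP x (T y); have := TP y (T x).
  have := j4 x y (T y) (T x); set a := enorm (x - y); rewrite (enormB (T y)).
  set b := enorm (T x - T y) => h1 h2 h3.
  have h4 : dotp (X x - X y) (T x - T y) <= Num.sqrt q * a * b.
    apply: (le_trans (ler_norm _)); apply: (le_trans (dotp_le _ _)).
    by rewrite ler_wpM2r ?enorm_ge0.
  have bb : b ^+ 2 = dotp (T x - T y) (T x - T y) by rewrite enorm_sqr.
  have h5 : b ^+ 2 <= kap * a * b.
    have : dotp (X x - T x) (T y - T x) + dotp (X y - T y) (T x - T y) =
       b ^+ 2 - dotp (X x - X y) (T x - T y).
      rewrite bb -(opprB (T x) (T y)).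
      have -> : X x - T x = (X x - X y) + (X y - T y) - (T x - T y).
        by apply/rowP => i; rewrite !mxE; ring.
      rewrite !dotpE; ring.
    have := ler_wpM2l (ltW rho0) h1; rewrite /kap; nra.
  have [b0|b0] := eqVneq b 0; first by rewrite b0 mulr_ge0// enorm_ge0.
  by rewrite -(@ler_pM2r _ b) ?lt_def ?b0 ?enorm_ge0// -expr2.
exists z => y; have := TP z y; rewrite Tz.
rewrite /X (_ : _ - _ - _ = rho *: (l - z *m M)); last first.
  by apply/rowP => i; rewrite !mxE; ring.
by rewrite dotpZl -mulrBr ler_pM2l// dotpDl dotpNl; lra.
Qed.

End finite_dimensional_inequalities.

Section quasi_variational_inequality.
Context {R : realType} {V : lmodType R}.
Variables (W : set V) (s : V -> V -> R).
Hypotheses (sW : subspace W) (si : semi_inner W s).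

(** The inequality is solved on the span of a maximal orthonormal family, with
    Euclidean coordinates. Testing with the rest of [W] adds nothing new, since
    such vectors differ from the span by null vectors, which [a], [l] and [j]
    do not see. *)
Theorem quasi_variational_inequality (dim : nat)
    (a : V -> V -> R) (l : V -> R) (j : V -> V -> R) (m L : R) :
  (forall k (e : 'I_k -> V), orthonormal W s e -> (k <= dim)%N) ->
  0 <= L < m ->
  bilinear_on W a -> linear_on W l ->
  (forall z, W z -> m * s z z <= a z z) ->
  (forall z, W z -> exists2 K, 0 <= K & forall v v', W v -> W v' ->
     j z v - j z v' <= K * seminorm s (v - v')) ->
  (forall z, W z -> convex_fct W (j z)) ->
  (forall z z' v v', W z -> W z' -> W v -> W v' ->
     j z v - j z v' + j z' v' - j z' v <=
     L * seminorm s (z - z') * seminorm s (v - v')) ->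
  (forall z y, W z -> W y -> s y y = 0 -> a z y = 0 /\ l y = 0) ->
  exists2 z, W z & forall y, W y -> l (y - z) <= a z (y - z) + j z y - j z z.
Proof.
move=> dimP Lm ba ll am jlip jcvx j4 null.
have [n [e [oe span]]] := orthonormal_basis sW si dimP.
have [We oeE] := oe; pose E := comb e.
have WE c : W (E c) by exact: comb_subspace.
have EB c c' : E c - E c' = E (c - c') by rewrite /E comb_sub.
have sE c : seminorm s (E c) = enorm c by rewrite /seminorm (comb_dotp sW si).
pose M : 'M[R]_n := \matrix_(i, k) a (e i) (e k).
pose lv : 'rV[R]_n := \row_k l (e k).
have lE c : l (E c) = dotp lv c.
  rewrite (linear_on_sum sW ll); last by move=> i; exact: subspaceZ.
  by apply: eq_bigr => i _; rewrite (linear_onZ sW ll)// mxE mulrC.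
have aE c c' : a (E c) (E c') = dotp (c *m M) c'.
  rewrite (linear_on_sum sW (ba _ (WE c)).1); last by move=> i; exact: subspaceZ.
  apply: eq_bigr => k _; rewrite (linear_onZ sW (ba _ (WE c)).1)// mulrC; congr *%R.
  rewrite (linear_on_sum sW (ba _ (We k)).2); last by move=> i; exact: subspaceZ.
  by rewrite mxE; apply: eq_bigr => i _; rewrite (linear_onZ sW (ba _ (We k)).2)// mxE.
have [||||z zP] := @quasi_variational_inequality_rV R n M lv
  (fun c c' => j (E c) (E c')) m L Lm.
- by move=> c; rewrite -aE -(comb_dotp sW si _ _ oe) am.
- move=> c; have [K K0 KP] := jlip _ (WE c); exists K; split=> // x y.
  by rewrite -sE -EB KP.
- move=> c t x y _ _ t01; rewrite /E !comb_linear -/E.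
  have := jcvx _ (WE c) t _ _ (WE x) (WE y) t01.
  suff -> : E ((1 - t) *: y) = (1 - t) *: E y by [].
  rewrite /E -[_ *: y]addr0 comb_linear [X in _ + X]big1 ?addr0// => i _.
  by rewrite mxE scale0r.
- by move=> c c' v v'; rewrite -!sE -!EB j4.
exists (E z) => // y Wy; have [c yc] := span y Wy.
have Wr : W (y - E c) by exact: subspaceB.
have -> : y - E z = (y - E c) + E (c - z) by rewrite -EB addrA subrK.
have [az lz] := null _ _ (WE z) Wr yc.
rewrite (linear_onD ll)// (linear_onD (ba _ (WE z)).1)// az lz !add0r aE lE.
apply: le_trans (zP c) _; rewrite lerD2r lerD2l.
have [K K0 KP] := jlip _ (WE z); have := KP _ _ (WE c) Wy.
have [bs _ _] := si; have Wr' := subspaceZ sW (-1) Wr.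
have -> : seminorm s (E c - y) = 0.
  rewrite /seminorm -opprB -scaleN1r (linear_onZ sW (bs _ Wr').1)//.
  by rewrite (linear_onZ sW (bs _ Wr).2)// yc !mulr0 sqrtr0.
rewrite mulr0; lra.
Qed.

End quasi_variational_inequality.

(** * Square integrable functions and fields *)

Section L2_space.
Context {disp : measure_display} {X : measurableType disp} {R : realType}.
Variables (mu : {measure set X -> \bar R}) (D : set X).
Hypothesis mD : measurable D.
Implicit Types f g h : X -> R.

Local Notation L2 := (L2 mu D).
Local Notation ip := (ip mu D).
Local Notation integrable f := (mu.-integrable D (EFin \o f)).

Lemma measurable_fun_affine k f g : measurable_fun D f -> measurable_fun D g ->
  measurable_fun D (fun x => k * f x + g x).
Proof.
by move=> mf mg; apply: measurable_funD => //; apply: measurable_funM.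
Qed.

Lemma L2_sqr_integrable f : L2 f -> integrable (fun x => f x ^+ 2).
Proof.
move=> [mf fy]; apply/integrableP; split.
  by apply/measurable_EFinP; exact: measurable_funX.
rewrite (eq_integral (fun x => (f x ^+ 2)%:E))// => x _.
by rewrite /= ger0_norm// sqr_ge0.
Qed.

Lemma integrable_sqr_L2 f :
  measurable_fun D f -> integrable (fun x => f x ^+ 2) -> L2 f.
Proof.
move=> mf /integrableP[_]; split=> //.
rewrite (eq_integral (fun x => `|(f x ^+ 2)%:E|%E))// => x _.
by rewrite /= ger0_norm// sqr_ge0.
Qed.

Lemma L2_dominated f g : measurable_fun D f -> L2 g ->
  {ae mu, forall x, D x -> `|f x| <= `|g x|} -> L2 f.
Proof.
move=> mf [mg gy] fg; split=> //; apply: le_lt_trans gy.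
apply: ae_ge0_le_integral => //.
- by move=> x _; rewrite lee_fin sqr_ge0.
- by apply/measurable_EFinP; exact: measurable_funX.
- by move=> x _; rewrite lee_fin sqr_ge0.
- by apply/measurable_EFinP; exact: measurable_funX.
- apply: filterS fg => x h Dx; rewrite lee_fin -(real_normK (num_real (f x))).
  by rewrite -(real_normK (num_real (g x))) lerXn2r ?nnegrE// h.
Qed.

(** Comparison of [f g] with [f^2 + g^2]. *)
Lemma L2_integrableM f g : L2 f -> L2 g -> integrable (fun x => f x * g x).
Proof.
move=> f2 g2.
have : integrable (fun x => f x ^+ 2 + g x ^+ 2).
  exact: integrableD (L2_sqr_integrable f2) (L2_sqr_integrable g2).
apply: le_integrable => //.
  by apply/measurable_EFinP; apply: measurable_funM; [case: f2|case: g2].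
move=> x Dx /=; rewrite lee_fin (ger0_norm (addr_ge0 (sqr_ge0 _) (sqr_ge0 _))).
rewrite ler_norml; have := sqr_ge0 (f x + g x); have := sqr_ge0 (f x - g x).
have := sqr_ge0 (f x); have := sqr_ge0 (g x) => *; apply/andP; split; nra.
Qed.

Lemma integrable_linear k f g : integrable f -> integrable g ->
  integrable (fun x => k * f x + g x) /\
  \int[mu]_(x in D) (k * f x + g x) = k * \int[mu]_(x in D) f x + \int[mu]_(x in D) g x.
Proof.
move=> fi gi; have kfi : integrable (fun x => k * f x) by exact: (integrableZl mD k fi).
by split; [exact: (integrableD mD kfi gi)|rewrite RintegralD// RintegralZl].
Qed.

Lemma Rintegral_sum n (F : 'I_n -> X -> R) : (forall i, integrable (F i)) ->
  integrable (fun x => \sum_i F i x) /\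
  \int[mu]_(x in D) (\sum_i F i x) = \sum_i \int[mu]_(x in D) F i x.
Proof.
move=> Fi; elim: n F Fi => [|n IH] F Fi.
  rewrite big_ord0; under eq_fun do rewrite big_ord0.
  split; first exact: integrable0.
  by rewrite /Rintegral integral0_eq// => x _; rewrite big_ord0.
have [i1 e1] := IH (fun i => F (lift ord0 i)) (fun i => Fi _).
have [i2 e2] := integrable_linear 1 (Fi ord0) i1.
have -> : (fun x => \sum_i F i x) =
    (fun x => 1 * F ord0 x + \sum_i F (lift ord0 i) x).
  by apply/funext => x; rewrite big_ord_recl mul1r.
by split=> //; rewrite e2 e1 mul1r big_ord_recl.
Qed.

Lemma L2_subspace : subspace (L2 : set (X -> R)).
Proof.
split.
  split; first exact: measurable_cst.
  by rewrite integral0_eq// => x _; rewrite expr0n.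
move=> k f g f2 g2; have [mf _] := f2; have [mg _] := g2.
apply: integrable_sqr_L2; first exact: measurable_fun_affine.
rewrite (_ : (fun _ => _) = fun x => k ^+ 2 * (f x ^+ 2) +
   ((2 * k) * (f x * g x) + g x ^+ 2)); last first.
  by apply/funext => x /=; rewrite -[(_ + _) x]/(k * f x + g x); ring.
apply: (integrable_linear _ (L2_sqr_integrable f2) _).1.
exact: (integrable_linear _ (L2_integrableM f2 g2) (L2_sqr_integrable g2)).1.
Qed.

Lemma ipC f g : ip f g = ip g f.
Proof. by apply: eq_Rintegral => x _; rewrite mulrC. Qed.

Lemma ip_semi_inner : semi_inner (L2 : set (X -> R)) ip.
Proof.
have lin f : L2 f -> linear_on (L2 : set (X -> R)) (ip f).
  move=> f2 k g h g2 h2.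
  rewrite -(integrable_linear k (L2_integrableM f2 g2) (L2_integrableM f2 h2)).2.
  by apply: eq_Rintegral => x _; rewrite -[(_ + _) x]/(k * g x + h x); ring.
split=> [f f2|f g _ _|f f2].
- by split; [exact: lin|move=> k g h g2 h2; rewrite ![ip _ f]ipC lin].
- exact: ipC.
- by apply: Rintegral_ge0 => x _; rewrite -expr2 sqr_ge0.
Qed.

Lemma ip_eq_ae f f' g g' : L2 f -> L2 f' -> L2 g -> L2 g' ->
  ae_eq mu D f f' -> ae_eq mu D g g' -> ip f g = ip f' g'.
Proof.
move=> f2 f2' g2 g2' ff gg; congr fine; apply: ae_eq_integral => //.
- by case/integrableP: (L2_integrableM f2 g2).
- by case/integrableP: (L2_integrableM f2' g2').
- by apply: filterS2 ff gg => x h1 h2 Dx; rewrite h1// h2.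
Qed.

Lemma ip0_ae f : L2 f -> ip f f = 0 -> ae_eq mu D f (cst 0).
Proof.
move=> f2 f0; have := L2_sqr_integrable f2.
move=> /[dup] fi /integrableP[mf _].
have : (\int[mu]_(x in D) `|(f x ^+ 2)%:E| = 0)%E.
  rewrite (eq_integral (fun x => (f x * f x)%:E)); last first.
    by move=> x _; rewrite /= ger0_norm ?sqr_ge0// expr2.
  rewrite -[LHS]fineK; first by rewrite [fine _]f0.
  exact: integrable_fin_num (L2_integrableM f2 f2).
move/(ae_eq_integral_abs mu mD mf); apply: filterS => x h Dx.
by have := h Dx; rewrite /= => -[] /eqP; rewrite sqrf_eq0 => /eqP.
Qed.

Lemma ae_integral_sqr0 f : measurable_fun D f -> ae_eq mu D f (cst 0) ->
  (\int[mu]_(x in D) (f x ^+ 2)%:E = 0)%E.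
Proof.
move=> mf f0; rewrite (ae_eq_integral (cst 0%E))//.
- by rewrite integral0_eq.
- by apply/measurable_EFinP; exact: measurable_funX.
- by apply: filterS f0 => x h Dx; rewrite h// expr0n.
Qed.

Lemma L2_eq_ae f g : measurable_fun D g -> L2 f -> ae_eq mu D f g -> L2 g.
Proof.
move=> mg f2 fg; split=> //; case: (f2) => mf; apply: le_lt_trans.
rewrite le_eqVlt; apply/orP; left; apply/eqP; apply: ae_eq_integral => //.
- by apply/measurable_EFinP; exact: measurable_funX.
- by apply/measurable_EFinP; exact: measurable_funX.
- by apply: filterS fg => x h Dx; rewrite h.
Qed.

End L2_space.

Section L2_fields.
Context {disp : measure_display} {X : measurableType disp} {R : realType}.
Variables (mu : {measure set X -> \bar R}) (D : set X) (n : nat).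
Hypothesis mD : measurable D.
Implicit Types u v w : X -> 'rV[R]_n.

Lemma L2V_subspace : subspace (L2V mu D : set (X -> 'rV[R]_n)).
Proof.
have [L0 Ll] := L2_subspace mu mD; split=> [i|k u v u2 v2 i].
  by under eq_fun do rewrite mxE; exact: L0.
by under eq_fun do rewrite !mxE; exact: Ll.
Qed.

Lemma L2V_dotp_integrable u v : L2V mu D u -> L2V mu D v ->
  mu.-integrable D (EFin \o (fun x => dotp (u x) (v x))) /\
  ipV mu D u v = \sum_i ip mu D (fun x => u x ord0 i) (fun x => v x ord0 i).
Proof.
move=> u2 v2.
exact: (@Rintegral_sum _ _ _ mu D mD n (fun i x => u x ord0 i * v x ord0 i)
  (fun i => L2_integrableM mD (u2 i) (v2 i))).
Qed.

Lemma sum_bilinear_on (I : finType) (V : lmodType R) (W : set V)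
    (a : I -> V -> V -> R) :
  (forall i, bilinear_on W (a i)) -> bilinear_on W (fun x y => \sum_i a i x y).
Proof.
move=> b z Wz; split=> k x y Wx Wy.
  rewrite mulr_sumr -big_split/=; apply: eq_bigr => i _.
  exact: (b i z Wz).1.
rewrite mulr_sumr -big_split/=; apply: eq_bigr => i _.
exact: (b i z Wz).2.
Qed.

Lemma ipV_semi_inner : semi_inner (L2V mu D : set (X -> 'rV[R]_n)) (ipV mu D).
Proof.
have lin u : L2V mu D u -> linear_on (L2V mu D : set (X -> 'rV[R]_n)) (ipV mu D u).
  move=> u2 k v w v2 w2.
  rewrite /ipV -(integrable_linear mD k (L2V_dotp_integrable u2 v2).1
    (L2V_dotp_integrable u2 w2).1).2.
  by apply: eq_Rintegral => x _; rewrite -dotp_linear.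
have sym u v : ipV mu D u v = ipV mu D v u.
  by apply: eq_Rintegral => x _; rewrite dotpC.
split=> [u u2|u v _ _|u u2].
- by split; [exact: lin|move=> k v w v2 w2; rewrite ![ipV _ _ _ u]sym lin].
- exact: sym.
- by apply: Rintegral_ge0 => x _; exact: dotp_ge0.
Qed.

Lemma ipV_eq_ae u u' v v' :
  L2V mu D u -> L2V mu D u' -> L2V mu D v -> L2V mu D v' ->
  ae_eq mu D u u' -> ae_eq mu D v v' -> ipV mu D u v = ipV mu D u' v'.
Proof.
move=> u2 u2' v2 v2' uu vv; rewrite !(L2V_dotp_integrable _ _).2//.
apply: eq_bigr => i _; apply: ip_eq_ae => //.
  by apply: filterS uu => x h Dx; rewrite h.
by apply: filterS vv => x h Dx; rewrite h.
Qed.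

Definition L2M (A : X -> 'M[R]_n) := forall i j, L2 mu D (fun x => A x i j).

Lemma L2M_subspace : subspace (L2M : set (X -> 'M[R]_n)).
Proof.
have [L0 Ll] := L2_subspace mu mD; split=> [i j|k u v u2 v2 i j].
  by under eq_fun do rewrite mxE; exact: L0.
by under eq_fun do rewrite !mxE; exact: Ll.
Qed.

Lemma ipT_sum (A B : X -> 'M[R]_n) : L2M A -> L2M B ->
  ipT mu D A B = \sum_i \sum_j ip mu D (fun x => A x i j) (fun x => B x i j).
Proof.
move=> A2 B2.
have F i := @Rintegral_sum _ _ _ mu D mD n (fun j x => A x i j * B x i j)
  (fun j => L2_integrableM mD (A2 i j) (B2 i j)).
rewrite /ipT/frob.
rewrite (@Rintegral_sum _ _ _ mu D mD n (fun i x => \sum_j A x i j * B x i j)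
  (fun i => (F i).1)).2.
by apply: eq_bigr => i _; rewrite (F i).2.
Qed.

Lemma ipT_bilinear : bilinear_on (L2M : set (X -> 'M[R]_n)) (ipT mu D).
Proof.
have [bl _ _] := ip_semi_inner mu mD.
have LM := L2M_subspace.2.
move=> A A2; split=> k B C B2 C2; have BC2 := LM k B C B2 C2.
  rewrite !ipT_sum// mulr_sumr -big_split/=; apply: eq_bigr => i _.
  rewrite mulr_sumr -big_split/=; apply: eq_bigr => j _.
  rewrite -((bl _ (A2 i j)).1 k _ _ (B2 i j) (C2 i j)).
  by congr Defs.ip; apply/funext => x /=; rewrite !mxE.
rewrite !ipT_sum// mulr_sumr -big_split/=; apply: eq_bigr => i _.
rewrite mulr_sumr -big_split/=; apply: eq_bigr => j _.
rewrite -((bl _ (A2 i j)).2 k _ _ (B2 i j) (C2 i j)).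
by congr Defs.ip; apply/funext => x /=; rewrite !mxE.
Qed.

Lemma ipT_eq_ae (A A' B B' : X -> 'M[R]_n) : L2M A -> L2M A' -> L2M B -> L2M B' ->
  ae_eq mu D A A' -> ae_eq mu D B B' -> ipT mu D A B = ipT mu D A' B'.
Proof.
move=> A2 A2' B2 B2' AA BB; rewrite !ipT_sum//.
apply: eq_bigr => i _; apply: eq_bigr => j _; apply: ip_eq_ae => //.
  by apply: filterS AA => x h Dx; rewrite h.
by apply: filterS BB => x h Dx; rewrite h.
Qed.

End L2_fields.

(** * Boxes and Lebesgue measure *)

Section boxes.
Context {R : realType} {d : nat}.
Implicit Types (a b x y : 'rV[R]_d) (A : set 'rV[R]_d).

Definition obox a b := [set x : 'rV[R]_d | forall i, a ord0 i < x ord0 i < b ord0 i].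
Definition cbox a b := [set x : 'rV[R]_d | forall i, a ord0 i <= x ord0 i <= b ord0 i].

Lemma obox_sub_cbox a b : obox a b `<=` cbox a b.
Proof. by move=> x h i; have /andP[p q] := h i; rewrite !ltW. Qed.

Lemma rV_ballP x (e : R) y : 0 < e -> ball x e y <-> forall i, `|x ord0 i - y ord0 i| < e.
Proof.
move=> e0; split=> [[_ h] i|h]; first by have := h ord0 i.
by split=> // i j; rewrite ord1; exact: h.
Qed.

Lemma ball_obox x (e : R) : 0 < e ->
  ball x e = obox (x - const_mx e) (x + const_mx e).
Proof.
move=> e0; apply/seteqP; split=> y.
  move/(rV_ballP _ _ e0) => h i; have := h i; rewrite !mxE distrC ltr_distl.
  by [].
move=> h; apply/(rV_ballP _ _ e0) => i; have := h i.
by rewrite !mxE distrC ltr_distl.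
Qed.

(** Boxes with rational corners whose closure lies in [A]. The closure matters
    later: bump functions supported in such a box are test functions on [A]. *)
Definition rational_boxes A : set ('rV[rat]_d * 'rV[rat]_d) :=
  [set pq | cbox (map_mx ratr pq.1) (map_mx ratr pq.2) `<=` A].

Definition rational_box (pq : 'rV[rat]_d * 'rV[rat]_d) : set 'rV[R]_d :=
  obox (map_mx ratr pq.1) (map_mx ratr pq.2).

Lemma open_rational_boxes A : open A ->
  A = \bigcup_(pq in rational_boxes A) rational_box pq.
Proof.
move=> oA; apply/seteqP; split=> [x Ax|x [pq /= pqA /obox_sub_cbox]]; last exact: pqA.
have /nbhs_ballP[e /= e0 eA] : nbhs x A by exact: open_nbhs_nbhs.
have lo i : exists q : rat, x ord0 i - e < ratr q < x ord0 i.
  have [|q] := @rat_in_itvoo R (x ord0 i - e) (x ord0 i); first by rewrite gtrBl.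
  by rewrite in_itv/=; exists q.
have hi i : exists q : rat, x ord0 i < ratr q < x ord0 i + e.
  have [|q] := @rat_in_itvoo R (x ord0 i) (x ord0 i + e); first by rewrite ltrDl.
  by rewrite in_itv/=; exists q.
have [p pP] := choice lo; have [q qP] := choice hi.
exists (\row_i p i, \row_i q i) => /=.
  move=> y /= h; apply: eA; apply/(rV_ballP _ _ e0) => i; have := h i.
  rewrite !mxE distrC ltr_distl => /andP[h1 h2].
  have /andP[h3 _] := pP i; have /andP[_ h4] := qP i.
  by rewrite (lt_le_trans h3)//= (le_lt_trans h2).
by move=> i; rewrite !mxE; have /andP[_ ->] := pP i; have /andP[-> _] := qP i.
Qed.

(** The source [T] is arbitrary so that [f] can also be the identity of the
    same space with the sigma-algebra generated by the boxes. *)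
Lemma open_measurable_of_boxes disp (T : measurableType disp) (f : T -> 'rV[R]_d) A :
  (forall a b, measurable (f @^-1` obox a b)) -> open A -> measurable (f @^-1` A).
Proof.
move=> mf /open_rational_boxes ->; rewrite preimage_bigcup bigcup_mkcond.
apply: countable_bigcupT_measurable; first exact: countableP.
by move=> pq; case: ifP => _ //; exact: mf.
Qed.

Lemma measurable_obox a b : measurable (obox a b).
Proof.
rewrite (_ : obox a b = \bigcap_(i in [set: 'I_d])
   ((fun x : 'rV[R]_d => x ord0 i) @^-1` `]a ord0 i, b ord0 i[%classic)).
  apply: fin_bigcap_measurable => [|i _]; first exact: finite_finset.
  by rewrite -[X in measurable X]setTI; apply: measurable_coor.
apply/seteqP; split=> x /= h i; last by have := h i I; rewrite /= in_itv.
by move=> _; rewrite /= in_itv/=; exact: h.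
Qed.

Lemma open_measurable_rV A : open A -> measurable A.
Proof.
by apply: (@open_measurable_of_boxes _ _ id) => a b; exact: measurable_obox.
Qed.

Lemma closed_measurable_rV A : closed A -> measurable A.
Proof.
by move=> cA; rewrite -(setCK A); apply: measurableC; apply: open_measurable_rV; exact: closed_openC.
Qed.

Lemma continuous_measurable_rV (f : 'rV[R]_d -> R) : continuous f ->
  measurable_fun setT f.
Proof.
move=> /continuousP cf; apply: (measurability _ (RGenOpens.measurableE R)).
move=> _ [_ [a [b ->] <-]]; rewrite setTI; apply: open_measurable_rV.
exact/cf/interval_open.
Qed.

Definition oboxes : set (set 'rV[R]_d) := [set obox ab.1 ab.2 | ab in setT].

Lemma obox_setI a b a' b' : obox a b `&` obox a' b' =
  obox (\row_i Num.max (a ord0 i) (a' ord0 i)) (\row_i Num.min (b ord0 i) (b' ord0 i)).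
Proof.
apply/seteqP; split=> x /=.
  move=> [h h'] i; rewrite !mxE gt_max lt_min.
  by have /andP[-> ->] := h i; have /andP[-> ->] := h' i.
by move=> h; split=> i; have := h i; rewrite !mxE gt_max lt_min;
  move=> /andP[/andP[h1 h2] /andP[h3 h4]]; apply/andP.
Qed.

Lemma oboxesI : setI_closed oboxes.
Proof.
by move=> _ _ [[a b] _ <-] [[a' b'] _ <-] /=; rewrite obox_setI; eexists (_, _).
Qed.

Lemma measurable_oboxes : @measurable _ 'rV[R]_d = <<s oboxes >>.
Proof.
apply/seteqP; split; last first.
  apply: smallest_sub; first exact: sigma_algebra_measurable.
  by move=> _ [[a b] _ <-]; exact: measurable_obox.
have open_gen (A : set 'rV[R]_d) : open A -> <<s oboxes >> A.
  move=> oA; apply: (@open_measurable_of_boxes _ (g_sigma_algebraType oboxes) id A _ oA).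
  by move=> a b; apply: sub_sigma_algebra; exists (a, b).
have coor i : measurable_fun (setT : set (g_sigma_algebraType oboxes))
    (fun x : 'rV[R]_d => x ord0 i).
  apply: (measurability _ (RGenOpens.measurableE R)).
  move=> _ [_ [a [b ->] <-]]; rewrite setTI; apply: open_gen.
  by have /continuousP := @coord_continuous R 1 d ord0 i; apply; exact: interval_open.
apply: smallest_sub; first exact: smallest_sigma_algebra.
rewrite -bigcup_seq => B [i _ [C mC <-]] /=.
exact: coor.
Qed.

End boxes.

Section lebesgue_of_boxes.
Context {R : realType}.

(** By induction on the dimension, as the measure is an iterated product; only
    positivity and finiteness of the volume are needed. *)
Lemma lebesgue_obox d (a b : 'rV[R]_d) : (forall i, a ord0 i < b ord0 i) ->
  exists2 r : R, 0 < r & lebesgue_rV d (obox a b) = r%:E.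
Proof.
elim: d a b => [|d IH] a b ab.
  exists 1 => //; rewrite (_ : obox a b = setT).
    by rewrite /= diracT.
  by apply/seteqP; split=> // x _ [].
have [r r0 rE] := IH (\row_i a ord0 (lift ord0 i)) (\row_i b ord0 (lift ord0 i))
  (fun i => ltac:(by rewrite !mxE; exact: ab)).
exists ((b ord0 ord0 - a ord0 ord0) * r); first by rewrite mulr_gt0// subr_gt0.
rewrite -[LHS]/((@lebesgue_measure R \x lebesgue_rV d)%E
  (@row_cons R d @^-1` obox a b)).
have -> : @row_cons R d @^-1` obox a b = `]a ord0 ord0, b ord0 ord0[%classic `*`
   obox (\row_i a ord0 (lift ord0 i)) (\row_i b ord0 (lift ord0 i)).
  apply/seteqP; split=> -[t y] /=.
    move=> h; split=> [|i].
      by have := h ord0; rewrite /= in_itv /row_cons/= mxE unlift_none.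
    by have := h (lift ord0 i); rewrite /row_cons !mxE liftK.
  rewrite in_itv/= => -[h1 h2] i; rewrite /row_cons mxE.
  case: (unliftP ord0 i) => [j|] ->; last by [].
  by have := h2 j; rewrite !mxE.
rewrite product_measure1E//; last exact: measurable_obox.
by rewrite /= rE lebesgue_measure_itv/= lte_fin ab EFinM EFinB.
Qed.

Lemma lebesgue_bounded d (A : set 'rV[R]_d) (M : R) : measurable A ->
  (forall x, A x -> `|x| <= M) -> (lebesgue_rV d A < +oo)%E.
Proof.
move=> mA AM.
have [|r _ rE] := @lebesgue_obox d (const_mx (- (`|M| + 1))) (const_mx (`|M| + 1)).
  by move=> i; rewrite !mxE gtrN// ltr_wpDl.
apply: (@le_lt_trans _ _ (lebesgue_rV d (obox (const_mx (- (`|M| + 1))) (const_mx (`|M| + 1))))).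
  apply: le_measure; rewrite ?inE//; first exact: measurable_obox.
  move=> x /AM xM i; rewrite !mxE -ltr_norml.
  apply: le_lt_trans (coord_le_norm x i) _.
  by rewrite (le_lt_trans xM)// (le_lt_trans (ler_norm M))// ltrDl.
by rewrite rE ltry.
Qed.

Lemma lebesgue_open_gt0 d (A : set 'rV[R]_d) : open A -> A !=set0 ->
  (0 < lebesgue_rV d A)%E.
Proof.
move=> oA [x Ax]; have /nbhs_ballP[e /= e0 eA] : nbhs x A by exact: open_nbhs_nbhs.
have [|r r0 rE] := @lebesgue_obox d (x - const_mx e) (x + const_mx e).
  by move=> i; rewrite !mxE ltrD2l gtrN.
apply: (@lt_le_trans _ _ (lebesgue_rV d (ball x e))).
  by rewrite ball_obox// rE lte_fin.
apply: le_measure => //; rewrite inE; last exact: open_measurable_rV.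
by rewrite ball_obox//; exact: measurable_obox.
Qed.

Lemma lebesgue_ae_open d (A : set 'rV[R]_d) (P : 'rV[R]_d -> Prop) :
  open A -> A !=set0 -> {ae lebesgue_rV d, forall x, A x -> P x} ->
  exists2 x, A x & P x.
Proof.
move=> oA A0 [N [mN N0 NP]]; apply: contrapT => h.
have : (lebesgue_rV d A <= lebesgue_rV d N)%E.
  apply: le_measure; rewrite ?inE//; first exact: open_measurable_rV.
  by move=> x Ax; apply: NP => /= /(_ Ax) Px; apply: h; exists x.
by rewrite N0 leNgt lebesgue_open_gt0.
Qed.

End lebesgue_of_boxes.

(** * Continuously differentiable functions *)

Section continuously_differentiable.
Context {R : realType} {d : nat}.
Implicit Types (phi : 'rV[R]_d -> R) (x y v : 'rV[R]_d).

Lemma derivable_line phi v x t : derivable phi (x + t *: v) v ->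
  is_derive t 1 (fun s => phi (x + s *: v)) ('D_v phi (x + t *: v)).
Proof.
move=> dphi; pose g s := phi (x + s *: v).
have E : (fun h => h^-1 *: ((g \o shift t) (h *: 1) - g t)) =
         (fun h => h^-1 *: ((phi \o shift (x + t *: v)) (h *: v) - phi (x + t *: v))).
  apply/funext => h; rewrite /g /= /shift/=; congr (_ *: (phi _ - _)).
  by apply/rowP => i; rewrite !mxE -[h *: 1]/(h * 1); ring.
by split; rewrite ?/derivable ?/derive -/g E.
Qed.

Lemma mean_value_line phi v x h : (forall z, derivable phi z v) ->
  exists2 t : R, `|t| <= `|h| &
    phi (x + h *: v) - phi x = h * 'D_v phi (x + t *: v).
Proof.
move=> dphi; pose g s := phi (x + s *: v).
have dg (t : R) : is_derive t 1 g ('D_v phi (x + t *: v)) by exact: derivable_line.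
have cg : continuous g.
  by move=> t; apply/differentiable_continuous/derivable1_diffP; case: (dg t).
have g0 : g 0 = phi x by rewrite /g scale0r addr0.
have [h0|h0|->] := ltgtP h 0.
- have [t] := MVT h0 (fun t _ => dg t) (continuous_subspaceT cg).
  rewrite in_itv/= => /andP[ht t0]; rewrite g0 -/(g h) => e; exists t.
    by rewrite !ltr0_norm// lerN2 ltW.
  by move: e; rewrite sub0r mulrN mulrC; lra.
- have [t] := MVT h0 (fun t _ => dg t) (continuous_subspaceT cg).
  rewrite in_itv/= => /andP[t0 th]; rewrite g0 -/(g h) => e; exists t.
    by rewrite !gtr0_norm// ltW.
  by rewrite e subr0 mulrC.
- by exists 0 => //; rewrite !scale0r addr0 mul0r subrr.
Qed.

(** Move from [x] to [y] one coordinate at a time and apply the mean value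
    theorem along each axis, where the partial derivatives are locally
    bounded. *)
Lemma is_C1_continuous phi : is_C1 phi -> continuous phi.
Proof.
move=> C1 x.
pose M := \sum_i `|pderiv phi i x| + 1.
have M0 : 0 < M by rewrite ltr_wpDl// sumr_ge0.
have near_bound : nbhs x [set y | forall i, `|pderiv phi i y| <= M].
  apply: (@filter_forall _ _ (fun i y => `|pderiv phi i y| <= M) (nbhs x)).
  move=> i; have := (C1 i).2 x.
  move=> /(@cvgrPdist_lt _ _ _ (nbhs x) (nbhs_filter x)) /(_ 1 ltr01).
  apply: filterS => y h.
  rewrite /M (bigD1 i)//= -addrA (addrC _ 1) addrA; apply: ler_wpDr.
    exact: sumr_ge0.
  have := ler_normB (pderiv phi i x) (pderiv phi i x - pderiv phi i y).
  by rewrite subKr => /le_trans; apply; rewrite lerD2l ltW.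
have /nbhs_ballP[r /= r0 rM] := near_bound.
apply/(@cvgrPdist_lt _ _ _ (nbhs x) (nbhs_filter x)) => e e0.
have dM0 : 0 < d%:R * M + 1 by rewrite ltr_wpDl// mulr_ge0// ltW.
pose del := Num.min r (e / (d%:R * M + 1)).
have del0 : 0 < del by rewrite lt_min r0 divr_gt0.
apply/nbhs_ballP; exists del => //= y /(rV_ballP _ _ del0) xy.
pose p k : 'rV[R]_d := \row_i (if (i < k)%N then y ord0 i else x ord0 i).
have step (k : 'I_d) : `|phi (p k.+1) - phi (p k)| <= M * del.
  have -> : p k.+1 = p k + (y ord0 k - x ord0 k) *: delta_mx ord0 k.
    apply/rowP => i; rewrite !mxE ltnS leq_eqVlt !eqxx/=.
    have [->|ik] := eqVneq i k; first by rewrite eqxx ltnn/= mulr1 subrKC.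
    by rewrite (negPf (_ : (i : nat) != k))//= mulr0 addr0.
  have [t th ->] := @mean_value_line phi (delta_mx ord0 k) (p k) (y ord0 k - x ord0 k)
    (C1 k).1.
  rewrite normrM mulrC; apply: ler_pM => //.
  - apply: rM; apply/(rV_ballP _ _ r0) => i; rewrite !mxE eqxx/=.
    have xyr j : `|x ord0 j - y ord0 j| < r by apply: lt_le_trans (xy j) _; rewrite ge_min lexx.
    have [->|ik] := eqVneq i k.
      rewrite ltnn mulr1 opprD addrA subrr sub0r normrN (le_lt_trans th)//.
      by rewrite distrC.
    by rewrite mulr0 addr0; case: ifP => _ //; rewrite subrr normr0.
  - by rewrite distrC ltW.
have tele : phi y - phi x = \sum_(k < d) (phi (p k.+1) - phi (p k)).
  rewrite -(big_mkord xpredT (fun k => phi (p k.+1) - phi (p k))) telescope_sumr//.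
  congr (phi _ - phi _); apply/rowP => i; rewrite mxE ?ltn_ord//.
rewrite distrC tele (le_lt_trans (ler_norm_sum _ _ _))//.
apply: (@le_lt_trans _ _ (d%:R * M * del)).
  apply: (le_trans (ler_sum _ (fun k _ => step k))).
  by rewrite sumr_const card_ord -[_ *+ _]mulr_natl mulrA.
apply: (@lt_le_trans _ _ ((d%:R * M + 1) * del)); first by rewrite ltr_pM2r// ltrDl.
by rewrite mulrC -ler_pdivlMr// ge_min lexx orbT.
Qed.

End continuously_differentiable.

(** * Test functions and the fundamental lemma of the calculus of variations *)

Section test_functions.
Context {R : realType} {d : nat}.
Variable Om : set 'rV[R]_d.
Hypothesis Om_open : open Om.
Local Notation leb := (lebesgue_rV d).

Lemma compact_support_L2 (f : 'rV[R]_d -> R) (K : set 'rV[R]_d) :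
  continuous f -> compact K -> (forall x, ~ K x -> f x = 0) -> L2 leb Om f.
Proof.
move=> cf cK f0.
have mf : measurable_fun setT f by exact: continuous_measurable_rV.
have mOm := open_measurable_rV Om_open.
have mK : measurable K.
  by apply: closed_measurable_rV; apply: (compact_closed (@norm_hausdorff _ 'rV[R]_d) cK).
apply: integrable_sqr_L2; first exact: measurable_funTS.
apply: (@integrableS _ _ _ _ setT) => //.
have -> : EFin \o (fun x => f x ^+ 2) = (EFin \o (fun x => f x ^+ 2)) \_ K.
  apply/funext => x; rewrite /patch; case: ifPn => // /negP.
  by rewrite inE => /f0 /= ->; rewrite expr0n.
apply/(integrable_mkcond _ mK); apply: measurable_bounded_integrable => //.
- have [M [_ MK]] := compact_bounded cK.
  by apply: (@lebesgue_bounded _ _ _ (M + 1)) => // x Kx; apply: MK => //; rewrite ltrDl.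
- by apply: measurable_funTS; exact: measurable_funX.
- have cf2 : continuous (fun x => f x ^+ 2).
    under eq_fun do rewrite expr2.
    exact: continuous_mul.
  have [|M [Mr MK]] := @compact_bounded _ _ ((fun x => f x ^+ 2) @` K).
    by apply: continuous_compact => //; exact: continuous_subspaceT.
  by exists M; split=> // N MN x Kx; apply: MK => //; exists x.
Qed.

Lemma pderiv_outside_support (phi : 'rV[R]_d -> R) i x :
  ~ closure [set y | phi y != 0] x -> pderiv phi i x = 0.
Proof.
move=> nx; have ox : \near x, phi x = cst 0 x.
  have : nbhs x (~` closure [set y | phi y != 0]).
    by apply: open_nbhs_nbhs; split=> //; exact/closed_openC/closed_closure.
  apply: filterS => y ny; apply: contrapT => /eqP y0; apply: ny.
  exact: subset_closure.
by rewrite /pderiv (near_eq_derive _ ox) derive_cst.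
Qed.

Lemma test_function_L2 phi : test_function Om phi ->
  L2 leb Om phi /\ forall i, L2 leb Om (pderiv phi i).
Proof.
move=> [C1 cK _]; split=> [|i].
  apply: (compact_support_L2 (is_C1_continuous C1) cK) => x nx.
  by apply: contrapT => /eqP h; apply: nx; exact: subset_closure.
apply: (compact_support_L2 (C1 i).2 cK) => x nx.
exact: pderiv_outside_support.
Qed.

End test_functions.

Section bump_functions.
Context {R : realType}.

Definition C1_deriv (f f' : R -> R) :=
  (forall t : R, is_derive t 1 f (f' t)) /\ continuous f'.

Lemma C1_deriv_continuous f f' : C1_deriv f f' -> continuous f.
Proof.
by move=> [df _] t; apply/differentiable_continuous/derivable1_diffP; case: (df t).
Qed.

Lemma C1_deriv_eq f f' g g' : f =1 g -> f' =1 g' ->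
  C1_deriv f f' -> C1_deriv g g'.
Proof. by move=> /funext -> /funext ->. Qed.

Lemma C1_derivD f f' g g' : C1_deriv f f' -> C1_deriv g g' ->
  C1_deriv (fun t => f t + g t) (fun t => f' t + g' t).
Proof.
move=> [df cf] [dg cg]; split=> [t|]; last exact: continuous_add.
exact: (@is_deriveD _ _ _ f g).
Qed.

Lemma C1_derivM f f' g g' : C1_deriv f f' -> C1_deriv g g' ->
  C1_deriv (fun t => f t * g t) (fun t => f t * g' t + g t * f' t).
Proof.
move=> Cf Cg; have cf := C1_deriv_continuous Cf; have cg := C1_deriv_continuous Cg.
case: Cf Cg => [df cf'] [dg cg']; split=> [t|].
  exact: (@is_deriveM _ _ f g).
by apply: continuous_add; exact: continuous_mul.
Qed.

Lemma C1_deriv_cst c : C1_deriv (fun=> c) (fun=> 0).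
Proof. by split=> [t|]; [exact: is_derive_cst|exact: continuous_const]. Qed.

Lemma C1_deriv_affine f f' k c : C1_deriv f f' ->
  C1_deriv (fun t => f (k * t + c)) (fun t => f' (k * t + c) * k).
Proof.
move=> [df cf].
have dA (t : R) : is_derive t 1 (fun t => k * t + c) k.
  have := is_deriveD (is_deriveZ k (is_derive_id t 1)) (is_derive_cst c t 1).
  by rewrite addr0 -[X in is_derive _ _ _ X]/(k * 1) mulr1.
split=> [t|].
  exact: (@is_derive1_comp _ f (fun t => k * t + c)).
have cA : continuous (fun t => k * t + c).
  apply: continuous_add; last exact: continuous_const.
  apply: continuous_mul; [exact: continuous_const|by move=> t; exact: cvg_id].
apply: continuous_mul; last exact: continuous_const.
by move=> t; apply: continuous_comp; [exact: cA|exact: cf].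
Qed.

(** The error of the first-order expansion of the square of the positive part
    lies between [0] and [h^2] whatever the signs of [t] and [t + h]. *)
Lemma C1_deriv_sqr_pos :
  C1_deriv (fun t => Num.max 0 t ^+ 2) (fun t => 2 * Num.max 0 t).
Proof.
have cmax : continuous (fun t : R => Num.max 0 t).
  move=> t; apply/(@cvgrPdist_lt _ _ _ (nbhs t) (nbhs_filter t)) => e e0.
  apply/nbhs_ballP; exists e => // u /=; apply: le_lt_trans.
  have h1 := ler_norm (t - u); have h2 := ler_norm (- (t - u)).
  rewrite normrN in h2; rewrite ler_norml.
  by have [t0|t0] := leP 0 t; have [u0|u0] := leP 0 u; apply/andP; split; lra.
split; last first.
  by apply: continuous_mul => //; exact: continuous_const.
move=> t.
have key (h : R) : `|Num.max 0 (h + t) ^+ 2 - Num.max 0 t ^+ 2 - 2 * Num.max 0 t * h| <= h ^+ 2.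
  rewrite ler_norml; have h2 := sqr_ge0 h.
  have [t0|t0] := leP 0 t; have [ht|ht] := leP 0 (h + t);
    apply/andP; split; nra.
have cvgq : (fun h => h^-1 *: (((fun t => Num.max 0 t ^+ 2) \o shift t) (h *: 1)
    - Num.max 0 t ^+ 2)) @ (0 : R)^' --> 2 * Num.max 0 t.
  apply/cvgrPdist_lt => e e0; near=> h.
  have h0 : h != 0 by near: h; exact: nbhs_dnbhs_neq.
  have he : `|h| < e by near: h; exact: dnbhs0_lt.
  apply: le_lt_trans he; rewrite /= /shift/= -[h *: 1]/(h * 1) mulr1.
  rewrite -[h^-1 *: _]/(h^-1 * _) distrC.
  set q := Num.max 0 (h + t) ^+ 2 - _.
  have -> : h^-1 * q - 2 * Num.max 0 t = h^-1 * (q - 2 * Num.max 0 t * h) by field.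
  rewrite normrM normfV ler_pdivrMl ?normr_gt0//.
  by rewrite -expr2 real_normK ?num_real//; exact: key.
by split; [apply/cvg_ex; exists (2 * Num.max 0 t)|exact: cvg_lim cvgq].
Unshelve. all: by end_near. Qed.

(** A quadratic spline that is [0] for [t <= 0] and [1] for [1 <= t]; it is a
    combination of translates of the squared positive part, the only function
    that has to be differentiated by hand. *)
Definition smoothstep (t : R) : R :=
  2 * Num.max 0 t ^+ 2 - 4 * Num.max 0 (t - 2^-1) ^+ 2 + 2 * Num.max 0 (t - 1) ^+ 2.

Definition dsmoothstep (t : R) : R :=
  4 * Num.max 0 t - 8 * Num.max 0 (t - 2^-1) + 4 * Num.max 0 (t - 1).

Lemma C1_smoothstep : C1_deriv smoothstep dsmoothstep.
Proof.
have q c k := C1_derivM (C1_deriv_cst k) (C1_deriv_affine 1 c C1_deriv_sqr_pos).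
have := C1_derivD (C1_derivD (q 0 2) (q (- 2^-1) (- 4))) (q (- 1) 2).
apply: C1_deriv_eq => t; rewrite !mul1r addr0.
  by rewrite /smoothstep mulNr.
rewrite /dsmoothstep; ring.
Qed.

Lemma smoothstep0 t : t <= 0 -> smoothstep t = 0.
Proof.
move=> t0; rewrite /smoothstep !(@max_l _ R 0); [ring|lra..].
Qed.

Lemma smoothstep1 t : 1 <= t -> smoothstep t = 1.
Proof.
move=> t1; rewrite /smoothstep !(@max_r _ R 0); [|lra..].
by field.
Qed.

Lemma smoothstep_ge0_le1 t : 0 <= smoothstep t <= 1.
Proof.
have [t0|t0] := leP t 0; first by rewrite smoothstep0// lexx ler01.
have [t1|t1] := leP 1 t; first by rewrite smoothstep1// lexx ler01.
rewrite /smoothstep (@max_r _ R 0 t) ?(ltW t0)// (@max_l _ R 0 (t - 1)); last lra.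
have [h|h] := leP 0 (t - 2^-1).
  have -> : 2 * t ^+ 2 - 4 * (t - 2^-1) ^+ 2 + 2 * 0 ^+ 2 = 1 - 2 * (1 - t) ^+ 2.
    by field.
  by apply/andP; split; nra.
by apply/andP; split; nra.
Qed.

(** Supported between [a] and [b], and equal to [1] at distance at least [1/k]
    from both. *)
Definition bump (k a b t : R) : R :=
  smoothstep (k * t + - (k * a)) * smoothstep (- k * t + k * b).

Definition dbump (k a b t : R) : R :=
  smoothstep (k * t + - (k * a)) * (dsmoothstep (- k * t + k * b) * - k)
  + smoothstep (- k * t + k * b) * (dsmoothstep (k * t + - (k * a)) * k).

Lemma C1_bump k a b : C1_deriv (bump k a b) (dbump k a b).
Proof. by apply: C1_derivM; apply: C1_deriv_affine; exact: C1_smoothstep. Qed.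

Lemma bump_ge0_le1 k a b t : 0 <= bump k a b t <= 1.
Proof.
have /andP[h1 h2] := smoothstep_ge0_le1 (k * t + - (k * a)).
have /andP[h3 h4] := smoothstep_ge0_le1 (- k * t + k * b).
by rewrite /bump mulr_ge0//= mulr_ile1.
Qed.

Lemma bump_support k a b t : 0 <= k -> bump k a b t != 0 -> a < t < b.
Proof.
move=> k0; apply: contra_neqT; rewrite negb_and -!leNgt => /orP[h|h]; rewrite /bump.
  by rewrite smoothstep0 ?mul0r//; nra.
by rewrite [X in _ * X]smoothstep0 ?mulr0//; nra.
Qed.

Lemma bump_eq1 k a b t : 0 < k -> k^-1 <= t - a -> k^-1 <= b - t -> bump k a b t = 1.
Proof.
move=> k0 h1 h2; rewrite /bump !smoothstep1 ?mulr1//.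
  by rewrite (_ : _ + _ = k * (b - t)); [rewrite -ler_pdivrMl// mulr1|ring].
by rewrite (_ : _ + _ = k * (t - a)); [rewrite -ler_pdivrMl// mulr1|ring].
Qed.

End bump_functions.

Section tensor_products.
Context {R : realType} {d : nat}.

Lemma is_C1_tensor (th dth : 'I_d -> R -> R) : (forall i, C1_deriv (th i) (dth i)) ->
  is_C1 (fun x : 'rV[R]_d => \prod_i th i (x ord0 i)).
Proof.
move=> Cth i; pose phi (x : 'rV[R]_d) := \prod_j th j (x ord0 j).
pose rest (x : 'rV[R]_d) := \prod_(j | j != i) th j (x ord0 j).
have phiE x : phi x = th i (x ord0 i) * rest x by rewrite /phi (bigD1 i).
have D x : is_derive x (delta_mx ord0 i) phi (rest x * dth i (x ord0 i)).
  have E : (fun h => h^-1 *: ((phi \o shift x) (h *: delta_mx ord0 i) - phi x)) =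
    (fun h => rest x * (h^-1 *: ((th i \o shift (x ord0 i)) (h *: 1) - th i (x ord0 i)))).
    apply/funext => h; rewrite /= /shift/= !phiE.
    have -> : rest (h *: delta_mx ord0 i + x) = rest x.
      by apply: eq_bigr => j ji; rewrite !mxE eqxx (negPf ji)/= mulr0 add0r.
    rewrite !mxE !eqxx/=.
    rewrite -[LHS]/(h^-1 * (th i (h * 1 + x ord0 i) * rest x - th i (x ord0 i) * rest x)).
    rewrite -[RHS]/(rest x * (h^-1 * (th i (h * 1 + x ord0 i) - th i (x ord0 i)))).
    ring.
  have [dth1 dth2] := (Cth i).1 (x ord0 i).
  have cv : (fun h => h^-1 *: ((phi \o shift x) (h *: delta_mx ord0 i) - phi x)) @ (0 : R)^'
      --> rest x * dth i (x ord0 i).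
    rewrite E; apply: cvgM; first exact: cvg_cst.
    by rewrite -dth2; exact: dth1.
  by split; [apply/cvg_ex; eexists; exact: cv|exact: cvg_lim cv].
split=> [x|]; first by case: (D x).
have -> : pderiv (fun x : 'rV[R]_d => \prod_i th i (x ord0 i)) i =
    (fun x => rest x * dth i (x ord0 i)).
  by apply/funext => x; case: (D x).
have coordC j (f : R -> R) : continuous f -> continuous (fun x : 'rV[R]_d => f (x ord0 j)).
  by move=> cf x; apply: (@continuous_comp _ _ _ (fun x : 'rV[R]_d => x ord0 j) f);
    [exact: coord_continuous|exact: cf].
apply: continuous_mul; last exact: coordC (Cth i).2.
have -> : rest = fun x => \prod_j if j != i then th j (x ord0 j) else 1.
  by apply/funext => x; rewrite /rest big_mkcond.
apply: continuous_bigprod => j; case: (j != i); last exact: continuous_const.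
by apply: coordC; exact: C1_deriv_continuous (Cth j).
Qed.

Definition box_bump (k : R) (a b x : 'rV[R]_d) : R :=
  \prod_i bump k (a ord0 i) (b ord0 i) (x ord0 i).

Lemma box_bump_ge0_le1 k a b x : 0 <= box_bump k a b x <= 1.
Proof.
rewrite /box_bump; elim/big_ind : _ => [|u v /andP[u0 u1] /andP[v0 v1]|i _].
- by rewrite ler01 lexx.
- by rewrite mulr_ge0//= mulr_ile1.
- exact: bump_ge0_le1.
Qed.

Lemma box_bump_support k a b : 0 <= k -> [set x | box_bump k a b x != 0] `<=` obox a b.
Proof.
move=> k0 x /= /prodf_neq0 h i; exact: bump_support (h i isT).
Qed.

Lemma closed_cbox (a b : 'rV[R]_d) : closed (cbox a b).
Proof.
rewrite (_ : cbox a b = \bigcap_(i in [set: 'I_d])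
   ((fun x : 'rV[R]_d => x ord0 i) @^-1` `[a ord0 i, b ord0 i]%classic)).
  apply: closed_bigI => i _; apply: preimage_closed; last exact: interval_closed.
  by move=> x _; exact: coord_continuous.
by apply/seteqP; split=> x h i; have := h i; rewrite /= in_itv//=; exact.
Qed.

Lemma compact_cbox (a b : 'rV[R]_d) : compact (cbox a b).
Proof.
apply: bounded_closed_compact; last exact: closed_cbox.
exists (`|a| + `|b|); split=> [|M abM x xab]; first exact: num_real.
rewrite /= [leLHS]/Num.norm/= mx_normrE; apply: bigmax_le.
  by rewrite (le_trans _ (ltW abM))// addr_ge0.
move=> [i j] _ /=; rewrite ord1; have /andP[h1 h2] := xab j.
apply: le_trans (ltW abM); have := coord_le_norm a j; have := coord_le_norm b j.
rewrite !ler_norml => /andP[b1 b2] /andP[a1 a2].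
have := normr_ge0 a; have := normr_ge0 b => *; apply/andP; split; lra.
Qed.

Lemma box_bump_test k a b (Om : set 'rV[R]_d) : 0 <= k -> cbox a b `<=` Om ->
  test_function Om (box_bump k a b).
Proof.
move=> k0 abOm.
have sub : closure [set x | box_bump k a b x != 0] `<=` cbox a b.
  rewrite ((closure_id (cbox a b)).1 (@closed_cbox a b)); apply: closureS.
  by apply: subset_trans (box_bump_support k0) _; exact: obox_sub_cbox.
split; [|exact: (subclosed_compact (@closed_closure _ _) (@compact_cbox a b) sub)
        |exact: subset_trans abOm].
apply: (@is_C1_tensor (fun i => bump k (a ord0 i) (b ord0 i))
  (fun i => dbump k (a ord0 i) (b ord0 i))) => i.
exact: C1_bump.
Qed.

Lemma box_bump_cvg a b (x : 'rV[R]_d) :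
  \forall n \near \oo, box_bump n.+1%:R a b x = \1_(obox a b) x.
Proof.
have [xab|xab] := pselect (obox a b x); last first.
  rewrite indicE memNset//; apply: nearW => n.
  by apply/eqP; apply: contra_notT xab => h; apply: box_bump_support h; rewrite ler0n.
rewrite indicE mem_set//.
have : \forall n \near \oo, forall i : 'I_d,
    n.+1%:R^-1 <= x ord0 i - a ord0 i /\ n.+1%:R^-1 <= b ord0 i - x ord0 i.
  apply: filter_forall => i; have /andP[h1 h2] := xab i.
  rewrite -subr_gt0 in h1; rewrite -subr_gt0 in h2.
  have := near_infty_natSinv_lt (PosNum h1); have := near_infty_natSinv_lt (PosNum h2).
  by apply: filterS2 => n /ltW ? /ltW.
apply: filterS => n h; rewrite /box_bump big1// => i _.
by have [h1 h2] := h i; rewrite bump_eq1// ltr0n.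
Qed.

End tensor_products.

Section fundamental_lemma.
Context {R : realType} {d : nat}.
Variable Om : set 'rV[R]_d.
Hypothesis Om_open : open Om.
Local Notation leb := (lebesgue_rV d).
Variable h : 'rV[R]_d -> R.
Hypotheses (h2 : L2 leb Om h)
  (h_test : forall phi, test_function Om phi -> ip leb Om h phi = 0).

Let mOm : measurable Om. Proof. exact: open_measurable_rV. Qed.

Lemma indic_obox_L2 a b : L2 leb Om (\1_(obox a b) : 'rV[R]_d -> R).
Proof.
have mb : measurable_fun Om (\1_(obox a b) : 'rV[R]_d -> R).
  by apply: measurable_funTS; apply: measurable_indic; exact: measurable_obox.
apply: integrable_sqr_L2 => //.
have -> : (fun x => \1_(obox a b) x ^+ 2) = (\1_(obox a b) : 'rV[R]_d -> R).
  by apply/funext => x; rewrite indicE; case: (x \in _); rewrite ?expr1n ?expr0n.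
apply: (@integrableS _ _ _ _ setT) => //.
have [ab|ab] := pselect (forall i, a ord0 i < b ord0 i); last first.
  rewrite (_ : obox a b = set0).
    by rewrite indic0; exact: integrable0.
  apply/seteqP; split=> // x xab; apply: ab => i.
  by have /andP[] := xab i; exact: lt_trans.
have -> : EFin \o (\1_(obox a b) : 'rV[R]_d -> R) = (EFin \o cst 1) \_ (obox a b).
  by apply/funext => x; rewrite /patch /= indicE; case: ifP.
apply/(integrable_mkcond _ (measurable_obox a b)).
apply: measurable_bounded_integrable => //; first exact: measurable_obox.
  by have [r _ rE] := lebesgue_obox ab; apply: (eq_ind_r (fun y => (y < +oo)%E) _ rE); exact: ltry.
by exists 1; split=> // M M1 x _ /=; rewrite normr1 ltW.
Qed.

Let h_local a b :
  leb.-integrable (Om `&` obox a b) (EFin \o h).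
Proof.
have mb := measurable_obox a b.
apply: (@eq_integrable _ _ _ _ _ (measurableI _ _ mOm mb)
   (EFin \o (fun x => h x * \1_(obox a b) x))).
  by move=> x; rewrite inE => -[_ xb]; rewrite /= indicE mem_set// mulr1.
apply: (@integrableS _ _ _ _ Om) => //; first exact: measurableI.
exact: L2_integrableM (indic_obox_L2 _ _).
Qed.

Let h_box a b : cbox a b `<=` Om -> (\int[leb]_(x in obox a b) (h x)%:E = 0)%E.
Proof.
move=> abOm.
have mb := measurable_obox a b.
have bOm : obox a b `<=` Om by apply: subset_trans abOm; exact: obox_sub_cbox.
have tb n : test_function Om (box_bump n.+1%:R a b).
  by apply: box_bump_test => //; rewrite ler0n.
have ib := L2_integrableM mOm h2 (indic_obox_L2 a b).
have [] := @dominated_convergence _ _ _ leb Om mOm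
  (fun n x => (h x * box_bump n.+1%:R a b x)%:E) (fun x => (h x * \1_(obox a b) x)%:E)
  (fun x => `|(h x * \1_(obox a b) x)%:E|%E).
- move=> n; case/integrableP : (L2_integrableM mOm h2 (test_function_L2 Om_open (tb n)).1).
  by [].
- by case/integrableP: ib.
- apply: aeW => x Ox; apply: cvg_near_cst.
  by apply: filterS (box_bump_cvg a b x) => n ->.
- exact: integrable_abse.
- apply: aeW => x n Ox /=; rewrite lee_fin !normrM ler_wpM2l//.
  have /andP[b0 b1] := box_bump_ge0_le1 n.+1%:R a b x.
  rewrite ger0_norm// ger0_norm ?indicE//.
  have [xab|xab] := boolP (x \in obox a b); first exact: b1.
  suff -> : box_bump n.+1%:R a b x = 0 by [].
  apply/eqP; apply: contraNT xab => hb; rewrite inE.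
  by apply: box_bump_support hb; rewrite ler0n.
move=> _ _; rewrite (_ : [sequence _]_n = cst 0%E); last first.
  apply/funext => n /=.
  rewrite -[LHS]fineK; first by congr EFin; exact: h_test (tb n).
  exact: integrable_fin_num (L2_integrableM mOm h2 (test_function_L2 Om_open (tb n)).1).
move=> /(cvg_unique (@ereal_hausdorff R)) /(_ (cvg_cst _)) h0.
rewrite -(setIidr bOm) integral_mkcondr -[RHS]h0; apply: eq_integral => x _.
by rewrite /patch indicE; case: ifP => _; rewrite ?mulr1 ?mulr0.
Qed.

Let h_measurable a b A : cbox a b `<=` Om -> measurable A ->
  (\int[leb]_(x in obox a b `&` A) (h x)%:E = 0)%E.
Proof.
move=> abOm; rewrite measurable_oboxes => mA.
have mb := measurable_obox a b.
have hb : leb.-integrable (obox a b) (EFin \o h).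
  have := h_local a b; rewrite setIidr//.
  by apply: subset_trans abOm; exact: obox_sub_cbox.
have hS B : measurable B -> leb.-integrable (obox a b `&` B) (EFin \o h).
  by move=> mB; apply: integrableS hb => //; exact: measurableI.
move: A mA; apply: (dynkin_induction measurable_oboxes oboxesI).
- by rewrite setIT; exact: h_box.
- move=> _ [[a' b'] _ <-] /=.
  rewrite obox_setI; apply: h_box; apply: subset_trans abOm => x xab i.
  by have := xab i; rewrite !mxE ge_max le_min => /andP[/andP[-> _] /andP[-> _]].
- move=> S mS h0; rewrite -(h_box abOm) -[in RHS](setIT (obox a b)) -(setUv S) setIUr.
  rewrite integral_setU//; [|exact: measurableI| | |].
  + by rewrite h0 add0e.
  + by apply: measurableI => //; exact: measurableC.
  + by rewrite -setIUr setUv setIT; exact: measurable_int hb.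
  + by apply/disj_setPS => x [[_ Sx] [_ nSx]]; exact: nSx.
- move=> F mF tF F0; rewrite setI_bigcupr integral_bigcup.
  + by apply: eseries0 => k _ _; exact: F0.
  + move=> i j _ _ [x [[_ Fi] [_ Fj]]]; apply: tF => //; by exists x.
  + by move=> k; exact: measurableI.
  + by rewrite -setI_bigcupr; apply: hS; exact: bigcupT_measurable.
Qed.

(** If the integral of [h] against every test function vanishes, so does its
    integral over every box inside [Om] (approximate the box by bumps), hence over
    every measurable part of such a box (boxes form a pi-system generating the
    Borel sets), hence [h] is null on each of the countably many rational boxes
    covering [Om]. *)
Lemma fundamental_lemma : ae_eq leb Om h (cst 0).
Proof.
pose P n (x : 'rV[R]_d) := if @unpickle ('rV[rat]_d * 'rV[rat]_d)%type n is Some pq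
  then rational_boxes Om pq -> rational_box pq x -> h x = 0 else True.
have : {ae leb, forall x n, P n x}.
  apply: ae_foralln => n; rewrite /P; case: unpickle => [[p q]|]; last exact: aeW.
  have [pq|pq] := pselect (rational_boxes Om (p, q)); last first.
    by apply: aeW => x /pq.
  have hb : leb.-integrable (rational_box (p, q)) (EFin \o h).
    have := h_local (map_mx ratr p) (map_mx ratr q); rewrite setIidr//.
    by apply: subset_trans pq; exact: obox_sub_cbox.
  have : ae_eq leb (rational_box (p, q)) (EFin \o h) (cst 0%E).
    apply: (integral_ae_eq (measurable_obox _ _)) => //.
    move=> E Eb mE; rewrite -(setIidr Eb) [RHS]integral0_eq//.
    by apply: h_measurable => //; exact: pq.
  by apply: filterS => x hx _ bx; have [] := hx bx.
apply: filterS => x hx Omx.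
have := Omx; rewrite {1}(open_rational_boxes Om_open) => -[pq Ppq bpq].
by have := hx (pickle pq); rewrite /P pickleK; exact.
Qed.

End fundamental_lemma.

(** * Operators that are linear up to null sets *)

Section almost_everywhere_linear.
Context {disp : measure_display} {X : measurableType disp} {R : realType}.
Variables (mu : {measure set X -> \bar R}) (D : set X).

(** Weak gradients and traces are chosen representatives, so that they depend
    linearly on the function only up to null sets. *)
Definition ae_linear_on (V U : lmodType R) (W : set V) (T : V -> X -> U) :=
  forall (k : R) x y, W x -> W y ->
    ae_eq mu D (T (k *: x + y)) (fun z => k *: T x z + T y z).

Lemma bilinear_pullback (V U : lmodType R) (W : set V) (S : set (X -> U))
    (T : V -> X -> U) (b : (X -> U) -> (X -> U) -> R) :
  subspace W -> subspace S -> (forall x, W x -> S (T x)) -> ae_linear_on W T ->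
  bilinear_on S b ->
  (forall f f' g g', S f -> S f' -> S g -> S g' ->
     ae_eq mu D f f' -> ae_eq mu D g g' -> b f g = b f' g') ->
  bilinear_on W (fun x y => b (T x) (T y)).
Proof.
move=> sW sS ST lT bb bae z Wz.
have Wl k x y : W x -> W y -> W (k *: x + y) by exact: sW.2.
have Sl k x y : W x -> W y -> S (k *: T x + T y).
  by move=> Wx Wy; apply: sS.2; exact: ST.
have refl f : ae_eq mu D f f by apply: aeW.
split=> k x y Wx Wy.
  have -> : b (T z) (T (k *: x + y)) = b (T z) (k *: T x + T y).
    by apply: bae; [exact: ST|exact: ST|apply: ST; exact: Wl|exact: Sl|exact: refl|exact: lT].
  exact: (bb _ (ST _ Wz)).1 k _ _ (ST _ Wx) (ST _ Wy).
have -> : b (T (k *: x + y)) (T z) = b (k *: T x + T y) (T z).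
  by apply: bae; [apply: ST; exact: Wl|exact: Sl|exact: ST|exact: ST|exact: lT|exact: refl].
exact: (bb _ (ST _ Wz)).2 k _ _ (ST _ Wx) (ST _ Wy).
Qed.

Lemma linear_pullback (V U : lmodType R) (W : set V) (S : set (X -> U))
    (T : V -> X -> U) (l : (X -> U) -> R) :
  subspace W -> subspace S -> (forall x, W x -> S (T x)) -> ae_linear_on W T ->
  linear_on S l ->
  (forall f f', S f -> S f' -> ae_eq mu D f f' -> l f = l f') ->
  linear_on W (fun x => l (T x)).
Proof.
move=> sW sS ST lT ll lae k x y Wx Wy.
have -> : l (T (k *: x + y)) = l (k *: T x + T y).
  by apply: lae; [apply: ST; exact: sW.2|apply: sS.2; exact: ST|exact: lT].
exact: ll k _ _ (ST _ Wx) (ST _ Wy).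
Qed.

Lemma linear_on_add (V : lmodType R) (W : set V) (l l' : V -> R) :
  linear_on W l -> linear_on W l' -> linear_on W (fun x => l x + l' x).
Proof. by move=> ll ll' k x y Wx Wy; rewrite (ll k x y)// (ll' k x y)//; ring. Qed.

Lemma bilinear_onD (V : lmodType R) (W : set V) (a b : V -> V -> R) :
  bilinear_on W a -> bilinear_on W b -> bilinear_on W (fun x y => a x y + b x y).
Proof.
by move=> ba bb z Wz; split=> k x y Wx Wy; rewrite ?((ba z Wz).1 k x y)//
  ?((bb z Wz).1 k x y)// ?((ba z Wz).2 k x y)// ?((bb z Wz).2 k x y)//; ring.
Qed.

Lemma bilinear_onZ (V : lmodType R) (W : set V) (a : V -> V -> R) c :
  bilinear_on W a -> bilinear_on W (fun x y => c * a x y).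
Proof.
by move=> ba z Wz; split=> k x y Wx Wy; rewrite ?((ba z Wz).1 k x y)//
  ?((ba z Wz).2 k x y)//; ring.
Qed.

(** From [(k f + g)^2 <= 2 k^2 f^2 + 2 g^2]. *)
Lemma cvg_integral_sqr_linear (k : R) (f g : nat -> X -> R) : measurable D ->
  (forall n, measurable_fun D (f n)) -> (forall n, measurable_fun D (g n)) ->
  ((\int[mu]_(x in D) ((f n x) ^+ 2)%:E) @[n --> \oo] --> 0)%E ->
  ((\int[mu]_(x in D) ((g n x) ^+ 2)%:E) @[n --> \oo] --> 0)%E ->
  ((\int[mu]_(x in D) ((k * f n x + g n x) ^+ 2)%:E) @[n --> \oo] --> 0)%E.
Proof.
move=> mD mf mg f0 g0.
have mf2 n : measurable_fun D (fun x => ((f n x) ^+ 2)%:E).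
  by apply/measurable_EFinP; exact: measurable_funX.
have mg2 n : measurable_fun D (fun x => ((g n x) ^+ 2)%:E).
  by apply/measurable_EFinP; exact: measurable_funX.
have bound : ((2 * k ^+ 2)%:E * \int[mu]_(x in D) ((f n x) ^+ 2)%:E
    + 2%:E * \int[mu]_(x in D) ((g n x) ^+ 2)%:E @[n --> \oo] --> 0)%E.
  rewrite -[X in _ --> X]adde0; apply: cvgeD => //.
    by rewrite -[X in _ --> X](mule0 (2 * k ^+ 2)%:E); apply: cvgeZl.
  by rewrite -[X in _ --> X](mule0 2%:E); apply: cvgeZl.
apply: (squeeze_cvge _ (cvg_cst 0%E) bound).
apply: nearW => n; rewrite integral_ge0/=; last by move=> x _; rewrite lee_fin sqr_ge0.
have k0 : (0 <= (2 * k ^+ 2)%:E)%E by rewrite lee_fin mulr_ge0// sqr_ge0.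
rewrite -!ge0_integralZl//; try by move=> x _; rewrite lee_fin sqr_ge0.
rewrite -ge0_integralD//; first last.
- by apply: measurable_funeM.
- by move=> x _; rewrite -EFinM lee_fin mulr_ge0// sqr_ge0.
- by apply: measurable_funeM.
- by move=> x _; rewrite -EFinM lee_fin mulr_ge0 ?sqr_ge0// mulr_ge0// sqr_ge0.
apply: ge0_le_integral => //.
- by move=> x _; rewrite lee_fin sqr_ge0.
- by apply/measurable_EFinP; apply: measurable_funX; exact: measurable_fun_affine.
- by apply: emeasurable_funD; apply: measurable_funeM.
- move=> x _; rewrite -!EFinM -EFinD lee_fin.
  have := sqr_ge0 (k * f n x - g n x); nra.
Qed.

End almost_everywhere_linear.

(** * Weak gradients *)

Section weak_gradient.
Context {R : realType} {d : nat}.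
Variable Om : set 'rV[R]_d.
Hypothesis Om_open : open Om.
Local Notation leb := (lebesgue_rV d).
Implicit Types (v w : 'rV[R]_d -> R) (g : 'rV[R]_d -> 'rV[R]_d).

Let mOm : measurable Om. Proof. exact: open_measurable_rV. Qed.

Lemma ae_eq_rV g g' : (forall i, ae_eq leb Om (cpnt g i) (cpnt g' i)) ->
  ae_eq leb Om g g'.
Proof.
move=> gg.
have H : {ae leb, forall x, forall i, Om x -> cpnt g i x = cpnt g' i x}.
  by apply: filter_forall => i; exact: gg.
by apply: filterS H => x h Ox; apply/rowP => i; exact: h.
Qed.

Lemma is_wgrad_linear k v w g h : L2 leb Om v -> L2 leb Om w ->
  is_wgrad Om v g -> is_wgrad Om w h -> is_wgrad Om (k *: v + w) (k *: g + h).
Proof.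
move=> v2 w2 [g2 gP] [h2 hP].
have [bl _ _] := ip_semi_inner leb mOm.
split; first exact: (L2V_subspace leb d mOm).2.
move=> i phi tphi; have [phi2 dphi2] := test_function_L2 Om_open tphi.
have -> : cpnt (k *: g + h) i = k *: cpnt g i + cpnt h i.
  by apply/funext => x; rewrite /cpnt !mxE.
rewrite (bl _ (dphi2 i)).2// (bl _ phi2).2; [|exact: g2|exact: h2].
rewrite gP// hP//; ring.
Qed.

(** The difference of two weak gradients is orthogonal to all test functions. *)
Lemma wgrad_unique v g h : is_wgrad Om v g -> is_wgrad Om v h -> ae_eq leb Om g h.
Proof.
move=> [g2 gP] [h2 hP]; apply: ae_eq_rV => i.
have [bl _ _] := ip_semi_inner leb mOm.
have L := L2_subspace leb mOm.
have : ae_eq leb Om (-1 *: cpnt h i + cpnt g i) (cst 0).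
  apply: fundamental_lemma => //; first exact: L.2 (h2 i) (g2 i).
  move=> phi tphi; have [phi2 _] := test_function_L2 Om_open tphi.
  rewrite (bl _ phi2).2; [|exact: h2|exact: g2].
  have := gP i _ tphi; rewrite hP// => /oppr_inj ->; ring.
apply: filterS => x hx Ox; have := hx Ox.
by rewrite -[LHS]/(-1 * cpnt h i x + cpnt g i x) mulN1r addrC => /eqP; rewrite subr_eq0 => /eqP.
Qed.

Lemma wgradP v : H1 Om v -> is_wgrad Om v (wgrad Om v).
Proof. by move=> [_ [g gP]]; exact: (xgetPex _ (ex_intro _ g gP)). Qed.

Lemma wgrad_L2 v : H1 Om v -> L2V leb Om (wgrad Om v).
Proof. by case/wgradP. Qed.

Lemma H1_subspace : subspace (H1 Om : set ('rV[R]_d -> R)).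
Proof.
split.
  split; first exact: (L2_subspace leb mOm).1.
  exists 0; split; first exact: (L2V_subspace leb d mOm).1.
  move=> i phi _; rewrite /ip/Rintegral !integral0_eq ?oppr0// => x _.
    by rewrite /cpnt mxE mul0r.
  by rewrite mul0r.
move=> k v w Hv Hw; split; first by apply: (L2_subspace leb mOm).2; [case: Hv|case: Hw].
exists (k *: wgrad Om v + wgrad Om w); apply: is_wgrad_linear;
  by [case: Hv|case: Hw|exact: wgradP].
Qed.

Lemma wgrad_ae_linear : ae_linear_on leb Om (H1 Om : set ('rV[R]_d -> R)) (wgrad Om).
Proof.
move=> k v w Hv Hw; apply: (@wgrad_unique (k *: v + w)).
  exact: wgradP (H1_subspace.2 k v w Hv Hw).
by apply: is_wgrad_linear; [case: Hv|case: Hw|exact: wgradP|exact: wgradP].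
Qed.

Definition H1ip v w : R := ip leb Om v w + ipV leb Om (wgrad Om v) (wgrad Om w).

Lemma H1ip_semi_inner : semi_inner (H1 Om : set ('rV[R]_d -> R)) H1ip.
Proof.
have [bl sl pl] := ip_semi_inner leb mOm.
have [bV sV pV] := ipV_semi_inner leb d mOm.
split=> [|v w Hv Hw|v Hv].
- apply: bilinear_onD.
    by move=> z [z2 _]; split=> k v w [v2 _] [w2 _]; [exact: (bl z z2).1|exact: (bl z z2).2].
  apply: (@bilinear_pullback _ _ _ leb Om _ _ _ (L2V leb Om)).
  + exact: H1_subspace.
  + exact: L2V_subspace.
  + exact: wgrad_L2.
  + exact: wgrad_ae_linear.
  + exact: bV.
  + exact: ipV_eq_ae.
- have [v2 _] := Hv; have [w2 _] := Hw.
  rewrite /H1ip.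
  rewrite (sl v w v2 w2).
  by rewrite (sV _ _ (wgrad_L2 Hv) (wgrad_L2 Hw)).
- have [v2 _] := Hv.
  by apply: addr_ge0; [exact: pl|apply: pV; exact: wgrad_L2].
Qed.

(** Integrals over [Om] only see the values on [Om], so functions that agree
    there have the same weak gradients, and the same representative is chosen. *)
Lemma is_wgrad_local v w : (forall x, Om x -> v x = w x) ->
  is_wgrad Om v = is_wgrad Om w.
Proof.
move=> vw; apply/funext => g; apply/propext.
have E f : ip leb Om v f = ip leb Om w f.
  by apply: eq_Rintegral => x /set_mem Ox; rewrite vw.
by rewrite /is_wgrad; split=> -[g2 gP]; split=> // i phi tp; rewrite -gP// E.
Qed.

Lemma wgrad_local v w : (forall x, Om x -> v x = w x) -> wgrad Om v = wgrad Om w.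
Proof. by move=> vw; rewrite /wgrad (is_wgrad_local vw). Qed.

Lemma H1_local v w : (forall x, Om x -> v x = w x) -> H1 Om v -> H1 Om w.
Proof.
move=> vw [[mv v2] gP]; split; last by rewrite -(is_wgrad_local vw).
split; first by apply: eq_measurable_fun mv => x /set_mem /vw.
by rewrite (eq_integral (fun x => (v x ^+ 2)%:E))// => x /set_mem /vw ->.
Qed.

End weak_gradient.

(** * Boundary traces *)

Section trace.
Context {R : realType} {d : nat}.
Variables (Om : set 'rV[R]_d) (sg : {measure set 'rV[R]_d -> \bar R}).
Hypotheses (Om_open : open Om) (mGam : measurable (boundary Om)).
Local Notation leb := (lebesgue_rV d).
Local Notation Gam := (boundary Om).
Implicit Types (v w phi : 'rV[R]_d -> R).

Let mOm : measurable Om. Proof. exact: open_measurable_rV. Qed.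

Lemma is_C1_linear k phi phi' : is_C1 phi -> is_C1 phi' -> is_C1 (k *: phi + phi') /\
  forall i, pderiv (k *: phi + phi') i = k *: pderiv phi i + pderiv phi' i.
Proof.
move=> C C'.
have D i x : is_derive x (delta_mx ord0 i) (k *: phi + phi')
   (k *: pderiv phi i x + pderiv phi' i x).
  have [d1 _] := C i; have [d2 _] := C' i.
  apply: is_deriveD; last by split.
  by apply: is_deriveZ; split.
have E i : pderiv (k *: phi + phi') i = k *: pderiv phi i + pderiv phi' i.
  by apply/funext => x; case: (D i x).
split=> // i; split=> [x|]; first by case: (D i x).
rewrite E; apply: continuous_add; last exact: (C' i).2.
apply: continuous_mul; last exact: (C i).2.
by move=> x; exact: cst_continuous.
Qed.

Lemma is_trace_H1 v w : is_trace Om sg v w -> H1 Om v /\ L2 sg Gam w.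
Proof. by case. Qed.

Lemma is_trace_linear k v v' w w' : is_trace Om sg v w -> is_trace Om sg v' w' ->
  is_trace Om sg (k *: v + v') (k *: w + w').
Proof.
move=> [Hv w2 [phi [C1 cv cg ct]]] [Hv' w2' [phi' [C1' cv' cg' ct']]].
have mphi (f : nat -> 'rV[R]_d -> R) D n : (forall n, is_C1 (f n)) -> measurable_fun D (f n).
  by move=> Cf; apply: measurable_funTS; apply: continuous_measurable_rV; exact: is_C1_continuous.
have mdphi (f : nat -> 'rV[R]_d -> R) D n i : (forall n, is_C1 (f n)) ->
    measurable_fun D (pderiv (f n) i).
  by move=> Cf; apply: measurable_funTS; apply: continuous_measurable_rV; exact: (Cf n i).2.
have mH u : H1 Om u -> measurable_fun Om u by case=> -[].
have mg u i : H1 Om u -> measurable_fun Om (cpnt (wgrad Om u) i).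
  by move=> Hu; case: (wgrad_L2 Hu i).
split; first exact: (H1_subspace Om_open).2.
  exact: (L2_subspace sg mGam).2.
exists (fun n => k *: phi n + phi' n); split.
- by move=> n; exact: (is_C1_linear k (C1 n) (C1' n)).1.
- have H := @cvg_integral_sqr_linear _ _ _ leb Om k (fun n x => v x - phi n x)
    (fun n x => v' x - phi' n x) mOm
    (fun n => measurable_funB (mH _ Hv) (mphi _ _ n C1))
    (fun n => measurable_funB (mH _ Hv') (mphi _ _ n C1')) cv cv'.
  apply: cvg_trans H; apply: near_eq_cvg; apply: nearW => n.
  apply: eq_integral => x _; congr (_ %:E).
  by rewrite -[(k *: v + v') x]/(k * v x + v' x)
    -[(k *: phi n + phi' n) x]/(k * phi n x + phi' n x); ring.
- move=> i.
  have H := @cvg_integral_sqr_linear _ _ _ leb Om k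
    (fun n x => cpnt (wgrad Om v) i x - pderiv (phi n) i x)
    (fun n x => cpnt (wgrad Om v') i x - pderiv (phi' n) i x) mOm
    (fun n => measurable_funB (mg _ i Hv) (mdphi _ _ n i C1))
    (fun n => measurable_funB (mg _ i Hv') (mdphi _ _ n i C1')) (cg i) (cg' i).
  apply: cvg_trans H; apply: near_eq_cvg; apply: nearW => n.
  apply: ae_eq_integral => //.
  + apply/measurable_EFinP; apply: measurable_funX; apply: measurable_fun_affine => //.
      exact: measurable_funB (mg _ i Hv) (mdphi _ _ n i C1).
    exact: measurable_funB (mg _ i Hv') (mdphi _ _ n i C1').
  + apply/measurable_EFinP; apply: measurable_funX; apply: measurable_funB.
      by apply: mg; exact: (H1_subspace Om_open).2.
    rewrite (is_C1_linear k (C1 n) (C1' n)).2.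
    exact: measurable_fun_affine (mdphi _ _ n i C1) (mdphi _ _ n i C1').
  + apply: filterS (wgrad_ae_linear Om_open k Hv Hv') => x hx Ox.
    rewrite (is_C1_linear k (C1 n) (C1' n)).2 /cpnt hx//; congr (_ %:E).
    rewrite !mxE -[(k *: _ + _ : 'rV[R]_d -> R) x]/(k * pderiv (phi n) i x + pderiv (phi' n) i x).
    ring.
- have [mw _] := w2; have [mw' _] := w2'.
  have H := @cvg_integral_sqr_linear _ _ _ sg Gam k (fun n x => w x - phi n x)
    (fun n x => w' x - phi' n x) mGam
    (fun n => measurable_funB mw (mphi _ _ n C1))
    (fun n => measurable_funB mw' (mphi _ _ n C1')) ct ct'.
  apply: cvg_trans H; apply: near_eq_cvg; apply: nearW => n.
  apply: eq_integral => x _; congr (_ %:E).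
  by rewrite -[(k *: w + w') x]/(k * w x + w' x)
    -[(k *: phi n + phi' n) x]/(k * phi n x + phi' n x); ring.
Qed.

Lemma is_trace0 : is_trace Om sg 0 0.
Proof.
have H0 := (H1_subspace Om_open).1.
have L0 := (L2_subspace sg mGam).1.
have C0 : is_C1 (0 : 'rV[R]_d -> R) /\ forall i, pderiv (0 : 'rV[R]_d -> R) i = 0.
  have D i x : is_derive x (delta_mx ord0 i) (cst 0 : 'rV[R]_d -> R) 0 by exact: is_derive_cst.
  have E i : pderiv (cst 0) i = cst 0 :> ('rV[R]_d -> R).
    by apply/funext => x; case: (D i x).
  split=> // i; split=> [x|]; first by case: (D i x).
  by rewrite E => x; exact: cst_continuous.
split=> //; exists (fun=> 0); split.
- by move=> _; exact: C0.1.
- apply: cvg_near_cst; apply: nearW => n.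
  by rewrite integral0_eq// => x _; rewrite subrr expr0n.
- move=> i; apply: cvg_near_cst; apply: nearW => n.
  rewrite C0.2; apply: ae_integral_sqr0 => //.
    apply: measurable_funB; first by case: (wgrad_L2 H0 i).
    exact: measurable_cst.
  have := wgrad_ae_linear Om_open (-1) H0 H0.
  rewrite scaler0 addr0; apply: filterS => x h Ox.
  rewrite /cpnt h// !mxE /= -[(0 : _ -> _) x]/0; ring.
- apply: cvg_near_cst; apply: nearW => n.
  by rewrite integral0_eq// => x _; rewrite subrr expr0n.
Qed.

Definition has_trace : set ('rV[R]_d -> R) := [set v | exists w, is_trace Om sg v w].

Lemma has_trace_subspace : subspace has_trace.
Proof.
split; first by exists 0; exact: is_trace0.
by move=> k v v' [w tw] [w' tw']; exists (k *: w + w'); exact: is_trace_linear.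
Qed.

Lemma bdtraceP v : has_trace v -> is_trace Om sg v (bdtrace Om sg v).
Proof. by move=> [w tw]; exact: (xgetPex _ (ex_intro _ w tw)). Qed.

Lemma has_trace_H1 : has_trace `<=` H1 Om.
Proof. by move=> v [w []]. Qed.

Lemma bdtrace_L2 v : has_trace v -> L2 sg Gam (bdtrace Om sg v).
Proof. by move=> /bdtraceP[]. Qed.

Section trace_inequality.
Variable C : R.
Hypothesis trC : trace_inequality Om sg C.

(** The trace inequality, applied to the zero function, whose traces
    include the difference of two traces of [v]. *)
Lemma is_trace_unique v w w' : is_trace Om sg v w -> is_trace Om sg v w' ->
  ae_eq sg Gam w w'.
Proof.
move=> tw tw'; have := is_trace_linear (-1) tw tw'.
rewrite scaleN1r addNr => /[dup] t0 /trC.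
have -> : H1norm Om 0 = 0.
  have [bl _ _] := H1ip_semi_inner Om_open.
  have H0 := (H1_subspace Om_open).1.
  rewrite -[H1norm Om 0]/(seminorm (H1ip Om) 0) /seminorm.
  by rewrite (linear_on0 (H1_subspace Om_open) (bl _ H0).1) sqrtr0.
rewrite mulr0 => le0; have [_ d2] := is_trace_H1 t0.
have := ip0_ae mGam d2 _.
move=> /(_ _)/wrap[|].
  apply/eqP; rewrite eq_le; apply/andP; split.
    by rewrite leNgt -sqrtr_gt0 -leNgt.
  by have [_ _ p] := ip_semi_inner sg mGam; exact: p.
apply: filterS => x h Gx; have := h Gx.
rewrite -[_ x]/(-1 * w x + w' x) mulN1r addrC => /eqP; rewrite subr_eq0.
by move=> /eqP.
Qed.

Lemma bdtrace_ae_linear : ae_linear_on sg Gam has_trace (bdtrace Om sg).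
Proof.
move=> k v v' tv tv'; apply: (@is_trace_unique (k *: v + v')).
  by apply: bdtraceP; exact: has_trace_subspace.2.
by apply: is_trace_linear; exact: bdtraceP.
Qed.

Lemma bdtrace_le v : has_trace v ->
  seminorm (ip sg Gam) (bdtrace Om sg v) <= C * seminorm (H1ip Om) v.
Proof. by move=> tv; exact: trC (bdtraceP tv). Qed.

End trace_inequality.

Lemma H1_zero_subspace E : subspace (H1_zero Om sg E : set ('rV[R]_d -> R)).
Proof.
split; first by exists 0; [exact: is_trace0|apply: aeW].
move=> k v v' [w tw w0] [w' tw' w0']; exists (k *: w + w').
  exact: is_trace_linear.
apply: filterS2 w0 w0' => x h h' Ex.
by rewrite -[LHS]/(k * w x + w' x) h// h'// mulr0 addr0.
Qed.

Lemma H1_zero_has_trace E : H1_zero Om sg E `<=` has_trace.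
Proof. by move=> v [w tw _]; exists w. Qed.

Lemma is_trace_local v v' w : (forall x, Om x -> v x = v' x) ->
  is_trace Om sg v w -> is_trace Om sg v' w.
Proof.
move=> vv [Hv w2 [phi [C1 cv cg ct]]]; split; [exact: H1_local vv Hv|exact: w2|].
exists phi; split; [exact: C1| |by rewrite -(wgrad_local vv); exact: cg|exact: ct].
apply: cvg_trans cv; apply: near_eq_cvg; apply: nearW => n.
by apply: eq_integral => x /set_mem /vv ->.
Qed.

Lemma bdtrace_local v v' : (forall x, Om x -> v x = v' x) ->
  bdtrace Om sg v = bdtrace Om sg v'.
Proof.
move=> vv.
have E : [set w | is_trace Om sg v w] = [set w | is_trace Om sg v' w].
  apply/seteqP; split=> w /=; first exact: is_trace_local.
  by apply: is_trace_local => x Ox; rewrite vv.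
exact: (f_equal (xget (fun=> 0)) E).
Qed.

End trace.

(** * Vector fields, elastic and load forms *)

Section pointwise_norms.
Context {disp : measure_display} {X : measurableType disp} {R : realType}.
Variables (mu : {measure set X -> \bar R}) (D : set X).
Hypothesis mD : measurable D.

Lemma measurable_sqrt_comp (f : X -> R) : measurable_fun D f ->
  measurable_fun D (fun x => Num.sqrt (f x)).
Proof.
move=> mf; apply: (@measurableT_comp _ _ _ _ _ _ (@Num.sqrt R)) => //.
by apply: continuous_measurable_fun; exact: sqrt_continuous.
Qed.

Lemma measurable_dotp n (u v : X -> 'rV[R]_n) :
  (forall i, measurable_fun D (fun x => u x ord0 i)) ->
  (forall i, measurable_fun D (fun x => v x ord0 i)) ->
  measurable_fun D (fun x => dotp (u x) (v x)).
Proof.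
by move=> mu' mv; apply: measurable_sum => i; apply: measurable_funM.
Qed.

Lemma measurable_enorm n (u : X -> 'rV[R]_n) :
  (forall i, measurable_fun D (fun x => u x ord0 i)) ->
  measurable_fun D (fun x => enorm (u x)).
Proof. by move=> mu'; apply: measurable_sqrt_comp; exact: measurable_dotp. Qed.

Lemma enorm_L2 n (u : X -> 'rV[R]_n) : L2V mu D u -> L2 mu D (fun x => enorm (u x)).
Proof.
move=> u2; apply: integrable_sqr_L2 => //.
  by apply: measurable_enorm => i; case: (u2 i).
under eq_fun do rewrite enorm_sqr.
exact: (L2V_dotp_integrable mD u2 u2).1.
Qed.

Lemma ip_enorm n (u : X -> 'rV[R]_n) :
  ip mu D (fun x => enorm (u x)) (fun x => enorm (u x)) = ipV mu D u u.
Proof. by apply: eq_Rintegral => x _; rewrite -expr2 enorm_sqr. Qed.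

Lemma L2S E f : measurable E -> E `<=` D -> L2 mu D f -> L2 mu E f.
Proof.
move=> mE ED [mf fy]; split; first exact: measurable_funS mf.
apply: le_lt_trans fy; apply: ge0_subset_integral => //.
  by apply/measurable_EFinP; exact: measurable_funX.
by move=> x _; rewrite lee_fin sqr_ge0.
Qed.

Lemma ip_sqr_fin f : L2 mu D f -> ((ip mu D f f)%:E = \int[mu]_(x in D) (f x ^+ 2)%:E)%E.
Proof.
move=> f2; rewrite /ip/Rintegral fineK; first exact: eq_integral.
exact: integrable_fin_num (L2_integrableM mD f2 f2).
Qed.

Lemma seminorm_le_ae E f g : measurable E -> E `<=` D -> L2 mu E f -> L2 mu D g ->
  {ae mu, forall x, E x -> `|f x| <= `|g x|} ->
  seminorm (ip mu E) f <= seminorm (ip mu D) g.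
Proof.
move=> mE ED f2 g2 fg; apply: ler_wsqrtr; rewrite -lee_fin ip_sqr_fin//.
have [mg _] := g2; have [mf _] := f2.
rewrite (_ : (ip mu E f f)%:E = \int[mu]_(x in E) (f x ^+ 2)%:E)%E; last first.
  rewrite /ip/Rintegral fineK; first exact: eq_integral.
  exact: integrable_fin_num (L2_integrableM mE f2 f2).
apply: (@le_trans _ _ (\int[mu]_(x in E) (g x ^+ 2)%:E)%E).
  apply: ae_ge0_le_integral => //.
  - by move=> x _; rewrite lee_fin sqr_ge0.
  - by apply/measurable_EFinP; exact: measurable_funX.
  - by move=> x _; rewrite lee_fin sqr_ge0.
  - by apply/measurable_EFinP; apply: measurable_funX; exact: measurable_funS mg.
  - apply: filterS fg => x h Dx; rewrite lee_fin -(real_normK (num_real (f x))).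
    by rewrite -(real_normK (num_real (g x))) lerXn2r ?nnegrE// h.
apply: ge0_subset_integral => //.
  by apply/measurable_EFinP; exact: measurable_funX.
by move=> x _; rewrite lee_fin sqr_ge0.
Qed.

(** Replace [g - f] by its positive part, which differs from it on a null set. *)
Lemma ip_le_ae b f g : L2 mu D b -> L2 mu D f -> L2 mu D g ->
  (forall x, D x -> 0 <= b x) -> {ae mu, forall x, D x -> f x <= g x} ->
  ip mu D b f <= ip mu D b g.
Proof.
move=> b2 f2 g2 b0 fg; have [bl _ _] := ip_semi_inner mu mD.
have L := L2_subspace mu mD.
have d2 : L2 mu D (g - f) by exact: subspaceB.
rewrite -subr_ge0 -(linear_onB (bl _ b2).1)//.
pose h x := Num.max 0 ((g - f) x).
have mh : measurable_fun D h.
  by apply: measurable_maxr; [exact: measurable_cst|case: d2].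
have gfh : ae_eq mu D (g - f) h.
  apply: filterS fg => x h1 Dx; rewrite /h max_r//.
  by rewrite -[_ x]/(g x - f x) subr_ge0 h1.
have h2 : L2 mu D h by exact: L2_eq_ae gfh.
rewrite (ip_eq_ae mD b2 b2 d2 h2 _ gfh); last exact: aeW.
by apply: Rintegral_ge0 => x Dx; rewrite mulr_ge0 ?b0// le_max lexx.
Qed.

End pointwise_norms.

Section vector_valued_functions.
Context {R : realType} {d : nat}.
Variables (Om : set 'rV[R]_d) (sg : {measure set 'rV[R]_d -> \bar R}).
Hypotheses (Om_open : open Om) (mGam : measurable (boundary Om)).
Local Notation leb := (lebesgue_rV d).
Local Notation Gam := (boundary Om).
Local Notation VF := ('rV[R]_d -> 'rV[R]_d).
Implicit Types (u v w : VF).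

Let mOm : measurable Om. Proof. exact: open_measurable_rV. Qed.

Definition has_traceV : set VF := [set u | forall i, has_trace Om sg (cpnt u i)].

Lemma cpnt_linear k u v i : cpnt (k *: u + v) i = k *: cpnt u i + cpnt v i.
Proof. by apply/funext => x; rewrite /cpnt !mxE. Qed.

Lemma has_traceV_subspace : subspace has_traceV.
Proof.
have [T0 Tl] := has_trace_subspace sg Om_open mGam.
split=> [i|k u v tu tv i]; last first.
  by rewrite cpnt_linear; exact: Tl k _ _ (tu i) (tv i).
have -> : cpnt (0 : VF) i = 0 by apply/funext => x; rewrite /cpnt mxE.
exact: T0.
Qed.

Lemma H1_zeroV_subspace E : subspace (H1_zeroV Om sg E : set VF).
Proof.
have [T0 Tl] := H1_zero_subspace sg Om_open mGam E.
split=> [i|k u v tu tv i]; last first.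
  by rewrite cpnt_linear; exact: Tl k _ _ (tu i) (tv i).
have -> : cpnt (0 : VF) i = 0 by apply/funext => x; rewrite /cpnt mxE.
exact: T0.
Qed.

Lemma H1_zeroV_has_trace E : H1_zeroV Om sg E `<=` has_traceV.
Proof. by move=> u tu i; exact: H1_zero_has_trace (tu i). Qed.

Lemma cpnt_pullback (b : ('rV[R]_d -> R) -> ('rV[R]_d -> R) -> R) i :
  bilinear_on (H1 Om : set ('rV[R]_d -> R)) b ->
  bilinear_on has_traceV (fun u v => b (cpnt u i) (cpnt v i)).
Proof.
move=> bl z tz.
have H u : has_traceV u -> H1 Om (cpnt u i) by move=> tu; exact: has_trace_H1 (tu i).
by split=> k u v tu tv; rewrite cpnt_linear;
  [exact: (bl _ (H _ tz)).1 k _ _ (H _ tu) (H _ tv)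
  |exact: (bl _ (H _ tz)).2 k _ _ (H _ tu) (H _ tv)].
Qed.

Definition H1ipV u v : R := \sum_i H1ip Om (cpnt u i) (cpnt v i).

Lemma H1ipV_semi_inner : semi_inner has_traceV H1ipV.
Proof.
have [bl sl pl] := H1ip_semi_inner Om_open.
have H u i : has_traceV u -> H1 Om (cpnt u i) by move=> tu; exact: has_trace_H1 (tu i).
split=> [|u v tu tv|u tu].
- by apply: sum_bilinear_on => i; exact: cpnt_pullback.
- by apply: eq_bigr => i _; apply: sl; exact: H.
- by apply: sumr_ge0 => i _; apply: pl; exact: H.
Qed.

Lemma H1normVE u : has_traceV u -> H1normV Om u = seminorm H1ipV u.
Proof.
move=> tu; congr Num.sqrt; apply: eq_bigr => i _.
exact: (seminorm_sqr (H1ip_semi_inner Om_open) (has_trace_H1 (tu i))).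
Qed.

Lemma wgrad_cpnt_ae_linear i :
  ae_linear_on leb Om has_traceV (fun u => wgrad Om (cpnt u i)).
Proof.
move=> k u v tu tv; rewrite cpnt_linear.
exact: wgrad_ae_linear Om_open k _ _ (has_trace_H1 (tu i)) (has_trace_H1 (tv i)).
Qed.

Lemma jacobian_ae_linear : ae_linear_on leb Om has_traceV (Defs.jacobian Om).
Proof.
move=> k u v tu tv.
have H : {ae leb, forall x, forall i, Om x -> wgrad Om (cpnt (k *: u + v) i) x =
    k *: wgrad Om (cpnt u i) x + wgrad Om (cpnt v i) x}.
  by apply: filter_forall => i; exact: wgrad_cpnt_ae_linear.
apply: filterS H => x h Ox; apply/matrixP => i j.
by rewrite !mxE h// !mxE.
Qed.

Lemma jacobian_L2 u : has_traceV u -> L2M leb Om (Defs.jacobian Om u).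
Proof.
move=> tu i j; under eq_fun do rewrite mxE.
exact: wgrad_L2 (has_trace_H1 (tu i)) j.
Qed.

Lemma sym_grad_L2 u : has_traceV u -> L2M leb Om (sym_grad Om u).
Proof.
move=> tu i j; have Ll := (L2_subspace leb mOm).2.
have -> : (fun x => sym_grad Om u x i j) =
   2^-1 *: ((fun x => Defs.jacobian Om u x i j) : 'rV[R]_d -> R) +
   (2^-1 *: ((fun x => Defs.jacobian Om u x j i) : 'rV[R]_d -> R) + 0).
  apply/funext => x; rewrite !mxE addrC.
  rewrite -[RHS]/(2^-1 * Defs.jacobian Om u x i j + (2^-1 * Defs.jacobian Om u x j i + 0)) !mxE.
  ring.
apply: (Ll); first exact: jacobian_L2.
by apply: Ll; [exact: jacobian_L2|exact: (L2_subspace leb mOm).1].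
Qed.

Lemma sym_grad_ae_linear : ae_linear_on leb Om has_traceV (sym_grad Om).
Proof.
move=> k u v tu tv; apply: filterS (jacobian_ae_linear k tu tv) => x h Ox.
rewrite /sym_grad h// linearP/= scalerDr !scalerDr; apply/matrixP => i j; rewrite !mxE; ring.
Qed.

Lemma divg_L2 u : has_traceV u -> L2 leb Om (divg Om u).
Proof.
move=> tu; have L := L2_subspace leb mOm.
have -> : divg Om u = \sum_i ((fun x => Defs.jacobian Om u x i i) : 'rV[R]_d -> R).
  apply/funext => x; rewrite /divg /mxtrace fct_sumE//.
by apply: subspace_sum => // i; exact: jacobian_L2.
Qed.

Lemma divg_ae_linear : ae_linear_on leb Om has_traceV (divg Om).
Proof.
move=> k u v tu tv; apply: filterS (jacobian_ae_linear k tu tv) => x h Ox.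
by rewrite /divg h// linearP.
Qed.

Lemma elastic_form_bilinear G lam : bilinear_on has_traceV (elastic_form Om G lam).
Proof.
have sT := has_traceV_subspace.
have b1 : bilinear_on has_traceV (fun u v => ipT leb Om (sym_grad Om u) (sym_grad Om v)).
  apply: (bilinear_pullback (T := sym_grad Om) (b := ipT leb Om) (mu := leb) (D := Om)
    (S := L2M leb Om (n := d)) sT).
  - exact: L2M_subspace.
  - exact: sym_grad_L2.
  - exact: sym_grad_ae_linear.
  - exact: ipT_bilinear.
  - exact: ipT_eq_ae.
have b2 : bilinear_on has_traceV (fun u v => ip leb Om (divg Om u) (divg Om v)).
  apply: (bilinear_pullback (T := divg Om) (b := ip leb Om) (mu := leb) (D := Om)
    (S := L2 leb Om : set ('rV[R]_d -> R)) sT).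
  - exact: L2_subspace.
  - exact: divg_L2.
  - exact: divg_ae_linear.
  - by case: (ip_semi_inner leb mOm).
  - exact: ip_eq_ae.
exact: bilinear_onD (bilinear_onZ (2 * G) b1) (bilinear_onZ lam b2).
Qed.

Lemma viscous_formE gam u v : viscous_form Om gam u v = elastic_form Om (gam / 2) gam u v.
Proof.
rewrite /viscous_form/elastic_form; congr (_ * _ + _).
by rewrite mulrC divfK.
Qed.

Lemma ip_divg_linear q : L2 leb Om q -> linear_on has_traceV (fun u => ip leb Om q (divg Om u)).
Proof.
move=> q2; have [bl _ _] := ip_semi_inner leb mOm.
apply: (linear_pullback (T := divg Om) (l := ip leb Om q) (mu := leb) (D := Om)
  (S := L2 leb Om : set ('rV[R]_d -> R)) has_traceV_subspace).
- exact: L2_subspace.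
- exact: divg_L2.
- exact: divg_ae_linear.
- exact: (bl _ q2).1.
- move=> f f' f2 f2' ff; apply: (ip_eq_ae mOm q2 q2 f2 f2' _ ff); exact: aeW.
Qed.

Lemma bdtraceV_L2 u : has_traceV u -> L2V sg Gam (bdtraceV Om sg u).
Proof.
move=> tu i; under eq_fun do rewrite mxE.
exact: bdtrace_L2.
Qed.

Section trace_inequality.
Variable Ctau : R.
Hypotheses (Ctau0 : 0 <= Ctau) (trC : trace_inequality Om sg Ctau).

Lemma bdtraceV_ae_linear : ae_linear_on sg Gam has_traceV (bdtraceV Om sg).
Proof.
move=> k u v tu tv.
have H : {ae sg, forall x, forall i, Gam x -> bdtrace Om sg (cpnt (k *: u + v) i) x =
    k *: bdtrace Om sg (cpnt u i) x + bdtrace Om sg (cpnt v i) x}.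
  apply: filter_forall => i; rewrite cpnt_linear.
  exact: (bdtrace_ae_linear Om_open mGam trC).
apply: filterS H => x h Gx; apply/rowP => i.
rewrite [LHS]mxE.
rewrite [RHS]mxE.
rewrite [X in _ = X + _]mxE.
rewrite (h i Gx).
by congr (_ * _ + _); rewrite mxE.
Qed.

Lemma bdtraceV_le u : has_traceV u ->
  seminorm (ip sg Gam) (fun x => enorm (bdtraceV Om sg u x)) <= Ctau * seminorm H1ipV u.
Proof.
move=> tu; have b2 := bdtraceV_L2 tu.
have [_ _ pl] := H1ipV_semi_inner.
rewrite -[leRHS]ger0_norm; last by rewrite mulr_ge0// sqrtr_ge0.
rewrite -sqrtr_sqr; apply: ler_wsqrtr.
rewrite exprMn (seminorm_sqr H1ipV_semi_inner tu) ip_enorm.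
rewrite (L2V_dotp_integrable mGam b2 b2).2 mulr_sumr; apply: ler_sum => i _.
have h : seminorm (ip sg Gam) (bdtrace Om sg (cpnt u i)) ^+ 2 <=
    (Ctau * seminorm (H1ip Om) (cpnt u i)) ^+ 2.
  apply: lerXn2r (bdtrace_le trC (tu i)); rewrite nnegrE ?sqrtr_ge0//.
  by rewrite mulr_ge0// sqrtr_ge0.
move: h; rewrite exprMn (seminorm_sqr (ip_semi_inner sg mGam) (bdtrace_L2 (tu i))).
rewrite (seminorm_sqr (H1ip_semi_inner Om_open) (has_trace_H1 (tu i))).
apply: le_trans; rewrite le_eqVlt; apply/orP; left; apply/eqP.
by apply: eq_Rintegral => x _; rewrite !mxE.
Qed.

Lemma load_form_linear Gn (f b : VF) : measurable Gn -> Gn `<=` Gam ->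
  L2V leb Om f -> L2V sg Gn b -> linear_on has_traceV (load_form Om sg Gn f b).
Proof.
move=> mGn GnG f2 b2.
have [blf _ _] := ipV_semi_inner leb d mOm.
have [blb _ _] := ipV_semi_inner sg d mGn.
have v2 u : has_traceV u -> L2V leb Om u.
  by move=> tu i; case: (has_trace_H1 (tu i)).
have l1 : linear_on has_traceV (ipV leb Om f).
  by move=> k u v tu tv; apply: (blf _ f2).1; exact: v2.
have l2 : linear_on has_traceV (fun v => ipV sg Gn b (bdtraceV Om sg v)).
  apply: (linear_pullback (T := bdtraceV Om sg) (l := ipV sg Gn b) (mu := sg) (D := Gn)
    (S := L2V sg Gn (d := d)) has_traceV_subspace).
  - exact: L2V_subspace.
  - by move=> u tu i; apply: (L2S mGam mGn GnG (bdtraceV_L2 tu i)).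
  - by move=> k u v tu tv; apply: ae_eq_subset GnG _; exact: bdtraceV_ae_linear.
  - exact: (blb _ b2).1.
  - by move=> h h' h2 h2' hh; apply: (ipV_eq_ae mGn b2 b2 h2 h2' _ hh); exact: aeW.
exact: linear_on_add l1 l2.
Qed.

End trace_inequality.

End vector_valued_functions.

Local Opaque Rintegral integral bdtrace wgrad is_trace.

(** * The contact form *)

Section orthogonal_decomposition.
Context {R : realType} {d : nat}.
Implicit Types t n : 'rV[R]_d.

Lemma normal_component_le t n : enorm n = 1 -> `|dotp t n| <= enorm t.
Proof. by move=> n1; have := dotp_le t n; rewrite n1 mulr1. Qed.

Lemma tangential_component_le t n : enorm n = 1 ->
  enorm (t - dotp t n *: n) <= enorm t.
Proof.
move=> n1; apply: ler_wsqrtr.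
have n2 : dotp n n = 1 by rewrite -enorm_sqr n1 expr1n.
rewrite !dotpE n2 (dotpC n t); have := sqr_ge0 (dotp t n); nra.
Qed.

Lemma pos_part_sub_le (a b c : R) :
  `|Num.max 0 (a - c) - Num.max 0 (b - c)| <= `|a - b|.
Proof.
have h1 := ler_norm (a - b); have h2 := ler_norm (- (a - b)).
rewrite normrN in h2; rewrite ler_norml.
by have [t0|t0] := leP 0 (a - c); have [u0|u0] := leP 0 (b - c); apply/andP; split; lra.
Qed.

End orthogonal_decomposition.

Section contact_form.
Context {R : realType} {d : nat}.
Variables (Om : set 'rV[R]_d) (sg : {measure set 'rV[R]_d -> \bar R}).
Hypotheses (Om_open : open Om) (mGam : measurable (boundary Om)).
Local Notation Gam := (boundary Om).
Local Notation VF := ('rV[R]_d -> 'rV[R]_d).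
Variables (Ctau : R) (nu : VF) (Gc : set 'rV[R]_d) (cp mufr : R) (g : 'rV[R]_d -> R).
Hypotheses (Ctau0 : 0 <= Ctau) (trC : trace_inequality Om sg Ctau).
Hypotheses (nu_meas : measurable_fun Gam nu)
  (nu_unit : {ae sg, forall x, Gam x -> enorm (nu x) = 1}).
Hypotheses (mGc : measurable Gc) (GcG : Gc `<=` Gam) (g2 : L2 sg Gc g)
  (cp0 : 0 <= cp) (mufr0 : 0 <= mufr).
Implicit Types u v w : VF.

Local Notation HV := (has_traceV Om sg).
Local Notation tr := (bdtraceV Om sg).
Local Notation np := (normal_part Om sg nu).
Local Notation tp := (tangential_part Om sg nu).
Local Notation H1ipV := (H1ipV Om).

Let sHV := has_traceV_subspace sg Om_open mGam.
Let trl := bdtraceV_ae_linear Om_open mGam trC.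

Let nu_coord i : measurable_fun Gam (fun x => nu x ord0 i).
Proof.
by apply: (measurable_comp measurableT _ (measurable_coor i) nu_meas).
Qed.

Lemma normal_part_ae_linear : ae_linear_on sg Gam HV (np : VF -> 'rV[R]_d -> R).
Proof.
move=> k u v tu tv; apply: filterS (trl k tu tv) => x h Gx.
by rewrite /normal_part (h Gx) dotpDl dotpZl.
Qed.

Lemma tangential_part_ae_linear : ae_linear_on sg Gam HV tp.
Proof.
move=> k u v tu tv.
apply: filterS2 (trl k tu tv) (normal_part_ae_linear k tu tv) => x h h' Gx.
rewrite /tangential_part (h Gx) (h' Gx).
move: (tr u x) (tr v x) (np u x) (np v x) (nu x) => a b p q n.
by apply/rowP => i; rewrite !mxE -[k *: p]/(k * p); ring.
Qed.

Let tr_coord u i : HV u -> measurable_fun Gam (fun x => tr u x ord0 i).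
Proof. by move=> tu; case: (bdtraceV_L2 tu i). Qed.

Lemma normal_part_le u :
  {ae sg, forall x, Gam x -> `|np u x| <= `|enorm (tr u x)|}.
Proof.
apply: filterS nu_unit => x h Gx; rewrite [leRHS]ger0_norm ?enorm_ge0//.
by apply: normal_component_le; exact: h.
Qed.

Lemma tangential_part_le u :
  {ae sg, forall x, Gam x -> `|enorm (tp u x)| <= `|enorm (tr u x)|}.
Proof.
apply: filterS nu_unit => x h Gx; rewrite !ger0_norm ?enorm_ge0//.
by apply: tangential_component_le; exact: h.
Qed.

Lemma normal_part_measurable u : HV u -> measurable_fun Gam (np u).
Proof. by move=> tu; apply: measurable_dotp => i; [exact: tr_coord|exact: nu_coord]. Qed.

Lemma normal_part_L2 u : HV u -> L2 sg Gam (np u).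
Proof.
move=> tu; apply: (L2_dominated mGam (normal_part_measurable tu) _ (normal_part_le u)).
exact: (enorm_L2 mGam (bdtraceV_L2 tu)).
Qed.

Lemma tangential_norm_L2 u : HV u -> L2 sg Gam (fun x => enorm (tp u x)).
Proof.
move=> tu; apply: (L2_dominated mGam _ _ (tangential_part_le u)).
  apply: measurable_enorm => i.
  have -> : (fun x => tp u x ord0 i) = (fun x => tr u x ord0 i - np u x * nu x ord0 i).
    apply/funext => x; rewrite /tangential_part.
    by move: (tr u x) (np u x) (nu x) => a b c; rewrite !mxE.
  apply: measurable_funB; first exact: tr_coord.
  by apply: measurable_funM; [exact: normal_part_measurable|exact: nu_coord].
exact: (enorm_L2 mGam (bdtraceV_L2 tu)).
Qed.

Definition penetration u x : R := Num.max 0 (np u x - g x).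

Let LGc f : L2 sg Gam f -> L2 sg Gc f. Proof. exact: L2S. Qed.

Lemma penetration_L2 u : HV u -> L2 sg Gc (penetration u).
Proof.
move=> tu; have n2 := LGc (normal_part_L2 tu).
have d2 : L2 sg Gc (np u - g : 'rV[R]_d -> R).
  exact: (subspaceB (L2_subspace sg mGc) n2 g2).
apply: (L2_dominated mGc _ d2).
  by apply: measurable_maxr; [exact: measurable_cst|case: d2].
apply: aeW => x _; rewrite /penetration -[(np u - g) x]/(np u x - g x).
by have [h|h] := leP 0 (np u x - g x); rewrite ?normr0.
Qed.

Let blc := let: And3 bl _ _ := ip_semi_inner sg mGc in bl.

Lemma contact_formE u v : HV u -> HV v ->
  contact_form Om sg nu Gc cp mufr g u v =
  cp * ip sg Gc (penetration u) (np v)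
  + mufr * cp * ip sg Gc (penetration u) (fun x => enorm (tp v x)).
Proof.
move=> tu tv; have p2 := penetration_L2 tu.
have n2 := LGc (normal_part_L2 tv); have t2 := LGc (tangential_norm_L2 tv).
rewrite /contact_form /ip.
rewrite -(RintegralZl cp mGc (L2_integrableM mGc p2 n2)).
rewrite -(RintegralZl (mufr * cp) mGc (L2_integrableM mGc p2 t2)).
by congr (_ + _); apply: eq_Rintegral => x _; rewrite mulrA.
Qed.

Lemma normal_part_sub_le u v : HV u -> HV v ->
  {ae sg, forall x, Gam x -> `|np u x - np v x| <= `|enorm (tr (u - v) x)|}.
Proof.
move=> tu tv; apply: filterS2 (normal_part_ae_linear (-1) tv tu) (normal_part_le (u - v)).
move=> x h1 h2 Gx; apply: le_trans (h2 Gx).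
have -> : u - v = -1 *: v + u by rewrite scaleN1r addrC.
by rewrite (h1 Gx) -[_ *: _]/(-1 * np v x) mulN1r addrC.
Qed.

Lemma tangential_norm_sub_le u v : HV u -> HV v ->
  {ae sg, forall x, Gam x ->
     `|enorm (tp u x) - enorm (tp v x)| <= `|enorm (tr (u - v) x)|}.
Proof.
move=> tu tv; apply: filterS2 (tangential_part_ae_linear (-1) tv tu) (tangential_part_le (u - v)).
move=> x h1 h2 Gx; apply: le_trans (h2 Gx).
have -> : u - v = -1 *: v + u by rewrite scaleN1r addrC.
rewrite (h1 Gx); move: (tp u x) (tp v x) => a b.
rewrite scaleN1r (addrC (- b)) [leRHS]ger0_norm ?enorm_ge0// ler_norml.
have h3 := enormD (a - b) b; have h4 := enormD (b - a) a.
by rewrite subrK in h3; rewrite subrK enormB in h4; apply/andP; split; lra.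
Qed.

(** A function on the contact boundary dominated by a trace inherits the bound
    of the trace inequality; normal traces, tangential norms and penetrations are
    all compared with the data in this way. *)
Lemma boundary_norm_le f w : L2 sg Gc f -> HV w ->
  {ae sg, forall x, Gam x -> `|f x| <= `|enorm (tr w x)|} ->
  seminorm (ip sg Gc) f <= Ctau * seminorm H1ipV w.
Proof.
move=> f2 tw fw; apply: le_trans (bdtraceV_le Om_open mGam Ctau0 trC tw).
apply: (seminorm_le_ae mGam mGc GcG f2).
  exact: (enorm_L2 mGam (bdtraceV_L2 tw)).
by apply: filterS fw => x h Gx; apply: h; exact: GcG.
Qed.

Lemma ip_Gc_le f h w : L2 sg Gc f -> L2 sg Gc h -> HV w ->
  {ae sg, forall x, Gam x -> `|h x| <= `|enorm (tr w x)|} ->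
  ip sg Gc f h <= seminorm (ip sg Gc) f * (Ctau * seminorm H1ipV w).
Proof.
move=> f2 h2 tw hw; apply: le_trans (ler_norm _) _.
apply: le_trans (cauchy_schwarz (L2_subspace sg mGc) (ip_semi_inner sg mGc) f2 h2) _.
by rewrite ler_wpM2l ?sqrtr_ge0//; exact: boundary_norm_le.
Qed.

Lemma contact_form_sub u v v' : HV u -> HV v -> HV v' ->
  contact_form Om sg nu Gc cp mufr g u v - contact_form Om sg nu Gc cp mufr g u v' =
  cp * ip sg Gc (penetration u) (np v - np v' : 'rV[R]_d -> R) +
  mufr * cp * ip sg Gc (penetration u)
    ((fun x => enorm (tp v x)) - (fun x => enorm (tp v' x)) : 'rV[R]_d -> R).
Proof.
move=> tu tv tv'; have p2 := penetration_L2 tu.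
rewrite !contact_formE//.
rewrite (linear_onB (blc p2).1 (LGc (normal_part_L2 tv)) (LGc (normal_part_L2 tv'))).
rewrite (linear_onB (blc p2).1 (LGc (tangential_norm_L2 tv)) (LGc (tangential_norm_L2 tv'))).
have alg a b c e : cp * a + mufr * cp * b - (cp * c + mufr * cp * e) =
  cp * (a - c) + mufr * cp * (b - e) by ring.
exact: alg.
Qed.

Let np_sub_L2 v v' : HV v -> HV v' -> L2 sg Gc (np v - np v' : 'rV[R]_d -> R).
Proof.
move=> tv tv'; apply: (subspaceB (L2_subspace sg mGc)); apply: LGc; exact: normal_part_L2.
Qed.

Let tn_sub_L2 v v' : HV v -> HV v' -> L2 sg Gc
  ((fun x => enorm (tp v x)) - (fun x => enorm (tp v' x)) : 'rV[R]_d -> R).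
Proof.
move=> tv tv'; apply: (subspaceB (L2_subspace sg mGc)); apply: LGc; exact: tangential_norm_L2.
Qed.

Let HVB v v' : HV v -> HV v' -> HV (v - v').
Proof. by move=> tv tv'; exact: (subspaceB sHV tv tv'). Qed.

Lemma contact_form_lipschitz u v v' : HV u -> HV v -> HV v' ->
  contact_form Om sg nu Gc cp mufr g u v - contact_form Om sg nu Gc cp mufr g u v' <=
  (1 + mufr) * cp * Ctau * seminorm (ip sg Gc) (penetration u) * seminorm H1ipV (v - v').
Proof.
move=> tu tv tv'; rewrite contact_form_sub//; have p2 := penetration_L2 tu.
have h1 := ip_Gc_le p2 (np_sub_L2 tv tv') (HVB tv tv') (normal_part_sub_le tv tv').
have h2 := ip_Gc_le p2 (tn_sub_L2 tv tv') (HVB tv tv') (tangential_norm_sub_le tv tv').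
apply: le_trans (lerD (ler_wpM2l cp0 h1) (ler_wpM2l (mulr_ge0 mufr0 cp0) h2)) _.
move: (seminorm _ _) (seminorm _ _) => a b.
by rewrite le_eqVlt; apply/orP; left; apply/eqP; ring.
Qed.

(** The constant [Ctau^2 (1 + mufr) cp]: the penetration is a contraction of
    the normal trace, and normal and tangential parts are bounded by the trace. *)
Lemma contact_form_four_terms u u' v v' : HV u -> HV u' -> HV v -> HV v' ->
  contact_form Om sg nu Gc cp mufr g u v - contact_form Om sg nu Gc cp mufr g u v'
  + contact_form Om sg nu Gc cp mufr g u' v' - contact_form Om sg nu Gc cp mufr g u' v
  <= Ctau ^+ 2 * (1 + mufr) * cp * seminorm H1ipV (u - u') * seminorm H1ipV (v - v').
Proof.
move=> tu tu' tv tv'; have p2 := penetration_L2 tu; have p2' := penetration_L2 tu'.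
have n2 := np_sub_L2 tv tv'; have t2 := tn_sub_L2 tv tv'.
pose dp : 'rV[R]_d -> R := penetration u - penetration u'.
have dp2 : L2 sg Gc dp by exact: (subspaceB (L2_subspace sg mGc) p2 p2').
have dple : seminorm (ip sg Gc) dp <= Ctau * seminorm H1ipV (u - u').
  apply: (boundary_norm_le dp2 (HVB tu tu')).
  apply: filterS (normal_part_sub_le tu tu') => x h Gx; apply: le_trans (h Gx).
  exact: pos_part_sub_le.
have h1 := ip_Gc_le dp2 n2 (HVB tv tv') (normal_part_sub_le tv tv').
have h2 := ip_Gc_le dp2 t2 (HVB tv tv') (tangential_norm_sub_le tv tv').
have E1 := contact_form_sub tu tv tv'; have E2 := contact_form_sub tu' tv tv'.
have e1 := linear_onB (blc n2).2 p2 p2'; have e2 := linear_onB (blc t2).2 p2 p2'.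
have S0 : 0 <= Ctau * seminorm H1ipV (v - v') by rewrite mulr_ge0// sqrtr_ge0.
have h3 := ler_wpM2r S0 dple.
have h4 := lerD (ler_wpM2l cp0 (le_trans h1 h3))
  (ler_wpM2l (mulr_ge0 mufr0 cp0) (le_trans h2 h3)).
have alg (a1 a2 a3 a4 b1 b2 b3 b4 c1 c2 N S : R) :
    a1 - a2 = cp * b1 + mufr * cp * b2 -> a3 - a4 = cp * b3 + mufr * cp * b4 ->
    c1 = b1 - b3 -> c2 = b2 - b4 ->
    cp * c1 + mufr * cp * c2 <= cp * (Ctau * N * (Ctau * S)) + mufr * cp * (Ctau * N * (Ctau * S)) ->
    a1 - a2 + a4 - a3 <= Ctau ^+ 2 * (1 + mufr) * cp * N * S.
  move=> A1 A2 -> -> h; rewrite (_ : a1 - a2 + a4 - a3 = a1 - a2 - (a3 - a4)); last ring.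
  rewrite A1 A2.
  apply: le_trans (le_trans _ h) _; rewrite le_eqVlt; apply/orP; left; apply/eqP; ring.
exact: (alg _ _ _ _ _ _ _ _ _ _ _ _ E1 E2 e1 e2 h4).
Qed.

(** The penetration is a nonnegative weight; the normal part is linear and the
    norm of the tangential part is convex in the second argument. *)
Lemma contact_form_convex u : HV u ->
  convex_fct HV (contact_form Om sg nu Gc cp mufr g u).
Proof.
move=> tu t v v' tv tv' /andP[t0 t1]; have p2 := penetration_L2 tu.
have tv1 : HV ((1 - t) *: v') by exact: (subspaceZ sHV).
have tvv : HV (t *: v + (1 - t) *: v') by exact: sHV.2.
have [ZN ZT] : ae_eq sg Gam (np ((1 - t) *: v')) ((1 - t) *: np v' : 'rV[R]_d -> R) /\
   {ae sg, forall x, Gam x -> tp ((1 - t) *: v') x = (1 - t) *: tp v' x}.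
  have H0 := sHV.1.
  have N0 := normal_part_ae_linear (-1) H0 H0; have T0 := tangential_part_ae_linear (-1) H0 H0.
  have N1 := normal_part_ae_linear (1 - t) tv' H0.
  have T1 := tangential_part_ae_linear (1 - t) tv' H0.
  rewrite !scaler0 !addr0 in N0 T0 N1 T1; split.
    apply: filterS2 N0 N1 => x h0 h1 Gx; have := h0 Gx; rewrite (h1 Gx) scaleN1r addNr => ->.
    by rewrite addr0.
  apply: filterS2 T0 T1 => x h0 h1 Gx; have := h0 Gx; rewrite (h1 Gx) scaleN1r addNr => ->.
  by rewrite addr0.
rewrite !contact_formE//.
have n2 := LGc (normal_part_L2 tv); have n2' := LGc (normal_part_L2 tv').
have m2 := LGc (tangential_norm_L2 tv); have m2' := LGc (tangential_norm_L2 tv').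
have LL := (L2_subspace sg mGc).2.
have Z2 f : L2 sg Gc f -> L2 sg Gc ((1 - t) *: f : 'rV[R]_d -> R).
  by move=> f2; exact: (subspaceZ (L2_subspace sg mGc)).
have E1 : ip sg Gc (penetration u) (np (t *: v + (1 - t) *: v')) =
    t * ip sg Gc (penetration u) (np v) + (1 - t) * ip sg Gc (penetration u) (np v').
  rewrite -(linear_onZ (L2_subspace sg mGc) (blc p2).1 (1 - t) n2').
  rewrite -((blc p2).1 t _ _ n2 (Z2 _ n2')).
  apply: (ip_eq_ae mGc p2 p2 (LGc (normal_part_L2 tvv)) (LL t _ _ n2 (Z2 _ n2'))).
    exact: aeW.
  apply: ae_eq_subset GcG _.
  apply: filterS2 (normal_part_ae_linear t tv tv1) ZN => x h1 h2 Gx.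
  by rewrite (h1 Gx) (h2 Gx).
have E2 : ip sg Gc (penetration u) (fun x => enorm (tp (t *: v + (1 - t) *: v') x)) <=
    t * ip sg Gc (penetration u) (fun x => enorm (tp v x))
    + (1 - t) * ip sg Gc (penetration u) (fun x => enorm (tp v' x)).
  rewrite -(linear_onZ (L2_subspace sg mGc) (blc p2).1 (1 - t) m2').
  rewrite -((blc p2).1 t _ _ m2 (Z2 _ m2')).
  apply: (ip_le_ae mGc p2 (LGc (tangential_norm_L2 tvv)) (LL t _ _ m2 (Z2 _ m2'))).
    by move=> x _; rewrite /penetration le_max lexx.
  have : {ae sg, forall x, Gam x -> enorm (tp (t *: v + (1 - t) *: v') x) <=
      t * enorm (tp v x) + (1 - t) * enorm (tp v' x)}.
    apply: filterS2 (tangential_part_ae_linear t tv tv1) ZT => x h1 h2 Gx.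
    have tri (a b : 'rV[R]_d) : enorm (t *: a + (1 - t) *: b) <=
        t * enorm a + (1 - t) * enorm b.
      apply: le_trans (enormD _ _) _.
      by rewrite !enormZ !ger0_norm// subr_ge0.
    by rewrite (h1 Gx) (h2 Gx); exact: tri.
  by apply: filterS => x h Gx; apply: h; exact: GcG.
have alg (a b a' b' c e : R) : c = t * a + (1 - t) * a' ->
    e <= t * b + (1 - t) * b' -> cp * c + mufr * cp * e <=
    t * (cp * a + mufr * cp * b) + (1 - t) * (cp * a' + mufr * cp * b').
  move=> -> h; apply: le_trans (lerD (lexx _) (ler_wpM2l (mulr_ge0 mufr0 cp0) h)) _.
  rewrite le_eqVlt; apply/orP; left; apply/eqP; ring.
exact: (alg _ _ _ _ _ _ E1 E2).
Qed.

End contact_form.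

(** * Piecewise polynomials on a triangulation *)

Section simplices.
Context {R : realType} {d : nat}.
Implicit Types (a : 'I_d.+1 -> 'rV[R]_d) (x y : 'rV[R]_d).

(** Barycentric coordinates: the matrix with rows [(1, a i)] is invertible. *)
Lemma barycentric_coordinates a : affinely_independent a ->
  exists lam : 'I_d.+1 -> 'rV[R]_d -> R,
    [/\ forall i, continuous (lam i), forall y, \sum_i lam i y = 1,
        forall y, \sum_i lam i y *: a i = y &
        forall (c : 'I_d.+1 -> R) i, \sum_i c i = 1 -> lam i (\sum_i c i *: a i) = c i].
Proof.
move=> ai.
pose A : 'M[R]_(d.+1, d) := \matrix_(i, j) a i ord0 j.
pose Mx : 'M[R]_(d.+1, 1 + d) := row_mx (const_mx 1) A.
have mulA (c : 'rV[R]_d.+1) : c *m Mx = row_mx (const_mx (\sum_i c ord0 i))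
    (\sum_i c ord0 i *: a i).
  rewrite mul_mx_row; congr row_mx.
    by apply/rowP => j; rewrite !mxE; apply: eq_bigr => i _; rewrite mxE mulr1.
  by apply/rowP => j; rewrite !mxE summxE; apply: eq_bigr => i _; rewrite !mxE.
have Mu : (Mx : 'M[R]_d.+1) \in unitmx.
  rewrite -row_free_unit -kermx_eq0; apply/eqP/row_matrixP => k; rewrite row0.
  set c := row k (kermx Mx).
  have : c *m Mx = 0 by rewrite -row_mul mulmx_ker row0.
  rewrite mulA -[RHS](@row_mx0 _ 1 1 d) => /eq_row_mx[c0 ca].
  apply/rowP => i; rewrite [RHS]mxE; apply: (ai (fun i => c ord0 i)) => //.
  by have := congr1 (fun m : 'rV[R]_1 => m ord0 ord0) c0; rewrite !mxE.
pose N := invmx (Mx : 'M[R]_d.+1).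
pose L y : 'rV[R]_d.+1 := (row_mx (const_mx 1) y : 'rV[R]_(1 + d)) *m N.
have LM y : L y *m Mx = row_mx (const_mx 1) y.
  by rewrite /L mulmxKV.
exists (fun i y => L y ord0 i); split.
- move=> i.
  have -> : (fun y => L y ord0 i) =
      (fun y => \sum_j (row_mx (const_mx 1) y : 'rV[R]_(1 + d)) ord0 j * N j i).
    by apply/funext => y; rewrite mxE.
  apply: continuous_bigsum => j.
  apply: continuous_mul; last exact: continuous_const.
  have -> : (fun y => (row_mx (const_mx 1) y : 'rV[R]_(1 + d)) ord0 j) =
     (fun y => match fintype.split (j : 'I_(1 + d)) with inl _ => 1 | inr k => y ord0 k end).
    by apply/funext => y; rewrite mxE; case: fintype.split => // k; rewrite mxE.
  case: fintype.split => k; first exact: continuous_const.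
  exact: coord_continuous.
- move=> y; have := LM y; rewrite mulA => /eq_row_mx[h _].
  by have := congr1 (fun m : 'rV[R]_1 => m ord0 ord0) h; rewrite !mxE.
- by move=> y; have := LM y; rewrite mulA => /eq_row_mx[_ ->].
- move=> c i c1; pose cv : 'rV[R]_d.+1 := \row_i c i.
  have E : row_mx (const_mx 1) (\sum_i c i *: a i) = cv *m Mx.
    rewrite mulA; congr row_mx.
      by congr const_mx; rewrite -c1; apply: eq_bigr => k _; rewrite mxE.
    by apply: eq_bigr => k _; rewrite mxE.
  by rewrite /L E mulmxK// mxE.
Qed.

(** Move [x] slightly towards the barycentre: the barycentric coordinates become
    positive, and they remain so nearby. *)
Lemma simplex_interior_dense a x (U : set 'rV[R]_d) : affinely_independent a ->
  simplex a x -> open U -> U x -> exists O : set 'rV[R]_d,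
    [/\ open O, O !=set0, O `<=` U & O `<=` simplex a].
Proof.
move=> ai [c [c0 _ c1 xE]] oU Ux.
have [lam [clam lam1 lamE lamc]] := barycentric_coordinates ai.
pose O := U `&` [set y | forall i, 0 < lam i y].
exists O; split.
- apply: openI => //; rewrite openE => y /= ly.
  have : nbhs y [set z | forall i, 0 < lam i z].
    apply: (@filter_forall _ _ (fun i z => 0 < lam i z) (nbhs y)) => i.
    have : lam i @ nbhs y --> lam i y by exact: clam.
    move/(@cvgr_gt _ _ (nbhs y) (nbhs_filter y)); apply; exact: ly.
  by [].
- have /nbhs_ballP[e /= e0 eU] : nbhs x U by exact: open_nbhs_nbhs.
  pose n1 : R := d.+1%:R^-1.
  have n10 : 0 < n1 by rewrite invr_gt0 ltr0n.
  pose b := \sum_i n1 *: a i.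
  pose t := Num.min 1 (e / (`|b - x| + 1) / 2).
  have t0 : 0 < t.
    by rewrite lt_min ltr01 divr_gt0// divr_gt0// ltr_wpDl.
  have t1 : t <= 1 by rewrite ge_min lexx.
  have xt : x + t *: (b - x) = \sum_i ((1 - t) * c i + t * n1) *: a i.
    rewrite {1 2}xE /b scalerBr !scaler_sumr -sumrB -big_split/=.
    by apply: eq_bigr => i _; rewrite !scalerA -scalerBl -scalerDl; congr (_ *: _); ring.
  exists (x + t *: (b - x)); split.
    apply: eU; rewrite -ball_normE /= opprD addrA subrr sub0r normrN normrZ gtr0_norm//.
    apply: (@le_lt_trans _ _ (e / (`|b - x| + 1) / 2 * (`|b - x| + 1))).
      apply: ler_pM => //; first exact: ltW.
        by rewrite ge_min lexx orbT.
      by rewrite lerDl.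
    rewrite mulrAC divfK; last by rewrite gt_eqF// ltr_wpDl.
    by rewrite ltr_pdivrMr// ltr_pMr// ltr1n.
  move=> i /=; rewrite xt lamc; last first.
    rewrite big_split/= -!mulr_sumr c1 sumr_const card_ord -[_ *+ _]mulr_natl.
    by rewrite mulfV ?pnatr_eq0//; ring.
  by rewrite ltr_wpDl// ?mulr_gt0// mulr_ge0 ?subr_ge0.
- by move=> y [].
- move=> y [_ ly]; exists (fun i => lam i y); split=> //.
  + by move=> i; exact/ltW/ly.
  + by move=> i; rewrite inE.
Qed.

End simplices.

Section piecewise_polynomials.
Context {R : realType} {d : nat}.
Variables (Om : set 'rV[R]_d) (Th : triangulation R d).
Hypotheses (Om_open : open Om) (Th_conf : conforming Om Th).
Local Notation leb := (lebesgue_rV d).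

Definition poly_fct (k : nat) (c : {ffun 'I_d -> 'I_k.+1} -> R) (x : 'rV[R]_d) : R :=
  \sum_(m : {ffun 'I_d -> 'I_k.+1} | (\sum_i m i <= k)%N)
    c m * \prod_i x ord0 i ^+ m i.

Lemma poly_fct_continuous k (c : {ffun 'I_d -> 'I_k.+1} -> R) : continuous (poly_fct c).
Proof.
have -> : poly_fct c = (fun x => \sum_(m : {ffun 'I_d -> 'I_k.+1})
    (if (\sum_i m i <= k)%N then c m else 0) * \prod_i x ord0 i ^+ m i).
  apply/funext => x; rewrite /poly_fct big_mkcond/=; apply: eq_bigr => m _.
  by case: ifP => //; rewrite mul0r.
apply: continuous_bigsum => m; apply: continuous_mul; first exact: continuous_const.
have cexp i n : continuous (fun x : 'rV[R]_d => x ord0 i ^+ n).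
  elim: n => [|n IH].
    have -> : (fun x : 'rV[R]_d => x ord0 i ^+ 0) = fun=> 1 by apply/funext => x; rewrite expr0.
    exact: continuous_const.
  have -> : (fun x : 'rV[R]_d => x ord0 i ^+ n.+1) = fun x => x ord0 i * x ord0 i ^+ n.
    by apply/funext => x; rewrite exprS.
  by apply: continuous_mul => //; exact: coord_continuous.
by apply: continuous_bigprod => i; exact: cexp.
Qed.

(** Two continuous functions on a simplex that agree almost everywhere agree
    everywhere, because the interior of the simplex is dense in it and open sets
    have positive measure. *)
Lemma piecewise_polynomial_null k (q : 'rV[R]_d -> R) :
  (forall c, poly_on k (@cell _ _ Th c) q) ->
  {ae leb, forall x, Om x -> q x = 0} -> forall x, closure Om x -> q x = 0.
Proof.
move=> pq q0 x; have [ai -> _] := Th_conf => -[l _ xl].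
have [c qE] := pq l; rewrite (qE _ xl) -/(poly_fct c x).
apply: contrapT => /eqP qx0.
pose U := poly_fct c @^-1` [set r | r != 0].
have oU : open U.
  apply: open_comp; last exact: open_neq.
  by move=> y _; exact: poly_fct_continuous.
have [B [oO [z Oz] OU Ol]] := simplex_interior_dense (ai l) xl oU qx0.
have [y [Omy Oy]] : Om `&` B !=set0.
  have : closure Om z by have [_ -> _] := Th_conf; exists l => //; exact: Ol.
  by apply; exact: open_nbhs_nbhs.
have H : {ae leb, forall x, (Om `&` B) x -> q x = 0}.
  by apply: filterS q0 => v h [/h].
have [w [Omw Ow]] := lebesgue_ae_open (openI Om_open oO) (ex_intro _ y (conj Omy Oy)) H.
rewrite (qE _ (Ol _ Ow)) -/(poly_fct c w) => w0.
by have := OU _ Ow; rewrite /U/= w0 eqxx.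
Qed.

(** The piecewise polynomial with given coefficients on each cell; where cells
    overlap an arbitrary one is used, and the value outside the mesh is [0]. *)
Definition reconstruct k (c : 'I_(ncells Th) * {ffun 'I_d -> 'I_k.+1} -> R)
    (x : 'rV[R]_d) : R :=
  if [pick l | `[< @cell _ _ Th l x >]] is Some l
  then poly_fct (fun m => c (l, m)) x else 0.

Lemma reconstruct_linear k a c c' :
  reconstruct (a *: c + c') = a *: @reconstruct k c + reconstruct c'.
Proof.
apply/funext => x; rewrite -[RHS]/(a * reconstruct c x + reconstruct c' x) /reconstruct.
case: pickP => [l _|_]; last by rewrite mulr0 addr0.
rewrite /poly_fct mulr_sumr -big_split/=; apply: eq_bigr => m _.
by rewrite -[(_ + _) (l, m)]/(a * c (l, m) + c' (l, m)); ring.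
Qed.

Lemma reconstructP k (q : 'rV[R]_d -> R) : (forall l, poly_on k (@cell _ _ Th l) q) ->
  exists c, forall x, closure Om x -> q x = @reconstruct k c x.
Proof.
move=> /choice[c cP]; exists (fun lm => c lm.1 lm.2) => x.
have [_ -> _] := Th_conf => -[l _ xl]; rewrite /reconstruct.
case: pickP => [l' /asboolP xl'|/(_ l)]; first exact: cP.
by move/asboolP.
Qed.

Lemma poly_on_linear k (S : set 'rV[R]_d) a (q q' : 'rV[R]_d -> R) :
  poly_on k S q -> poly_on k S q' -> poly_on k S (a *: q + q').
Proof.
move=> [c cP] [c' cP']; exists (fun m => a * c m + c' m) => x Sx.
rewrite -[LHS]/(a * q x + q' x) cP// cP'// mulr_sumr -big_split/=.
by apply: eq_bigr => m _; ring.
Qed.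

Lemma poly_on0 k (S : set 'rV[R]_d) : poly_on k S (0 : 'rV[R]_d -> R).
Proof. by exists (fun=> 0) => x _; rewrite big1// => m _; rewrite mul0r. Qed.

End piecewise_polynomials.

Section dimension_bound.
Context {R : realType} {V : lmodType R}.
Variables (W : set V) (s : V -> V -> R).
Hypotheses (sW : subspace W) (si : semi_inner W s).

(** If the vectors of [W] are determined, up to vectors in the radical of the
    form, by finitely many coefficients, then orthonormal families are finite:
    a linear relation between the coefficient vectors of an orthonormal family
    yields a combination of the family that is orthogonal to itself. *)
Lemma orthonormal_bound (I : finType) (rec : (I -> R) -> V) (N : set V) n
    (e : 'I_n -> V) :
  subspace N -> (forall a c c', rec (a *: c + c') = a *: rec c + rec c') ->
  (forall x, W x -> exists c, N (x - rec c)) ->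
  (forall x y, W x -> W y -> N x -> s x y = 0) ->
  orthonormal W s e -> (n <= #|I|)%N.
Proof.
move=> sN recl recP Ns [We oe].
have /choice[c cP] : forall i, exists c, N (e i - rec c) by move=> i; exact: recP.
pose C : 'M[R]_(n, #|I|) := \matrix_(i, k) c i (enum_val k).
rewrite leqNgt; apply/negP => In.
have kn : kermx C != 0.
  rewrite -mxrank_eq0 mxrank_ker -lt0n subn_gt0.
  by apply: leq_ltn_trans In; exact: rank_leq_col.
have [i /eqP ki] : exists i, row i (kermx C) != 0.
  apply/existsP; rewrite -negb_forall; apply: contra kn => /forallP h.
  by apply/eqP/row_matrixP => i; rewrite row0; exact/eqP.
apply: ki; set a := row i (kermx C).
have aC : a *m C = 0 by rewrite -row_mul mulmx_ker row0.
have rec0 : rec 0 = 0.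
  by have := recl (-1) 0 0; rewrite scaler0 addr0 scaleN1r addNr.
have Nsum : N (comb e a).
  have recsum (J : seq 'I_n) : rec (\sum_(j <- J) a ord0 j *: c j) =
      \sum_(j <- J) a ord0 j *: rec (c j).
    elim: J => [|j J IH]; first by rewrite !big_nil rec0.
    by rewrite !big_cons recl IH.
  have -> : comb e a = \sum_j a ord0 j *: (e j - rec (c j)).
    rewrite /comb; under [RHS]eq_bigr do rewrite scalerBr.
    rewrite sumrB -recsum (_ : \sum_j a ord0 j *: c j = 0) ?rec0 ?subr0//.
    apply/funext => k; rewrite fct_sumE.
    have z0 : (0 : 'rV[R]_#|I|) ord0 (enum_rank k) = 0 by rewrite mxE.
    rewrite -[RHS]z0 -aC mxE; apply: eq_bigr => j _.
    by rewrite [C _ _]mxE enum_rankK.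
  apply: subspace_sum => // j; exact: subspaceZ.
have Wa : W (comb e a) by exact: comb_subspace.
apply/rowP => k; rewrite [RHS]mxE.
have := Ns _ _ Wa (We k) Nsum; rewrite (comb_inner sW si)// (bigD1 k)//= oe eqxx mulr1.
by rewrite big1 ?addr0// => j jk; rewrite oe (negPf jk) mulr0.
Qed.

End dimension_bound.

(** * The coupled problem *)

Section coupled_problem.
Context {R : realType} {V Q : lmodType R}.
Variables (Vh : set V) (Qh : set Q) (sV : V -> V -> R) (mQ : Q -> Q -> R).
Hypotheses (sVh : subspace Vh) (sQh : subspace Qh).
Hypotheses (siV : semi_inner Vh sV) (siQ : semi_inner Qh mQ).
Variables (A B J : V -> V -> R) (D : Q -> Q -> R) (c : Q -> V -> R).
Variables (F : V -> R) (psi : Q -> R).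
Variables (alphaA alphaB alpha c0 mu dt CJ : R).
Hypotheses (alphaA0 : 0 < alphaA) (alphaB0 : 0 < alphaB) (c00 : 0 < c0)
  (mu0 : 0 < mu) (dt0 : 0 < dt) (CJ0 : 0 <= CJ) (small : CJ < alphaA + alphaB / dt).
Hypotheses (bA : bilinear_on Vh A) (bB : bilinear_on Vh B) (bD : bilinear_on Qh D)
  (lc1 : forall v, Vh v -> linear_on Qh (c ^~ v))
  (lc2 : forall q, Qh q -> linear_on Vh (c q))
  (lF : linear_on Vh F) (lpsi : linear_on Qh psi).
Hypotheses (Acoer : forall v, Vh v -> alphaA * sV v v <= A v v)
  (Bcoer : forall v, Vh v -> alphaB * sV v v <= B v v)
  (D0 : forall q, Qh q -> 0 <= D q q).
Hypotheses (Jlip : forall u, Vh u -> exists2 K, 0 <= K & forall v v', Vh v -> Vh v' ->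
     J u v - J u v' <= K * seminorm sV (v - v'))
  (Jcvx : forall u, Vh u -> convex_fct Vh (J u))
  (J4 : forall u u' v v', Vh u -> Vh u' -> Vh v -> Vh v' ->
     J u v - J u v' + J u' v' - J u' v <=
     CJ * seminorm sV (u - u') * seminorm sV (v - v')).
Hypotheses (nullV : forall v z, Vh v -> Vh z -> sV v v = 0 ->
     [/\ A z v = 0, A v z = 0, B z v = 0 & F v = 0])
  (nullc : forall v q, Vh v -> Qh q -> sV v v = 0 -> c q v = 0)
  (nullQ : forall q z v, Qh q -> Qh z -> Vh v -> mQ q q = 0 ->
     [/\ D z q = 0, c q v = 0 & psi q = 0]).

(** One time step, in terms of the discrete velocity [du]. *)
Definition coupled_step (u0 : V) (p0 : Q) (u : V) (p : Q) :=
  let du := dt^-1 *: (u - u0) in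
  [/\ Vh u, Qh p,
      forall v, Vh v -> F (v - du) <=
        A u (v - du) + B du (v - du) - alpha * c p (v - du) + J u v - J u du &
      forall q, Qh q ->
        c0 * mQ (dt^-1 *: (p - p0)) q + alpha * c q du + mu^-1 * D p q = psi q].

Let m := dt * alphaA + alphaB.

Let m0 : 0 < m. Proof. by rewrite addr_gt0// mulr_gt0. Qed.

Let LM : dt * CJ < m.
Proof.
have : dt * CJ < dt * (alphaA + alphaB / dt) by rewrite ltr_pM2l.
by rewrite mulrDr (mulrC dt (_ / _)) divfK// gt_eqF.
Qed.

Section existence.
Variables (u0 : V) (p0 : Q) (Vu0 : Vh u0) (Qp0 : Qh p0).
Variables (I : finType) (rec : (I -> R) -> V * Q) (N : set (V * Q)).
Hypotheses (sN : subspace N)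
  (recl : forall a x y, rec (a *: x + y) = a *: rec x + rec y)
  (recP : forall v q, Vh v -> Qh q -> exists x, N ((v, q) - rec x))
  (Nnull : forall v q, Vh v -> Qh q -> N (v, q) -> sV v v = 0 /\ mQ q q = 0).

(* The unknown is the pair of the velocity and the pressure; the displacement is
   recovered as [u0 + dt *: z.1]. The weight [kap] of the pressure norm makes the
   joint form coercive with the constant [m] for both unknowns. *)
Let Z : lmodType R := (V * Q)%type.
Let W : set Z := [set z | Vh z.1 /\ Qh z.2].
Let kap := c0 / (dt * m).
Let s (z y : Z) := sV z.1 y.1 + kap * mQ z.2 y.2.
Let a (z y : Z) := dt * A z.1 y.1 + B z.1 y.1 - alpha * c z.2 y.1
  + alpha * c y.2 z.1 + c0 / dt * mQ z.2 y.2 + mu^-1 * D z.2 y.2.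
Let l (y : Z) := F y.1 - A u0 y.1 + psi y.2 + c0 / dt * mQ p0 y.2.
Let j (z y : Z) := J (u0 + dt *: z.1) y.1.

Let kap0 : 0 < kap. Proof. by rewrite divr_gt0// mulr_gt0. Qed.

Let sW : subspace W.
Proof.
split; first by split; [exact: sVh.1|exact: sQh.1].
by move=> k x y [Vx Qx] [Vy Qy]; split; [exact: sVh.2|exact: sQh.2].
Qed.

Let bV : bilinear_on Vh sV. Proof. by case: siV. Qed.
Let bQ : bilinear_on Qh mQ. Proof. by case: siQ. Qed.

Let siW : semi_inner W s.
Proof.
split.
- move=> z [Vz Qz]; split=> k x y [Vx Qx] [Vy Qy]; rewrite /s/=.
    by rewrite ((bV Vz).1 k _ _ Vx Vy) ((bQ Qz).1 k _ _ Qx Qy); ring.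
  by rewrite ((bV Vz).2 k _ _ Vx Vy) ((bQ Qz).2 k _ _ Qx Qy); ring.
- by move=> x y [Vx Qx] [Vy Qy]; rewrite /s (semi_innerC siV Vx Vy) (semi_innerC siQ Qx Qy).
- move=> x [Vx Qx]; rewrite /s addr_ge0 ?(semi_inner_ge0 siV)// mulr_ge0 ?(ltW kap0)//.
  exact: semi_inner_ge0 siQ _ Qx.
Qed.

Let sVs z : W z -> seminorm sV z.1 <= seminorm s z.
Proof.
move=> [Vz Qz]; apply: ler_wsqrtr; rewrite /s lerDl mulr_ge0 ?(ltW kap0)//.
exact: semi_inner_ge0 siQ _ Qz.
Qed.

Let seminormZ k v : Vh v -> seminorm sV (k *: v) = `|k| * seminorm sV v.
Proof.
move=> Vv; rewrite /seminorm (linear_onZ sVh (bV (subspaceZ sVh k Vv)).1)//.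
by rewrite (linear_onZ sVh (bV Vv).2)// mulrA -expr2 sqrtrM ?sqr_ge0// sqrtr_sqr.
Qed.

Let Wu z : W z -> Vh (u0 + dt *: z.1).
Proof. by move=> [Vz _]; apply: subspaceD => //; exact: subspaceZ. Qed.

Let WB z y : W z -> W y -> W (z - y). Proof. exact: subspaceB. Qed.

Let joint_solution : exists2 z, W z &
  forall y, W y -> l (y - z) <= a z (y - z) + j z y - j z z.
Proof.
apply: (quasi_variational_inequality sW siW (dim := #|I|) (m := m) (L := dt * CJ)).
- move=> k e; apply: (orthonormal_bound sW siW sN recl).
    by move=> [v q] [Vv Qq]; exact: recP.
  move=> [v q] y [Vv Qq] [Vy Qy] /(Nnull Vv Qq)[v0 q0].
  by rewrite /s/= (seminorm0_orth sVh siV Vv Vy v0) (seminorm0_orth sQh siQ Qq Qy q0) mulr0 addr0.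
- by rewrite mulr_ge0 ?(ltW dt0)//= LM.
- move=> z [Vz Qz]; split=> k x y [Vx Qx] [Vy Qy]; rewrite /a/=.
    rewrite ((bA Vz).1 k _ _ Vx Vy) ((bB Vz).1 k _ _ Vx Vy) ((bD Qz).1 k _ _ Qx Qy).
    rewrite ((bQ Qz).1 k _ _ Qx Qy) (lc1 Vz k Qx Qy) (lc2 Qz k Vx Vy); ring.
  rewrite ((bA Vz).2 k _ _ Vx Vy) ((bB Vz).2 k _ _ Vx Vy) ((bD Qz).2 k _ _ Qx Qy).
  rewrite ((bQ Qz).2 k _ _ Qx Qy) (lc1 Vz k Qx Qy) (lc2 Qz k Vx Vy); ring.
- move=> k x y [Vx Qx] [Vy Qy]; rewrite /l/=.
  rewrite (lF k Vx Vy) ((bA Vu0).1 k _ _ Vx Vy) (lpsi k Qx Qy) ((bQ Qp0).1 k _ _ Qx Qy).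
  ring.
- move=> z [Vz Qz]; rewrite /s /a mulrDr.
  have -> : m * (kap * mQ z.2 z.2) = c0 / dt * mQ z.2 z.2.
    by rewrite /kap; field; rewrite !gt_eqF.
  have h1 := ler_wpM2l (ltW dt0) (Acoer Vz); have h2 := Bcoer Vz.
  have h3 : 0 <= mu^-1 * D z.2 z.2 by rewrite mulr_ge0 ?D0// invr_ge0 ltW.
  by rewrite /m mulrDl; lra.
- move=> z Wz; have [K K0 KP] := Jlip (Wu Wz); exists K => // v v' Wv Wv'.
  apply: le_trans (KP _ _ Wv.1 Wv'.1) _; rewrite ler_wpM2l//.
  exact: sVs (WB Wv Wv').
- move=> z Wz t v v' [Vv _] [Vv' _]; exact: Jcvx (Wu Wz) _ _ _ Vv Vv'.
- move=> z z' v v' Wz Wz' Wv Wv'.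
  apply: le_trans (J4 (Wu Wz) (Wu Wz') Wv.1 Wv'.1) _.
  have -> : u0 + dt *: z.1 - (u0 + dt *: z'.1) = dt *: (z.1 - z'.1).
    by rewrite opprD addrACA subrr add0r scalerBr.
  rewrite seminormZ ?(gtr0_norm dt0); last by case: (WB Wz Wz').
  have h1 := sVs (WB Wz Wz'); have h2 := sVs (WB Wv Wv').
  rewrite (mulrC CJ) -!mulrA ler_wpM2l ?(ltW dt0)// mulrCA ler_wpM2l//.
  by apply: ler_pM => //; exact: sqrtr_ge0.
- move=> z y [Vz Qz] [Vy Qy] y0.
  have [y10 y20] : sV y.1 y.1 = 0 /\ mQ y.2 y.2 = 0.
    have h1 := semi_inner_ge0 siV Vy; have h2 := semi_inner_ge0 siQ Qy.
    have h3 := mulr_ge0 (ltW kap0) h2.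
    have e1 : sV y.1 y.1 = 0 by apply/eqP; rewrite eq_le h1 andbT; move: y0; rewrite /s; lra.
    split=> //; move: y0; rewrite /s e1 add0r => /eqP; rewrite mulf_eq0.
    by rewrite (gt_eqF kap0)/= => /eqP.
  have [A1 A2 B1 F1] := nullV Vy Vz y10; have [A3 _ _ _] := nullV Vy Vu0 y10.
  have [D1 c1 psi1] := nullQ Qy Qz Vz y20.
  have m1 q : Qh q -> mQ q y.2 = 0.
    by move=> Qq; rewrite (semi_innerC siQ Qq Qy) (seminorm0_orth sQh siQ Qy Qq y20).
  by rewrite /a /l A1 B1 (nullc Vy Qz y10) c1 m1// D1 F1 A3 psi1 m1//; split; ring.
Qed.

(** The velocity inequality is the joint one tested with an unchanged pressure;
    testing with an unchanged velocity and the pressures [p + q] and [p - q] gives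
    the pressure equation. *)
Lemma coupled_step_exists : exists u p, coupled_step u0 p0 u p.
Proof.
have [[w p] [/= Vw Qp] sol] := joint_solution.
have Vu : Vh (u0 + dt *: w) by exact: (Wu (z := (w, p))).
exists (u0 + dt *: w), p; rewrite /coupled_step.
have -> : dt^-1 *: (u0 + dt *: w - u0) = w.
  by rewrite addrC addKr scalerA mulVf ?scale1r// gt_eqF.
have lQ0 f : linear_on Qh f -> f 0 = 0 by move=> lf; exact (linear_on0 sQh lf).
have lV0 f : linear_on Vh f -> f 0 = 0 by move=> lf; exact (linear_on0 sVh lf).
split=> // [v Vv|q Qq].
- have Vvw : Vh (v - w) by exact: subspaceB.
  have := sol (v, p) (conj Vv Qp).
  have -> : (v, p) - (w, p) = (v - w, 0) :> Z.
    by rewrite -[LHS]/(v - w, p - p) subrr.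
  rewrite /l /a /j /=.
  rewrite (lQ0 _ lpsi) (lQ0 _ (bQ Qp0).1) (lQ0 _ (lc1 Vw)) (lQ0 _ (bQ Qp).1) (lQ0 _ (bD Qp).1).
  have -> : A (u0 + dt *: w) (v - w) = A u0 (v - w) + dt * A w (v - w).
    rewrite (linear_onD (bA Vvw).2)//; last exact: subspaceZ.
    by rewrite (linear_onZ sVh (bA Vvw).2).
  lra.
- have key r : Qh r -> psi r + c0 / dt * mQ p0 r <=
      alpha * c r w + c0 / dt * mQ p r + mu^-1 * D p r.
    move=> Qr; have := sol (w, p + r) (conj Vw (subspaceD sQh Qp Qr)).
    have -> : (w, p + r) - (w, p) = (0, r) :> Z.
      by rewrite -[LHS]/(w - w, p + r - p) subrr addrC addKr.
    rewrite /l /a /j /=.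
    rewrite (lV0 _ lF) (lV0 _ (bA Vu0).1) (lV0 _ (bA Vw).1) (lV0 _ (bB Vw).1) (lV0 _ (lc2 Qp)).
    lra.
  have QN : Qh (-1 *: q) by exact: subspaceZ.
  have h1 := key _ Qq; have := key _ QN.
  rewrite (linear_onZ sQh lpsi)// (linear_onZ sQh (bQ Qp0).1)// (linear_onZ sQh (lc1 Vw))//.
  rewrite (linear_onZ sQh (bQ Qp).1)// (linear_onZ sQh (bD Qp).1)// => h2.
  have Qpp : Qh (p - p0) by exact: subspaceB.
  rewrite (linear_onZ sQh (bQ Qq).2)// (linear_onB (bQ Qq).2)//.
  have -> : c0 * (dt^-1 * (mQ p q - mQ p0 q)) = c0 / dt * mQ p q - c0 / dt * mQ p0 q by ring.
  lra.
Qed.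

End existence.

(** Test each inequality with the velocity of the other solution and the
    difference of the pressure equations with the difference of the pressures;
    the coupling terms cancel. *)
Lemma coupled_step_unique u0 u0' p0 p0' u u' p p' :
  Vh u0 -> Vh u0' -> Qh p0 -> Qh p0' ->
  sV (u0 - u0') (u0 - u0') = 0 -> mQ (p0 - p0') (p0 - p0') = 0 ->
  coupled_step u0 p0 u p -> coupled_step u0' p0' u' p' ->
  sV (u - u') (u - u') = 0 /\ mQ (p - p') (p - p') = 0.
Proof.
move=> Vu0 Vu0' Qp0 Qp0' u00 p00; rewrite /coupled_step.
set w := dt^-1 *: (u - u0); set w' := dt^-1 *: (u' - u0').
move=> [Vu Qp vi ve] [Vu' Qp' vi' ve'].
have [bV _ _] := siV; have [bQ _ _] := siQ.
have Vw : Vh w by apply: subspaceZ => //; exact: subspaceB.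
have Vw' : Vh w' by apply: subspaceZ => //; exact: subspaceB.
pose e := w - w'; pose r := p - p'.
have Ve : Vh e by exact: subspaceB.
have Qr : Qh r by exact: subspaceB.
have Ve0 : Vh (u0 - u0') by exact: subspaceB.
have Qr0 : Qh (p0 - p0') by exact: subspaceB.
have uE : u - u' = dt *: e + (u0 - u0').
  rewrite /e /w /w' -scalerBr scalerA mulfV ?gt_eqF// scale1r.
  by rewrite opprB addrAC !subrKA.
have [_ A1 _ _] := nullV Ve0 Ve u00.
have we : w' - w = -1 *: e by rewrite scaleN1r opprB.
have lN f : linear_on Vh f -> f (w' - w) = - f e.
  by move=> lf; rewrite we (linear_onZ sVh lf)// mulN1r.
have := vi _ Vw'; have := vi' _ Vw.
rewrite -/e (lN _ lF) (lN _ (bA Vu).1) (lN _ (bB Vw).1) (lN _ (lc2 Qp)) => h1 h2.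
have j4 := J4 Vu Vu' Vw' Vw.
have Ae : A u e - A u' e = dt * A e e.
  rewrite -(linear_onB (bA Ve).2 Vu Vu') uE (linear_onD (bA Ve).2 _ Ve0)//.
    by rewrite A1 addr0 (linear_onZ sVh (bA Ve).2).
  exact: subspaceZ.
have Be : B w e - B w' e = B e e by rewrite -(linear_onB (bB Ve).2).
have ce : c p e - c p' e = c r e by rewrite -(linear_onB (lc1 Ve)).
have nu : seminorm sV (u - u') <= dt * seminorm sV e.
  rewrite uE; apply: le_trans (seminorm_triangle sVh siV (subspaceZ sVh dt Ve) Ve0) _.
  rewrite [X in _ + X](_ : _ = 0); last by rewrite /seminorm u00 sqrtr0.
  rewrite addr0 /seminorm (linear_onZ sVh (bV _ (subspaceZ sVh dt Ve)).1)//.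
  rewrite (linear_onZ sVh (bV _ Ve).2)// mulrA -expr2 sqrtrM ?sqr_ge0// sqrtr_sqr.
  by rewrite gtr0_norm.
have ne : seminorm sV (w' - w) = seminorm sV e.
  rewrite we /seminorm (linear_onZ sVh (bV _ (subspaceZ sVh (-1) Ve)).1)//.
  by rewrite (linear_onZ sVh (bV _ Ve).2)// mulrA mulrNN mul1r mul1r.
have s0 : 0 <= seminorm sV e by exact: sqrtr_ge0.
have ee := seminorm_sqr siV Ve.
have jb : J u w' - J u w + J u' w - J u' w' <= dt * CJ * sV e e.
  apply: le_trans j4 _; rewrite ne -ee expr2.
  by rewrite (mulrC dt CJ) !mulrA ler_wpM2r// -mulrA ler_wpM2l.
have h3 := ve r Qr; have h4 := ve' r Qr; rewrite -/w -/w' in h3 h4.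
have pr : c0 / dt * mQ r r + alpha * c r e + mu^-1 * D r r = 0.
  have Qd : Qh (dt^-1 *: (p - p0)) by apply: subspaceZ => //; exact: subspaceB.
  have E1 : mQ (dt^-1 *: (p - p0)) r - mQ (dt^-1 *: (p' - p0')) r = dt^-1 * mQ r r.
    rewrite !(linear_onZ sQh (bQ _ Qr).2); try exact: subspaceB.
    rewrite -mulrBr -(linear_onB (bQ _ Qr).2); try exact: subspaceB.
    have -> : p - p0 - (p' - p0') = r - (p0 - p0').
      by rewrite /r !opprB addrACA [RHS]addrACA (addrC (- p0)).
    rewrite (linear_onB (bQ _ Qr).2)// (seminorm0_orth sQh siQ Qr0 Qr p00) subr0.
    by [].
  have E2 : c r w - c r w' = c r e by rewrite -(linear_onB (lc2 Qr)).
  have E3 : D p r - D p' r = D r r by rewrite -(linear_onB (bD Qr).2).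
  rewrite -E2 -E3 -mulrA -E1; lra.
have ha := ler_wpM2l (ltW dt0) (Acoer Ve); have hb := Bcoer Ve.
have hd : 0 <= mu^-1 * D r r by rewrite mulr_ge0 ?D0// invr_ge0 ltW.
have hm := semi_inner_ge0 siQ Qr; have hs := semi_inner_ge0 siV Ve.
have cd : 0 < c0 / dt by rewrite divr_gt0.
have total : (m - dt * CJ) * sV e e + c0 / dt * mQ r r <= 0.
  by rewrite /m mulrBl mulrDl; nra.
have mL : 0 < m - dt * CJ by rewrite subr_gt0.
have he := mulr_ge0 (ltW mL) hs; have hr := mulr_ge0 (ltW cd) hm.
have e0 : sV e e = 0.
  have : (m - dt * CJ) * sV e e == 0 by rewrite eq_le he andbT; lra.
  by rewrite mulf_eq0 (gt_eqF mL)/= => /eqP.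
split.
  have h : seminorm sV (u - u') <= 0 by apply: le_trans nu _; rewrite /seminorm e0 sqrtr0 mulr0.
  have Vuu : Vh (u - u') by exact: subspaceB.
  rewrite -(seminorm_sqr siV Vuu); apply/eqP; rewrite sqrf_eq0.
  by rewrite eq_le h sqrtr_ge0.
have : c0 / dt * mQ r r == 0 by rewrite eq_le hr andbT; lra.
by rewrite mulf_eq0 (gt_eqF cd)/= => /eqP.
Qed.

End coupled_problem.

(** * The Darcy form *)

Section darcy_form.
Context {R : realType} {d : nat}.
Variables (Om : set 'rV[R]_d) (K : 'rV[R]_d -> 'M[R]_d).
Hypotheses (Om_open : open Om) (K_perm : permeability Om K).
Local Notation leb := (lebesgue_rV d).

Let mOm : measurable Om. Proof. exact: open_measurable_rV. Qed.

Let flux (g : 'rV[R]_d -> 'rV[R]_d) x := g x *m (K x)^T.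

Lemma flux_L2 g : L2V leb Om g -> L2V leb Om (flux g).
Proof.
move=> g2 j; have [mK _ [M KM] _] := K_perm.
have L := L2_subspace leb mOm.
have -> : (fun x => flux g x ord0 j) =
    \sum_k (fun x => g x ord0 k * K x j k : R).
  by apply/funext => x; rewrite fct_sumE mxE; apply: eq_bigr => k _; rewrite mxE.
apply: subspace_sum => // k.
have Mg : L2 leb Om (M *: (fun x => g x ord0 k) : 'rV[R]_d -> R) by exact: (subspaceZ L).
apply: (L2_dominated mOm _ Mg).
  by apply: measurable_funM; [case: (g2 k)|exact: mK].
apply: filterS KM => x h Ox; rewrite -[(M *: _) x]/(M * g x ord0 k) !normrM mulrC.
by rewrite ler_wpM2r// (le_trans (h Ox j k))// ler_norm.
Qed.

Let flux_form (g h : 'rV[R]_d -> 'rV[R]_d) := ipV leb Om (flux g) h.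

Let flux_form_bilinear : bilinear_on (L2V leb Om (d := d)) flux_form.
Proof.
have [bl _ _] := ipV_semi_inner leb d mOm.
move=> z z2; split=> k g h g2 h2; first exact: (bl _ (flux_L2 z2)).1.
rewrite /flux_form (_ : flux (k *: g + h) = k *: flux g + flux h).
  by apply: (bl _ z2).2; exact: flux_L2.
apply/funext => x; rewrite -[RHS]/(k *: flux g x + flux h x) /flux.
by rewrite mulmxDl -scalemxAl.
Qed.

Lemma darcy_form_bilinear : bilinear_on (H1 Om : set ('rV[R]_d -> R)) (darcy_form Om K).
Proof.
apply: (bilinear_pullback (T := wgrad Om) (b := flux_form) (mu := leb) (D := Om)
  (S := L2V leb Om (d := d)) (H1_subspace Om_open)).
- exact: L2V_subspace.
- exact: wgrad_L2.
- exact: wgrad_ae_linear.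
- exact: flux_form_bilinear.
- move=> f f' g g' f2 f2' g2 g2' ff gg.
  apply: (ipV_eq_ae mOm (flux_L2 f2) (flux_L2 f2') g2 g2' _ gg).
  by apply: filterS ff => x h Ox; rewrite /flux (h Ox).
Qed.

Lemma darcy_form_ge0 q : H1 Om q -> 0 <= darcy_form Om K q q.
Proof.
move=> Hq; have g2 := wgrad_L2 Hq; have f2 := flux_L2 g2.
have [_ _ _ [k0 k00 Kpos]] := K_perm.
have [i1 _] := L2V_dotp_integrable mOm f2 g2.
have m1 : measurable_fun Om (fun x => dotp (flux (wgrad Om q) x) (wgrad Om q x)).
  by apply/measurable_EFinP; case/integrableP: i1.
pose h x := Num.max 0 (dotp (flux (wgrad Om q) x) (wgrad Om q x)).
have mh : measurable_fun Om h by apply: measurable_maxr; [exact: measurable_cst|].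
have -> : darcy_form Om K q q = Rintegral leb Om h.
  congr fine; apply: ae_eq_integral => //; [exact/measurable_EFinP|exact/measurable_EFinP|].
  apply: filterS Kpos => x hx Ox; rewrite /h max_r//.
  apply: le_trans (hx Ox (wgrad Om q x)).
  by rewrite mulr_ge0 ?(ltW k00)// exprn_ge0// enorm_ge0.
by apply: Rintegral_ge0 => x _; rewrite /h le_max lexx.
Qed.

End darcy_form.

(** * Dependence on the values in the domain only *)

Section locality.
Context {R : realType} {d : nat}.
Variables (Om : set 'rV[R]_d) (sg : {measure set 'rV[R]_d -> \bar R}).
Local Notation leb := (lebesgue_rV d).
Implicit Types u v : 'rV[R]_d -> 'rV[R]_d.

Lemma cpnt_local u v i : (forall x, Om x -> u x = v x) ->
  forall x, Om x -> cpnt u i x = cpnt v i x.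
Proof. by move=> uv x Ox; rewrite /cpnt uv. Qed.

Lemma jacobian_local u v : (forall x, Om x -> u x = v x) ->
  Defs.jacobian Om u = Defs.jacobian Om v.
Proof.
move=> uv; apply/funext => x; apply/matrixP => i j.
by rewrite [LHS]mxE [RHS]mxE (wgrad_local (cpnt_local i uv)).
Qed.

Lemma sym_grad_local u v : (forall x, Om x -> u x = v x) -> sym_grad Om u = sym_grad Om v.
Proof. by move=> uv; rewrite /sym_grad (jacobian_local uv). Qed.

Lemma divg_local u v : (forall x, Om x -> u x = v x) -> divg Om u = divg Om v.
Proof. by move=> uv; rewrite /divg (jacobian_local uv). Qed.

Lemma bdtraceV_local u v : (forall x, Om x -> u x = v x) ->
  bdtraceV Om sg u = bdtraceV Om sg v.
Proof.
move=> uv; apply/funext => x; apply/rowP => i.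
by rewrite [LHS]mxE [RHS]mxE (bdtrace_local sg (cpnt_local i uv)).
Qed.

Lemma elastic_form_local G lam u u' v v' : (forall x, Om x -> u x = u' x) ->
  (forall x, Om x -> v x = v' x) -> elastic_form Om G lam u v = elastic_form Om G lam u' v'.
Proof.
move=> uu vv; rewrite /elastic_form (sym_grad_local uu) (sym_grad_local vv).
by rewrite (divg_local uu) (divg_local vv).
Qed.

Lemma load_form_local Gn f b u v : (forall x, Om x -> u x = v x) ->
  load_form Om sg Gn f b u = load_form Om sg Gn f b v.
Proof.
move=> uv; rewrite /load_form (bdtraceV_local uv); congr (_ + _).
by apply: eq_Rintegral => x /set_mem /uv ->.
Qed.

End locality.

(** * Finite element spaces *)

Lemma bilinear_onS (R : realType) (V : lmodType R) (W W' : set V) (a : V -> V -> R) :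
  W' `<=` W -> bilinear_on W a -> bilinear_on W' a.
Proof.
by move=> WW ba z /WW Wz; split=> k x y /WW Wx /WW Wy;
  [exact: (ba z Wz).1|exact: (ba z Wz).2].
Qed.

Lemma semi_innerS (R : realType) (V : lmodType R) (W W' : set V) (s : V -> V -> R) :
  W' `<=` W -> semi_inner W s -> semi_inner W' s.
Proof.
move=> WW [bl sl pl]; split; first exact: bilinear_onS bl.
  by move=> x y /WW Wx /WW Wy; exact: sl.
by move=> x /WW Wx; exact: pl.
Qed.

Section finite_element_spaces.
Context {R : realType} {d : nat}.
Variables (Om : set 'rV[R]_d) (sg : {measure set 'rV[R]_d -> \bar R}).
Hypotheses (Om_open : open Om) (mGam : measurable (boundary Om)).
Variables (Th : triangulation R d) (Th_conf : conforming Om Th).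
Variables (k1 k2 : nat) (Gd Gp : set 'rV[R]_d).
Local Notation leb := (lebesgue_rV d).
Local Notation VF := ('rV[R]_d -> 'rV[R]_d).
Local Notation QF := ('rV[R]_d -> R).

Let Vh : set VF := fe_spaceV Th k1 (H1_zeroV Om sg Gd).
Let Qh : set QF := fe_space Th k2 (H1_zero Om sg Gp).

Lemma fe_space_subspace : subspace Qh.
Proof.
have sH := H1_zero_subspace sg Om_open mGam Gp.
split; first by split; [exact: sH.1|move=> c; exact: poly_on0].
move=> k x y [Hx Px] [Hy Py]; split; first exact: (sH.2 k x y Hx Hy).
by move=> c; exact: (poly_on_linear k (Px c) (Py c)).
Qed.

Lemma fe_spaceV_subspace : subspace Vh.
Proof.
have sH := H1_zeroV_subspace sg Om_open mGam Gd.
split.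
  split; first exact: sH.1.
  move=> c i; have -> : cpnt (0 : VF) i = 0 by apply/funext => x; rewrite /cpnt mxE.
  exact: poly_on0.
move=> k x y [Hx Px] [Hy Py]; split; first exact: (sH.2 k x y Hx Hy).
by move=> c i; rewrite cpnt_linear; exact: (poly_on_linear k (Px c i) (Py c i)).
Qed.

Lemma fe_spaceV_trace : Vh `<=` has_traceV Om sg.
Proof. by move=> v [Hv _]; exact: (H1_zeroV_has_trace Hv). Qed.

Lemma fe_space_H1 : Qh `<=` H1 Om.
Proof. by move=> q [Hq _]; exact: (has_trace_H1 (H1_zero_has_trace Hq)). Qed.

Lemma fe_space_L2 : Qh `<=` L2 leb Om.
Proof. by move=> q /fe_space_H1[]. Qed.

Let mOm : measurable Om. Proof. exact: open_measurable_rV. Qed.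

Lemma fe_space_definite q : Qh q -> ip leb Om q q = 0 -> forall x, closure Om x -> q x = 0.
Proof.
move=> Qq q0; apply: (piecewise_polynomial_null Om_open Th_conf Qq.2).
exact: (ip0_ae mOm (fe_space_L2 Qq) q0).
Qed.

(** The inner product of [H^1] only controls functions up to null sets of the
    domain; on finite elements it determines them on the closed domain. *)
Lemma fe_spaceV_definite v : Vh v -> H1ipV Om v v = 0 ->
  forall x, closure Om x -> v x = 0.
Proof.
move=> Vv v0 x Ox; have tv := fe_spaceV_trace Vv.
have [_ _ p1] := H1ip_semi_inner Om_open.
have [_ _ p2] := ip_semi_inner leb mOm.
have [_ _ p3] := ipV_semi_inner leb d mOm.
have Hv i : H1 Om (cpnt v i) by exact: (has_trace_H1 (tv i)).
apply/rowP => i; rewrite mxE.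
have vi : H1ip Om (cpnt v i) (cpnt v i) = 0.
  move/eqP: v0; rewrite psumr_eq0 => [/allP h|k _]; last exact: p1 (Hv k).
  by have := h i; rewrite mem_index_enum => /(_ isT)/eqP.
have vi2 : L2 leb Om (cpnt v i) by case: (Hv i).
have i0 : ip leb Om (cpnt v i) (cpnt v i) = 0.
  have h1 := p2 _ vi2; have h2 := p3 _ (wgrad_L2 (Hv i)).
  apply/eqP; rewrite eq_le h1 andbT; move: vi; rewrite /H1ip; lra.
exact: (piecewise_polynomial_null Om_open Th_conf (fun c => Vv.2 c i) (ip0_ae mOm vi2 i0) Ox).
Qed.

Definition vanishing : set (VF * QF) :=
  [set z | forall x, closure Om x -> z.1 x = 0 /\ z.2 x = 0].

Lemma vanishing_subspace : subspace vanishing.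
Proof.
split=> [x _//|k z y hz hy x Ox].
have [z1 z2] := hz x Ox; have [y1 y2] := hy x Ox; split.
  by rewrite -[LHS]/(k *: z.1 x + y.1 x) z1 y1 scaler0 addr0.
by rewrite -[LHS]/(k *: z.2 x + y.2 x) z2 y2 scaler0 addr0.
Qed.

Definition fe_index : finType :=
  (('I_d * ('I_(ncells Th) * {ffun 'I_d -> 'I_k1.+1})) +
   ('I_(ncells Th) * {ffun 'I_d -> 'I_k2.+1}))%type.

Definition fe_reconstruct (c : fe_index -> R) : VF * QF :=
  (fun x => \row_i reconstruct (fun lm => c (inl (i, lm))) x,
   reconstruct (fun lm => c (inr lm))).

Lemma fe_reconstruct_linear a c c' :
  fe_reconstruct (a *: c + c') = a *: fe_reconstruct c + fe_reconstruct c'.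
Proof.
rewrite /fe_reconstruct; congr pair.
  apply/funext => x; apply/rowP => i.
  rewrite -[RHS]/((a *: (\row_i reconstruct (fun lm => c (inl (i, lm))) x) +
    \row_i reconstruct (fun lm => c' (inl (i, lm))) x) ord0 i) !mxE.
  exact: (congr1 (fun f : QF => f x) (reconstruct_linear a (fun lm => c (inl (i, lm)))
    (fun lm => c' (inl (i, lm))))).
exact: (reconstruct_linear a (fun lm => c (inr lm)) (fun lm => c' (inr lm))).
Qed.

Lemma fe_reconstructP v q : Vh v -> Qh q ->
  exists c, vanishing ((v, q) - fe_reconstruct c).
Proof.
move=> [_ Pv] [_ Pq].
have /choice[cv cvP] : forall i, exists c, forall x, closure Om x ->
    cpnt v i x = @reconstruct _ _ Th k1 c x.
  by move=> i; exact: (reconstructP Th_conf (fun l => Pv l i)).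
have [cq cqP] := reconstructP Th_conf Pq.
exists (fun t => match t with inl (i, lm) => cv i lm | inr lm => cq lm end).
move=> x Ox; split.
  rewrite -[LHS]/(v x - \row_i reconstruct (cv i) x).
  by apply/rowP => i; rewrite !mxE -[v x ord0 i]/(cpnt v i x) cvP// subrr.
by rewrite -[LHS]/(q x - reconstruct cq x) cqP// subrr.
Qed.

Lemma vanishing_null v q : vanishing (v, q) -> H1ipV Om v v = 0 /\ ip leb Om q q = 0.
Proof.
have sub x : Om x -> closure Om x by exact: subset_closure.
move=> z; split.
  have vv x : Om x -> v x = (0 : VF) x by move=> /sub /z[].
  have [bl _ _] := H1ipV_semi_inner sg Om_open.
  have sT := has_traceV_subspace sg Om_open mGam.
  have -> : H1ipV Om v v = H1ipV Om 0 0.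
    apply: eq_bigr => i _; rewrite /H1ip (wgrad_local (cpnt_local i vv)); congr (_ + _).
    by apply: eq_Rintegral => x /set_mem Ox; rewrite (cpnt_local i vv Ox).
  exact (linear_on0 sT (bl _ sT.1).1).
have [bl _ _] := ip_semi_inner leb mOm; have sL := L2_subspace leb mOm.
have -> : ip leb Om q q = ip leb Om 0 0.
  by apply: eq_Rintegral => x /set_mem Ox; have [_ /= ->] := z x (sub _ Ox).
exact (linear_on0 sL (bl _ sL.1).1).
Qed.

End finite_element_spaces.

(** * One time step *)

Section time_step.
Context {R : realType} {d : nat}.
Variables (Om : set 'rV[R]_d) (sg : {measure set 'rV[R]_d -> \bar R}).
Hypotheses (Om_open : open Om) (mGam : measurable (boundary Om)).
Variables (Th : triangulation R d) (Th_conf : conforming Om Th).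
Variables (k1 k2 : nat) (Gd Gp Gn Gc : set 'rV[R]_d).
Hypotheses (mGn : measurable Gn) (GnG : Gn `<=` boundary Om)
  (mGc : measurable Gc) (GcG : Gc `<=` boundary Om).
Variable nu : 'rV[R]_d -> 'rV[R]_d.
Hypotheses (nu_meas : measurable_fun (boundary Om) nu)
  (nu_unit : {ae sg, forall x, boundary Om x -> enorm (nu x) = 1}).
Variables (G lam gam alpha c0 mu cp mufr : R).
Hypotheses (c0_gt0 : 0 < c0) (mu_gt0 : 0 < mu) (cp_ge0 : 0 <= cp) (mufr_ge0 : 0 <= mufr).
Variables (K : 'rV[R]_d -> 'M[R]_d) (K_perm : permeability Om K).
Variables (Ctau : R) (Ctau_ge0 : 0 <= Ctau) (Ctau_trace : trace_inequality Om sg Ctau).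
Variables (alphaA alphaB : R) (alphaA_gt0 : 0 < alphaA) (alphaB_gt0 : 0 < alphaB).
Hypotheses (A_coercive : coercive Om (H1_zeroV Om sg Gd) (elastic_form Om G lam) alphaA)
  (B_coercive : coercive Om (H1_zeroV Om sg Gd) (viscous_form Om gam) alphaB).
Variables (f b : 'rV[R]_d -> 'rV[R]_d) (psi g : 'rV[R]_d -> R).
Local Notation leb := (lebesgue_rV d).
Hypotheses (f2 : L2V leb Om f) (b2 : L2V sg Gn b) (psi2 : L2 leb Om psi) (g2 : L2 sg Gc g).
Variables (dt : R) (dt_gt0 : 0 < dt).
Let CJ := Ctau ^+ 2 * (1 + mufr) * cp.
Hypothesis small : CJ < alphaA + alphaB / dt.

Local Notation VF := ('rV[R]_d -> 'rV[R]_d).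
Local Notation QF := ('rV[R]_d -> R).
Let Vh : set VF := fe_spaceV Th k1 (H1_zeroV Om sg Gd).
Let Qh : set QF := fe_space Th k2 (H1_zero Om sg Gp).

Let A : VF -> VF -> R := elastic_form Om G lam.
Let B : VF -> VF -> R := viscous_form Om gam.
Let J : VF -> VF -> R := contact_form Om sg nu Gc cp mufr g.
Let D : QF -> QF -> R := darcy_form Om K.
Let F : VF -> R := load_form Om sg Gn f b.
Let c (q : QF) (v : VF) := ip leb Om q (divg Om v).
Let l (q : QF) := ip leb Om psi q.
Let sV : VF -> VF -> R := H1ipV Om.
Let mQ : QF -> QF -> R := ip leb Om.
Let CJ_ge0 : 0 <= CJ.
Proof.
apply: (mulr_ge0 _ cp_ge0); apply: (mulr_ge0 (sqr_ge0 _)).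
exact: (addr_ge0 ler01 mufr_ge0).
Qed.

Let mOm : measurable Om. Proof. exact: open_measurable_rV. Qed.

Let sVh : subspace Vh. Proof. exact: fe_spaceV_subspace. Qed.
Let sQh : subspace Qh. Proof. exact: fe_space_subspace. Qed.
Let VhT : Vh `<=` has_traceV Om sg. Proof. exact: fe_spaceV_trace. Qed.
Let QhH : Qh `<=` H1 Om. Proof. exact: fe_space_H1. Qed.
Let QhL : Qh `<=` L2 leb Om. Proof. exact: fe_space_L2. Qed.

Let siV : semi_inner Vh sV.
Proof. exact (semi_innerS VhT (H1ipV_semi_inner sg Om_open)). Qed.

Let siQ : semi_inner Qh mQ.
Proof. exact (semi_innerS QhL (ip_semi_inner leb mOm)). Qed.

Let bA : bilinear_on Vh A.
Proof. exact (bilinear_onS VhT (elastic_form_bilinear Om_open mGam G lam)). Qed.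

Let BE : B = elastic_form Om (gam / 2) gam.
Proof. by apply/funext => u; apply/funext => v; exact: viscous_formE. Qed.

Let bB : bilinear_on Vh B.
Proof. by rewrite BE; exact (bilinear_onS VhT (elastic_form_bilinear Om_open mGam _ _)). Qed.

Let bD : bilinear_on Qh D.
Proof. exact (bilinear_onS QhH (darcy_form_bilinear Om_open K_perm)). Qed.

Let lc1 v : Vh v -> linear_on Qh (c ^~ v).
Proof.
move=> Vv k x y Qx Qy; have [bl _ _] := ip_semi_inner leb mOm.
exact: ((bl _ (divg_L2 Om_open (VhT Vv))).2 k _ _ (QhL Qx) (QhL Qy)).
Qed.

Let lc2 q : Qh q -> linear_on Vh (c q).
Proof.
move=> Qq k x y Vx Vy.
exact: (ip_divg_linear Om_open mGam (QhL Qq) k (VhT Vx) (VhT Vy)).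
Qed.

Let lF : linear_on Vh F.
Proof.
move=> k x y Vx Vy.
exact: (load_form_linear Om_open mGam Ctau_trace mGn GnG f2 b2 k (VhT Vx) (VhT Vy)).
Qed.

Let ll : linear_on Qh l.
Proof.
move=> k x y Qx Qy; have [bl _ _] := ip_semi_inner leb mOm.
exact: ((bl _ psi2).1 k _ _ (QhL Qx) (QhL Qy)).
Qed.

Let normV v : Vh v -> H1normV Om v ^+ 2 = sV v v.
Proof.
move=> Vv; rewrite (H1normVE Om_open (VhT Vv)).
exact: (seminorm_sqr (H1ipV_semi_inner sg Om_open) (VhT Vv)).
Qed.

Let Acoer v : Vh v -> alphaA * sV v v <= A v v.
Proof. by move=> Vv; rewrite -normV//; apply: A_coercive; case: Vv. Qed.

Let Bcoer v : Vh v -> alphaB * sV v v <= B v v.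
Proof. by move=> Vv; rewrite -normV//; apply: B_coercive; case: Vv. Qed.

Let D_ge0 q : Qh q -> 0 <= D q q.
Proof. by move=> Qq; exact: (darcy_form_ge0 Om_open K_perm (QhH Qq)). Qed.

Let Jlip u : Vh u -> exists2 L, 0 <= L & forall v v', Vh v -> Vh v' ->
  J u v - J u v' <= L * seminorm sV (v - v').
Proof.
move=> Vu.
exists ((1 + mufr) * cp * Ctau * seminorm (ip sg Gc) (penetration Om sg nu g u)).
  apply: mulr_ge0 (sqrtr_ge0 _); apply: (mulr_ge0 _ Ctau_ge0).
  by apply: (mulr_ge0 _ cp_ge0); exact: (addr_ge0 ler01 mufr_ge0).
move=> v v' Vv Vv'.
exact: (contact_form_lipschitz Om_open mGam Ctau_ge0 Ctau_trace nu_meas nu_unit mGc GcG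
  g2 cp_ge0 mufr_ge0 (VhT Vu) (VhT Vv) (VhT Vv')).
Qed.

Let Jcvx u : Vh u -> convex_fct Vh (J u).
Proof.
move=> Vu t v v' Vv Vv' t01.
exact: (contact_form_convex Om_open mGam Ctau_trace nu_meas nu_unit mGc GcG
  g2 cp_ge0 mufr_ge0 (VhT Vu) (VhT Vv) (VhT Vv') t01).
Qed.

Let J4 u u' v v' : Vh u -> Vh u' -> Vh v -> Vh v' ->
  J u v - J u v' + J u' v' - J u' v <=
  CJ * seminorm sV (u - u') * seminorm sV (v - v').
Proof.
move=> Vu Vu' Vv Vv'.
exact: (contact_form_four_terms Om_open mGam Ctau_ge0 Ctau_trace nu_meas nu_unit mGc GcG
  g2 cp_ge0 mufr_ge0 (VhT Vu) (VhT Vu') (VhT Vv) (VhT Vv')).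
Qed.

(* Null vectors vanish on the domain, so that every form takes the value it has
   at the zero vector. *)
Let null_Om v : Vh v -> sV v v = 0 -> forall x, Om x -> v x = (0 : VF) x.
Proof.
move=> Vv v0 x Ox.
exact: (fe_spaceV_definite Om_open Th_conf Vv v0 (subset_closure Ox)).
Qed.

Let null_OmQ q : Qh q -> mQ q q = 0 -> forall x, Om x -> q x = (0 : QF) x.
Proof.
move=> Qq q0 x Ox.
exact: (fe_space_definite Om_open Th_conf Qq q0 (subset_closure Ox)).
Qed.

Let nullV v z : Vh v -> Vh z -> sV v v = 0 ->
  [/\ A z v = 0, A v z = 0, B z v = 0 & F v = 0].
Proof.
move=> Vv Vz /(null_Om Vv) v0.
have r (u : VF) : forall x, Om x -> u x = u x by [].
split.
- rewrite /A (elastic_form_local G lam (r z) v0).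
  exact (linear_on0 sVh (bA Vz).1).
- rewrite /A (elastic_form_local G lam v0 (r z)).
  exact (linear_on0 sVh (bA Vz).2).
- have := linear_on0 sVh (bB Vz).1; rewrite BE => h.
  by rewrite (elastic_form_local (gam / 2) gam (r z) v0).
- rewrite /F (load_form_local sg Gn f b v0).
  exact (linear_on0 sVh lF).
Qed.

Let nullc v q : Vh v -> Qh q -> sV v v = 0 -> c q v = 0.
Proof.
move=> Vv Qq /(null_Om Vv) v0; rewrite /c (divg_local v0).
exact (linear_on0 sVh (lc2 Qq)).
Qed.

Let nullQ q z v : Qh q -> Qh z -> Vh v -> mQ q q = 0 ->
  [/\ D z q = 0, c q v = 0 & l q = 0].
Proof.
move=> Qq Qz Vv /(null_OmQ Qq) q0.
have E (h : QF) : ip leb Om q h = ip leb Om 0 h.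
  by apply: eq_Rintegral => x /set_mem Ox; rewrite q0.
split.
- rewrite /D /darcy_form (wgrad_local q0).
  exact (linear_on0 sQh (bD Qz).1).
- rewrite /c E; exact (linear_on0 sQh (lc1 Vv)).
- rewrite /l ipC E ipC; exact (linear_on0 sQh ll).
Qed.

Local Notation coupled := (coupled_step Vh Qh mQ A B J D c F l alpha c0 mu dt).

Lemma QD_step_coupled u0 p0 u p : Vh u0 -> Qh p0 ->
  QD_step Om Vh Qh A B J D alpha c0 mu dt F psi u0 p0 u p <-> coupled u0 p0 u p.
Proof.
move=> Vu0 Qp0.
have E q : Vh u -> Qh p -> Qh q ->
    ip leb Om (fun x => c0 * ((p x - p0 x) / dt) +
      alpha * divg Om (fun x => dt^-1 *: (u x - u0 x)) x) q =
    c0 * mQ (dt^-1 *: (p - p0)) q + alpha * c q (dt^-1 *: (u - u0)).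
  move=> Vu Qp Qq; have [bl _ _] := ip_semi_inner leb mOm; have sL := L2_subspace leb mOm.
  have Vd : Vh (dt^-1 *: (u - u0)) by apply: subspaceZ => //; exact: subspaceB.
  have Qd : Qh (dt^-1 *: (p - p0)) by apply: subspaceZ => //; exact: subspaceB.
  have d2 := divg_L2 Om_open (VhT Vd).
  have q2 := QhL Qq; have p2 := QhL Qd.
  have ad2 : L2 leb Om (alpha *: divg Om (dt^-1 *: (u - u0)) : QF) by exact: (subspaceZ sL).
  rewrite /c [ip _ _ q _]ipC -(linear_onZ sL (bl _ q2).2 alpha d2).
  rewrite -((bl _ q2).2 c0 _ _ p2 ad2).
  by apply: eq_Rintegral => x _; congr ((c0 * _ + _) * _); rewrite mulrC.
split=> -[Vu Qp vi ve]; split=> //.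
- by move=> q Qq; rewrite -E//; exact: ve.
- by move=> q Qq; rewrite E//; exact: ve.
Qed.

Lemma QD_step_exists u0 p0 : Vh u0 -> Qh p0 ->
  exists u p, QD_step Om Vh Qh A B J D alpha c0 mu dt F psi u0 p0 u p.
Proof.
move=> Vu0 Qp0.
have [u [p up]] : exists u p, coupled u0 p0 u p.
  apply: (@coupled_step_exists R VF QF Vh Qh sV mQ sVh sQh siV siQ A B J D c F l
    alphaA alphaB alpha c0 mu dt CJ alphaA_gt0 alphaB_gt0 c0_gt0 mu_gt0 dt_gt0 CJ_ge0 small
    bA bB bD lc1 lc2 lF ll Acoer Bcoer D_ge0 Jlip Jcvx J4 nullV nullc nullQ u0 p0 Vu0 Qp0
    (fe_index Th k1 k2) (@fe_reconstruct _ _ Th k1 k2) (vanishing Om)).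
  - exact: vanishing_subspace.
  - exact: fe_reconstruct_linear.
  - by move=> v q Vv Qq; exact: (fe_reconstructP Th_conf Vv Qq).
  - by move=> v q _ _; exact: (vanishing_null sg Om_open mGam).
by exists u, p; apply/(QD_step_coupled _ _ Vu0 Qp0).
Qed.

(** The two steps may start from different functions, provided that these agree on
    the closed domain; this is what uniqueness of the whole sequence needs. *)
Lemma QD_step_unique u0 u0' p0 p0' u u' p p' :
  Vh u0 -> Vh u0' -> Qh p0 -> Qh p0' ->
  (forall x, closure Om x -> u0 x = u0' x /\ p0 x = p0' x) ->
  QD_step Om Vh Qh A B J D alpha c0 mu dt F psi u0 p0 u p ->
  QD_step Om Vh Qh A B J D alpha c0 mu dt F psi u0' p0' u' p' ->
  forall x, closure Om x -> u x = u' x /\ p x = p' x.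
Proof.
move=> Vu0 Vu0' Qp0 Qp0' agree0.
move=> /(QD_step_coupled _ _ Vu0 Qp0) s1 /(QD_step_coupled _ _ Vu0' Qp0') s2.
have [u00 p00] : sV (u0 - u0') (u0 - u0') = 0 /\ mQ (p0 - p0') (p0 - p0') = 0.
  apply: (vanishing_null sg Om_open mGam) => x Ox; have [e1 e2] := agree0 x Ox.
  split; first by rewrite -[LHS]/(u0 x - u0' x) e1 subrr.
  by rewrite -[LHS]/(p0 x - p0' x) e2 subrr.
have [du dp] := coupled_step_unique sVh sQh siV siQ c0_gt0 mu_gt0 dt_gt0 CJ_ge0 small
  bA bB bD lc1 lc2 lF Acoer Bcoer D_ge0 J4 nullV Vu0 Vu0' Qp0 Qp0' u00 p00 s1 s2.
have [Vu Qp _ _] := s1; have [Vu' Qp' _ _] := s2.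
move=> x Ox; split; apply/eqP; rewrite -subr_eq0; apply/eqP.
  exact: (fe_spaceV_definite Om_open Th_conf (subspaceB sVh Vu Vu') du Ox).
exact: (fe_space_definite Om_open Th_conf (subspaceB sQh Qp Qp') dp Ox).
Qed.

End time_step.

(** * The discrete problem *)

Theorem theorem4p5 (R : realType) (d : nat) (hd : d = 2%N \/ d = 3%N)
  (* domain, surface measure, outward unit normal *)
  (Om : set 'rV[R]_d) (Om_open : open Om) (Om_bounded : bounded_set Om)
  (Om_connected : connected Om) (Om_lipschitz : lipschitz_domain Om)
  (sg : {measure set 'rV[R]_d -> \bar R}) (sg_surface : surface_measure Om sg)
  (nu : 'rV[R]_d -> 'rV[R]_d) (nu_meas : measurable_fun (boundary Om) nu)
  (nu_normal : {ae sg, forall x, boundary Om x -> outward_unit_normal Om x (nu x)})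
  (* decompositions of the boundary *)
  (Gp Gf Gd Gn Gc : set 'rV[R]_d)
  (Gp_meas : measurable Gp) (Gf_meas : measurable Gf) (Gd_meas : measurable Gd)
  (Gn_meas : measurable Gn) (Gc_meas : measurable Gc)
  (G_pf : boundary Om = Gp `|` Gf) (G_pf_disj : Gp `&` Gf = set0)
  (G_dnc : boundary Om = Gd `|` Gn `|` Gc) (G_dn_disj : Gd `&` Gn = set0)
  (G_dc_disj : Gd `&` Gc = set0) (G_nc_disj : Gn `&` Gc = set0)
  (Gd_pos : (0 < sg Gd)%E) (Gp_pos : (0 < sg Gp)%E)
  (* constants and coefficients *)
  (G lam gam alpha c0 mu cp mufr : R)
  (G_gt0 : 0 < G) (lam_gt0 : 0 < lam) (gam_gt0 : 0 < gam)
  (alpha_gt0 : 0 < alpha) (c0_gt0 : 0 < c0) (mu_gt0 : 0 < mu)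
  (cp_gt0 : 0 < cp) (mufr_ge0 : 0 <= mufr)
  (K : 'rV[R]_d -> 'M[R]_d) (K_perm : permeability Om K)
  (Ctau : R) (Ctau_gt0 : 0 < Ctau) (Ctau_trace : trace_inequality Om sg Ctau)
  (alphaA alphaB : R) (alphaA_gt0 : 0 < alphaA) (alphaB_gt0 : 0 < alphaB)
  (A_coercive : coercive Om (H1_zeroV Om sg Gd) (elastic_form Om G lam) alphaA)
  (B_coercive : coercive Om (H1_zeroV Om sg Gd) (viscous_form Om gam) alphaB)
  (* time grid and data *)
  (T : R) (T_gt0 : 0 < T) (N : nat) (N_ge1 : (1 <= N)%N)
  (f b : R -> 'rV[R]_d -> 'rV[R]_d) (psi : R -> 'rV[R]_d -> R) (g : 'rV[R]_d -> R)
  (f_H1 : H1timeV (lebesgue_rV d) T Om f) (b_H1 : H1timeV sg T Gn b)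
  (psi_H1 : H1time (lebesgue_rV d) T Om psi) (g_L2 : L2 sg Gc g)
  (* finite elements *)
  (family : set (triangulation R d)) (family_regular : regular_family Om family)
  (Th : triangulation R d) (Th_family : family Th)
  (k1 k2 : nat) (k1_ge1 : (1 <= k1)%N) (k2_ge1 : (1 <= k2)%N)
  (* initial data and their interpolants *)
  (u0 u0h : 'rV[R]_d -> 'rV[R]_d) (p0 p0h : 'rV[R]_d -> R)
  (u0_V : H1_zeroV Om sg Gd u0) (p0_Q : H1_zero Om sg Gp p0) :
  let Vh := fe_spaceV Th k1 (H1_zeroV Om sg Gd) in
  let Qh := fe_space Th k2 (H1_zero Om sg Gp) in
  lagrange_interpolantV Om Th k1 Vh u0 u0h ->
  lagrange_interpolant Om Th k2 Qh p0 p0h ->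
  let dt := T / N%:R in
  let CJ := Ctau ^+ 2 * (1 + mufr) * cp in
  let step (n : nat) := QD_step Om Vh Qh (elastic_form Om G lam) (viscous_form Om gam)
    (contact_form Om sg nu Gc cp mufr g) (darcy_form Om K) alpha c0 mu dt
    (load_form Om sg Gn (f (n%:R * dt)) (b (n%:R * dt))) (psi (n%:R * dt)) in
  let solution (u : nat -> 'rV[R]_d -> 'rV[R]_d) (p : nat -> 'rV[R]_d -> R) :=
    [/\ u 0%N = u0h, p 0%N = p0h &
        forall n, (1 <= n <= N)%N -> step n (u n.-1) (p n.-1) (u n) (p n)] in
  let agree (u u' : 'rV[R]_d -> 'rV[R]_d) (p p' : 'rV[R]_d -> R) :=
    forall x, closure Om x -> u x = u' x /\ p x = p' x in
  (exists2 tau0 : R, 0 < tau0 &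
     forall tau, 0 < tau < tau0 -> alphaA + alphaB / tau > CJ) /\
  (alphaA + alphaB / dt > CJ ->
   (exists u p, solution u p) /\
   (forall u p, solution u p ->
      forall n, (1 <= n <= N)%N -> forall u' p',
        step n (u n.-1) (p n.-1) u' p' -> agree (u n) u' (p n) p') /\
   (forall u p u' p', solution u p -> solution u' p' ->
      forall n, (n <= N)%N -> agree (u n) (u' n) (p n) (p' n))).
Proof.
move=> Vh Qh [Vu0h _] [Qp0h _] dt CJ step solution agree.
have mGam : measurable (boundary Om) by rewrite G_pf; exact: measurableU.
have GnG : Gn `<=` boundary Om by rewrite G_dnc => x Gx; left; right.
have GcG : Gc `<=` boundary Om by rewrite G_dnc => x Gx; right.
have nu_unit : {ae sg, forall x, boundary Om x -> enorm (nu x) = 1}.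
  by apply: filterS nu_normal => x h /h[].
have Th_conf : conforming Om Th by case: family_regular => h _; exact: h.
have dt0 : 0 < dt by rewrite divr_gt0// ltr0n.
have tn n : (n <= N)%N -> 0 <= n%:R * dt <= T.
  move=> nN; rewrite mulr_ge0 ?(ltW dt0)//= /dt mulrCA ger_pMr//.
  by rewrite ler_pdivrMr ?ltr0n// mul1r ler_nat.
split.
  (* below this step [alphaB / tau] alone exceeds [CJ] *)
  exists (alphaB / (`|CJ| + 1)); first by rewrite divr_gt0// ltr_wpDl.
  have CJ1 : 0 < `|CJ| + 1 by rewrite ltr_wpDl.
  move=> tau /andP[tau0]; rewrite (ltr_pdivlMr _ _ CJ1) => h.
  have h2 : `|CJ| + 1 < alphaB / tau by rewrite (ltr_pdivlMr _ _ tau0) mulrC.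
  have h1 := ler_norm CJ; lra.
move=> small.
have f2 n : (n <= N)%N -> L2V (lebesgue_rV d) Om (f (n%:R * dt)).
  by move=> /tn t i; case: (f_H1 i) => _ _ h _; exact: h.
have b2 n : (n <= N)%N -> L2V sg Gn (b (n%:R * dt)).
  by move=> /tn t i; case: (b_H1 i) => _ _ h _; exact: h.
have psi2 n : (n <= N)%N -> L2 (lebesgue_rV d) Om (psi (n%:R * dt)).
  by move=> /tn t; case: psi_H1 => _ _ h _; exact: h.
have step_spaces n u p u' p' : step n u p u' p' -> Vh u' /\ Qh p' by case.
have step_exists n u p : (n <= N)%N -> Vh u -> Qh p -> exists u' p', step n u p u' p'.
  move=> nN Vu Qp.
  exact: (QD_step_exists Om_open mGam Th_conf Gn_meas GnG Gc_meas GcG nu_meas nu_unit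
    alpha c0_gt0 mu_gt0 (ltW cp_gt0) mufr_ge0 K_perm (ltW Ctau_gt0) Ctau_trace
    alphaA_gt0 alphaB_gt0 A_coercive B_coercive (f2 n nN) (b2 n nN) (psi2 n nN) g_L2
    dt0 small Vu Qp).
have step_unique n u0' u0'' p0' p0'' u' u'' p' p'' : (n <= N)%N ->
    Vh u0' -> Vh u0'' -> Qh p0' -> Qh p0'' -> agree u0' u0'' p0' p0'' ->
    step n u0' p0' u' p' -> step n u0'' p0'' u'' p'' -> agree u' u'' p' p''.
  move=> nN Vu Vu' Qp Qp' ag s1 s2.
  exact: (QD_step_unique Om_open mGam Th_conf Gn_meas GnG Gc_meas GcG nu_meas nu_unit
    c0_gt0 mu_gt0 (ltW cp_gt0) mufr_ge0 K_perm (ltW Ctau_gt0) Ctau_trace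
    A_coercive B_coercive (f2 n nN) (b2 n nN) g_L2 dt0 small Vu Vu' Qp Qp' ag s1 s2).
have sol_spaces u p n : solution u p -> (n <= N)%N -> Vh (u n) /\ Qh (p n).
  move=> [u0E p0E us]; case: n => [_|n nN]; first by rewrite u0E p0E.
  exact: step_spaces (us n.+1 nN).
split; last split.
- have /choice[nxt nxtP] : forall t : nat * ('rV[R]_d -> 'rV[R]_d) * ('rV[R]_d -> R),
      exists up : ('rV[R]_d -> 'rV[R]_d) * ('rV[R]_d -> R),
      (t.1.1 <= N)%N -> Vh t.1.2 -> Qh t.2 -> step t.1.1 t.1.2 t.2 up.1 up.2.
    move=> [[n u] p]; have [[nN [Vu Qp]]|no] := pselect ((n <= N)%N /\ Vh u /\ Qh p).
      by have [u' [p' s']] := step_exists n u p nN Vu Qp; exists (u', p').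
    (* an arbitrary value; the iterates stay in the discrete spaces *)
    by exists (u, p) => nN Vu Qp; case: no.
  pose sol := fix sol n := if n is m.+1 then nxt (n, (sol m).1, (sol m).2) else (u0h, p0h).
  have sol_step n : (n <= N)%N -> (Vh (sol n).1 /\ Qh (sol n).2) /\
      ((1 <= n)%N -> step n (sol n.-1).1 (sol n.-1).2 (sol n).1 (sol n).2).
    elim: n => [//|n IH] nN; have [[Vn Qn] _] := IH (ltnW nN).
    have sn := nxtP (n.+1, (sol n).1, (sol n).2) nN Vn Qn.
    by split=> [|_]; [exact: step_spaces sn|exact: sn].
  exists (fun n => (sol n).1), (fun n => (sol n).2); split; [exact: erefl|exact: erefl|].
  by move=> n /andP[n1 nN]; exact ((sol_step n nN).2 n1).
- move=> u p us n /andP[n1 nN] u' p' s'.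
  have nN' : (n.-1 <= N)%N by rewrite (leq_trans (leq_pred n)).
  have [Vu Qp] := sol_spaces _ _ _ us nN'.
  have [_ _ usn] := us.
  have sn : step n (u n.-1) (p n.-1) (u n) (p n) by apply: usn; rewrite n1.
  by apply: (step_unique n _ _ _ _ _ _ _ _ nN Vu Vu Qp Qp _ sn s').
- move=> u p u' p' us us'; elim=> [_|n IH nN].
    by have [-> -> _] := us; have [-> -> _] := us'.
  have [Vu Qp] := sol_spaces _ _ _ us (ltnW nN).
  have [Vu' Qp'] := sol_spaces _ _ _ us' (ltnW nN).
  have [_ _ usn] := us; have [_ _ usn'] := us'.
  exact: (step_unique n.+1 _ _ _ _ _ _ _ _ nN Vu Vu' Qp Qp' (IH (ltnW nN))
    (usn n.+1 nN) (usn' n.+1 nN)).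
Qed.
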